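(* Let $s>0$ be an integer and let $B_{z^s\overline{z}^s}$ be the H-Toeplitz operator on the Bergman space $L^2_a(\mathbb{D})$ with symbol $z^s\overline{z}^s$. (a) If $s=2^k-1$ for some $k\in\mathbb{N}$, then $B^*_{z^s\overline{z}^s}$ is the direct sum of a one-dimensional normal operator and an infinite family of weighted shifts, each of which is subnormal. (b) If $2^k-1<s<2^{k+1}-1$ for some $k\in\mathbb{N}$, then $B^*_{z^s\overline{z}^s}$ is the direct sum of a one-dimensional normal operator and an infinite family of weighted shifts, each of which is at least $k$-hyponormal. In either case $B_{z^s\overline{z}^s}$ is not hyponormal, and both $B^*_{z^s\overline{z}^s}$ and $B_{z^s\overline{z}^s}$ are contractive.
   Context: $\mathbb{N}=\{1,2,\dots\}$. $\mathbb{D}$ is the open unit disk and $L^2(\mathbb{D})$ has inner product $\langle f,g\rangle=\frac1\pi\int_{\mathbb{D}}f\overline{g}\,dA$, with $dA$ area measure. The Bergman space $L^2_a(\mathbb{D})$ is the closed subspace of analytic functions in $L^2(\mathbb{D})$, with orthonormal basis $e_n(z)=\sqrt{n+1}\,z^n$, $n\ge 0$; $P$ is the orthogonal projection of $L^2(\mathbb{D})$ onto $L^2_a(\mathbb{D})$. $L^2_{harm}(\mathbb{D})$ is the closed subspace of complex-valued harmonic functions in $L^2(\mathbb{D})$. The bounded linear operator $K:L^2_a(\mathbb{D})\to L^2_{harm}(\mathbb{D})$ is defined by $K(e_{2n})=e_n$ and $K(e_{2n+1})=\overline{e_{n+1}}$ for all $n\ge0$. For $\varphi\in L^\infty(\mathbb{D})$,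 the H-Toeplitz operator $B_\varphi:L^2_a(\mathbb{D})\to L^2_a(\mathbb{D})$ is $B_\varphi(f)=P(\varphi\cdot K(f))$, with Hilbert space adjoint $B_\varphi^*$. A (unilateral) weighted shift with bounded positive weight sequence $(\alpha_n)_{n\ge0}$ is an operator $W$ with $Wu_n=\alpha_n u_{n+1}$ for an orthonormal basis $(u_n)_{n\ge0}$ of its space; its moments are $\gamma_0=1$, $\gamma_n=\prod_{j=0}^{n-1}\alpha_j^2$. It is $k$-hyponormal if for each $n\ge0$ the $(k+1)\times(k+1)$ Hankel matrix $(\gamma_{n+i+j})_{0\le i,j\le k}$ is positive semidefinite. An operator $T$ is hyponormal if $T^*T-TT^*\ge0$, and subnormal if it is the restriction of a normal operator to an invariant subspace. ''Contractive'' means operator norm at most $1$. Direct sums are orthogonal direct sums over reducing subspaces. *)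

(* Defs.v *)
From HB Require Import structures.
From mathcomp Require Import all_boot all_order all_algebra complex.
From mathcomp Require Import all_classical all_reals all_analysis.

Set Implicit Arguments.
Unset Strict Implicit.
Unset Printing Implicit Defensive.
Import Order.TTheory GRing.Theory Num.Theory.
Import numFieldNormedType.Exports.

Local Open Scope classical_set_scope.
Local Open Scope ring_scope.
Local Open Scope complex_scope.

(** * Operators on Hilbert spaces

    A Hilbert space is given by a set [H] of vectors of an ambient complex
    vector space [V] together with a form [ip : V -> V -> R[i]], linear in its
    first argument, of which only the values on [H] matter.  An operator is a
    map [V -> V], of which only the values on the space it acts on matter, so
    that the restriction of [T] to an invariant subspace [M] is [T] itself,
    considered on [M]. *)

Section Spaces.
Variables (R : realType) (V : lmodType R[i]) (ip : V -> V -> R[i]).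
Implicit Types (H M : set V) (T S : V -> V).

Definition subspace M : Prop :=
  M 0 /\ forall (a : R[i]) u v, M u -> M v -> M (a *: u + v).

Definition ipnorm (u : V) : R := Num.sqrt (complex.Re (ip u u)).

Definition cvg_in_norm (x : nat -> V) (l : V) : Prop :=
  (fun n => ipnorm (x n - l)) @ \oo --> (0 : R).

Definition cauchy_in_norm (x : nat -> V) : Prop :=
  forall e : R, 0 < e -> exists N : nat,
    forall m n : nat, (N <= m)%N -> (N <= n)%N -> ipnorm (x m - x n) < e.

Record hilbert H : Prop := Hilbert {
  hilbert_subspace : subspace H ;
  hilbert_linear : forall (a : R[i]) u v w, H u -> H v -> H w ->
    ip (a *: u + v) w = a * ip u w + ip v w ;
  hilbert_conj : forall u v, H u -> H v -> ip v u = conjc (ip u v) ;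
  hilbert_definite : forall u, H u -> u <> 0 -> 0 < ip u u ;
  hilbert_complete : forall x : nat -> V, (forall n, H (x n)) ->
    cauchy_in_norm x -> exists2 l, H l & cvg_in_norm x l }.

Definition closed_subspace H M : Prop :=
  [/\ subspace M, M `<=` H
    & forall (x : nat -> V) l,
        (forall n, M (x n)) -> H l -> cvg_in_norm x l -> M l].

Definition reducing H T M : Prop :=
  [/\ closed_subspace H M,
      forall u, M u -> M (T u)
    & forall u, H u -> (forall v, M v -> ip u v = 0) ->
        forall v, M v -> ip (T u) v = 0].

(** [T] is the orthogonal direct sum of its restrictions to the [M i]. *)
Definition orthogonal_sum (I : eqType) H T (M : I -> set V) : Prop :=
  [/\ forall i, reducing H T (M i),
      forall i j u v, i != j -> M i u -> M j v -> ip u v = 0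
    & forall f, H f -> forall e : R, 0 < e ->
        exists (r : seq I) (g : I -> V),
          (forall i, M i (g i)) /\ ipnorm (f - \sum_(i <- r) g i) < e].

Definition orthonormal_basis M (u : nat -> V) : Prop :=
  [/\ forall n, M (u n),
      forall m n, ip (u m) (u n) = (m == n)%:R
    & forall f, M f -> forall e : R, 0 < e ->
        exists (n : nat) (c : nat -> R[i]),
          ipnorm (f - \sum_(i < n) c i *: u i) < e].

Definition one_dimensional M : Prop :=
  exists2 v, v <> 0 & M = [set c *: v | c in [set: R[i]]].

End Spaces.

Definition bounded_operator (R : realType) (V1 V2 : lmodType R[i])
    (ip1 : V1 -> V1 -> R[i]) (ip2 : V2 -> V2 -> R[i])
    (H1 : set V1) (H2 : set V2) (T : V1 -> V2) : Prop :=
  [/\ forall u, H1 u -> H2 (T u),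
      forall (a : R[i]) u v, H1 u -> H1 v -> T (a *: u + v) = a *: T u + T v
    & exists c : R, forall u, H1 u -> ipnorm ip2 (T u) <= c * ipnorm ip1 u].

Section Operators.
Variables (R : realType) (V : lmodType R[i]) (ip : V -> V -> R[i]).
Implicit Types (H M : set V) (T S : V -> V).

Definition is_adjoint H T S : Prop :=
  bounded_operator ip ip H H S /\
  forall u v, H u -> H v -> ip (T u) v = ip u (S v).

Definition normal_operator H T : Prop :=
  bounded_operator ip ip H H T /\
  exists2 S, is_adjoint H T S & forall u, H u -> S (T u) = T (S u).

Definition hyponormal H T : Prop :=
  bounded_operator ip ip H H T /\
  exists2 S, is_adjoint H T S &
    forall u, H u -> 0 <= ip (S (T u) - T (S u)) u.

Definition opnorm H T : R :=
  sup [set ipnorm ip (T u) | u in [set u | H u /\ ipnorm ip u <= 1]].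

(** The boundedness requirement matters: [sup] of an unbounded set is [0]. *)
Definition contractive H T : Prop :=
  bounded_operator ip ip H H T /\ opnorm H T <= 1.

Definition weighted_shift M T (alpha : nat -> R) : Prop :=
  [/\ forall n, 0 < alpha n,
      exists c : R, forall n, alpha n <= c
    & exists2 u : nat -> V, orthonormal_basis ip M u &
        forall n, T (u n) = (alpha n)%:C *: u n.+1].

End Operators.

(** The Hilbert space of the normal extension [N] is all of [V']; the space [H]
    is identified with its image under the isometric embedding [J]. *)
Definition subnormal (R : realType) (V : lmodType R[i])
    (ip : V -> V -> R[i]) (H : set V) (T : V -> V) : Prop :=
  bounded_operator ip ip H H T /\
  exists (V' : lmodType R[i]) (ip' : V' -> V' -> R[i]) (N : V' -> V')
         (J : V -> V'),
    [/\ hilbert ip' [set: V'],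
        normal_operator ip' [set: V'] N,
        forall (a : R[i]) u v, H u -> H v -> J (a *: u + v) = a *: J u + J v,
        forall u v, H u -> H v -> ip' (J u) (J v) = ip u v
      & forall u, H u -> N (J u) = J (T u)].

Section KHyponormal.
Variables (R : realType) (alpha : nat -> R).

Definition moment (n : nat) : R := \prod_(j < n) alpha j ^+ 2.

Definition psd (n : nat) (A : 'M[R]_n) : Prop :=
  A^T = A /\ forall x : 'cV[R]_n, 0 <= (x^T *m A *m x) 0 0.

Definition k_hyponormal (k : nat) : Prop :=
  forall n : nat, psd (\matrix_(i < k.+1, j < k.+1) moment (n + i + j)).

End KHyponormal.

(** [T] is the direct sum of a one-dimensional normal operator, acting on the
    summand with index [None], and of infinitely many weighted shifts, acting
    on the summands with indices [Some i], each satisfying [Q] as a function of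
    the summand and of the weights. *)
Definition normal_plus_shifts (R : realType) (V : lmodType R[i])
    (ip : V -> V -> R[i]) (H : set V) (T : V -> V)
    (Q : set V -> (nat -> R) -> Prop) : Prop :=
  exists (M : option nat -> set V) (alpha : nat -> nat -> R),
    [/\ orthogonal_sum ip H T M,
        one_dimensional (M None),
        normal_operator ip (M None) T
      & forall i, weighted_shift ip (M (Some i)) T (alpha i) /\
                  Q (M (Some i)) (alpha i)].

(** * Function spaces on the unit disk

    Functions on the disk are represented by functions on the whole plane that
    vanish outside of it.  Elements of [L2disk] are functions rather than
    almost-everywhere classes, so [dot] is only semidefinite on [L2disk]; it is
    definite on [bergman] and [L2harm], whose elements are continuous on the
    disk. *)

Section Disk.
Variable R : realType.
Local Notation C := R[i].
Local Notation V := (C -> C^o).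
Implicit Types (f g phi : V).

Definition plane (p : R * R) : C := p.1 +i* p.2.

Definition re_part f (p : R * R) : R := complex.Re (f (plane p)).
Definition im_part f (p : R * R) : R := complex.Im (f (plane p)).

Definition disk : set C := [set z | `|z| < 1].

Definition disk2 : set (R * R) := plane @^-1` disk.

Definition area := (@lebesgue_measure R \x @lebesgue_measure R)%E.

Definition disk_integral f : C :=
  Rintegral area disk2 (re_part f) +i* Rintegral area disk2 (im_part f).

Definition dot f g : C :=
  (pi^-1)%:C * disk_integral (fun z => f z * conjc (g z)).

Definition L2disk : set V := [set f : V |
  [/\ forall z, ~ disk z -> f z = 0,
      measurable_fun disk2 (re_part f),
      measurable_fun disk2 (im_part f)
    & (\int[area]_(p in disk2)
         (re_part f p ^+ 2 + im_part f p ^+ 2)%:E < +oo)%E]].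

Definition analytic_on_disk f : Prop :=
  forall z0, disk z0 -> exists (r : R) (a : nat -> C), 0 < r /\
    forall z : C, `|z - z0| < r%:C ->
      series (fun n => a n * (z - z0) ^+ n : C^o) @ \oo --> (f z : C^o).

Definition dx (u : R * R -> R) (p : R * R) : R := 'D_((1, 0) : R * R) u p.
Definition dy (u : R * R -> R) (p : R * R) : R := 'D_((0, 1) : R * R) u p.

Definition C1_on (A : set (R * R)) (u : R * R -> R) : Prop :=
  forall p, A p ->
    [/\ derivable u p ((1, 0) : R * R), derivable u p ((0, 1) : R * R),
        {for p, continuous (dx u)} & {for p, continuous (dy u)}].

Definition harmonic_on (A : set (R * R)) (u : R * R -> R) : Prop :=
  [/\ C1_on A u, C1_on A (dx u), C1_on A (dy u)
    & forall p, A p -> dx (dx u) p + dy (dy u) p = 0].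

Definition bergman : set V := [set f : V | L2disk f /\ analytic_on_disk f].

Definition L2harm : set V := [set f : V |
  [/\ L2disk f,
      harmonic_on disk2 (re_part f)
    & harmonic_on disk2 (im_part f)]].

Definition monomial (n : nat) : V :=
  fun z => if `|z| < 1 then (Num.sqrt n.+1%:R)%:C * z ^+ n else 0.

Definition conjf f : V := fun z => conjc (f z).

Definition bergman_projection (P : V -> V) : Prop :=
  forall h, L2disk h ->
    bergman (P h) /\ forall g, bergman g -> dot (h - P h) g = 0.

Definition K_operator (K : V -> V) : Prop :=
  [/\ bounded_operator dot dot bergman L2harm K,
      forall n : nat, K (monomial n.*2) = monomial n
    & forall n : nat, K (monomial n.*2.+1) = conjf (monomial n.+1)].

Definition H_Toeplitz (P K : V -> V) phi : V -> V :=
  fun f => P (fun z => phi z * K f z).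

Definition symbol (s : nat) : V := fun z => z ^+ s * conjc z ^+ s.

End Disk.

(* Main.v *)
(** Let [T] be the adjoint of the H-Toeplitz operator.  The orthogonality
    relations of [z ^ a * conjc z ^ b] on the disk give [T e_n = w_n e_(2n)] with
    [w_n = (n + 1) / (n + 1 + s)].  Hence [T] preserves the line through [e_0] and,
    for each odd [m], acts as a weighted shift on the span of the
    [e_(m 2 ^ j)].  With [q = 1/2], [a = 1 / m] and [b = (s + 1) / m], the moments
    of that shift are the squares of [(-a; q)_n / (-b; q)_n].

    If [s = 2 ^ k - 1], that is [b = 2 ^ k a], this quotient telescopes to a
    polynomial in [q ^ n] with nonnegative coefficients, so the moments are
    those of a measure on the points [q ^ i], and the shift is the restriction
    of a direct sum of multiples of the bilateral shift. In general the
    quotients [(-a; q)_n / (-b; q)_n] are the moments of an explicit Stieltjes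
    continued fraction; if [2 ^ k <= s + 1], those of its coefficients that
    enter the Hankel matrices of order [k + 1] are nonnegative, so these
    matrices are positive semidefinite, and by Schur's product theorem so are
    those of the squares.

    That the [e_n] span the Bergman space rests on the Taylor expansion of a
    function that is only locally a sum of power series, obtained without complex
    integration: roots of unity give Cauchy's estimates for polynomials, and these
    pass to uniform limits of polynomials. *)
Require Import Defs.
From HB Require Import structures.
From mathcomp Require Import all_boot all_order all_algebra complex.
From mathcomp Require Import all_classical all_reals all_analysis.
From mathcomp Require Import measurable_realfun ring lra zify.
Import Order.TTheory GRing.Theory Num.Theory.
Import numFieldNormedType.Exports.
Local Open Scope classical_set_scope.
Local Open Scope ring_scope.
Local Open Scope complex_scope.

Set Implicit Arguments.
Unset Strict Implicit.
Unset Printing Implicit Defensive.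

(** * Taylor expansion of analytic functions on the disk *)

(** [bergman_projection] and [K_operator] describe [P] by orthogonality and [K] by its values on the
    basis, so the H-Toeplitz operator enters through its matrix: the numbers [dot (B e_m) e_n]
    determine [Bstar e_n] once the [e_n] are known to form an orthonormal basis and [dot] to be
    definite on [bergman]. From there on only weights between 0 and 1 matter. The main obstacle is
    that [analytic_on_disk] grants series of uncontrolled radius around each point. Compactness
    makes the radius uniform on smaller disks, and a supremum argument then pushes uniform
    polynomial approximation out to every radius below 1. Polar coordinates are avoided:
    orthogonality comes from the invariance of area under rotations, the radial integrals from their
    increments over thin annuli. For the moments, the ratio [b / a = s + 1] does not depend on [m],
    and the coefficient [sfC l] of the continued fraction has the sign of [b * q ^ l - a], that is
    of [s + 1 - 2 ^ l]; this is how powers of two become thresholds. *)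

Section Modulus.
Variable R : realType.
Implicit Types (z w : R[i]) (x : R).

(** The norm of [R[i]] takes its values in [R[i]]; estimates, suprema and real limits need a modulus
    in [R]. *)
Definition modc z : R := Normc.normc z.

Lemma modcE z : modc z = Num.sqrt (complex.Re z ^+ 2 + complex.Im z ^+ 2).
Proof. by case: z. Qed.

Lemma norm_modc z : `|z| = (modc z)%:C.
Proof. by rewrite normc_def modcE. Qed.

Lemma modc_ge0 z : 0 <= modc z.
Proof. by rewrite modcE sqrtr_ge0. Qed.

Lemma modc_sqr z : modc z ^+ 2 = complex.Re z ^+ 2 + complex.Im z ^+ 2.
Proof. by rewrite modcE sqr_sqrtr // addr_ge0 ?sqr_ge0. Qed.

Lemma modcM z w : modc (z * w) = modc z * modc w.
Proof. exact: Normc.normcM. Qed.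

Lemma modcD z w : modc (z + w) <= modc z + modc w.
Proof. exact: le_normcD. Qed.

Lemma modcN z : modc (- z) = modc z.
Proof. by rewrite !modcE /=; case: z => a b /=; rewrite !sqrrN. Qed.

Lemma modcB z w : modc (z - w) <= modc z + modc w.
Proof. by rewrite -(modcN w) modcD. Qed.

Lemma modc_distC z w : modc (z - w) = modc (w - z).
Proof. by rewrite -modcN opprB. Qed.

Lemma modc_triangle u z w : modc (z - w) <= modc (z - u) + modc (u - w).
Proof. by rewrite (le_trans _ (modcD _ _)) // addrA subrK. Qed.

Lemma modc0 : modc 0 = 0.
Proof. exact: Normc.normc0. Qed.

Lemma modc1 : modc 1 = 1.
Proof. exact: Normc.normc1. Qed.

Lemma modc_eq0 z : modc z = 0 -> z = 0.
Proof. exact: Normc.eq0_normc. Qed.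

Lemma modcX z n : modc (z ^+ n) = modc z ^+ n.
Proof. by elim: n => [|n IH]; rewrite ?expr0 ?modc1 // !exprS modcM IH. Qed.

Lemma modcR x : modc x%:C = `|x|.
Proof. by rewrite modcE /= expr0n addr0 sqrtr_sqr. Qed.

Lemma modc_nat n : modc n%:R = n%:R.
Proof.
have -> : (n%:R : R[i]) = (n%:R)%:C by rewrite rmorph_nat.
by rewrite modcR ger0_norm.
Qed.

Lemma modcJ z : modc (conjc z) = modc z.
Proof. by rewrite !modcE; case: z => a b /=; rewrite sqrrN. Qed.

Lemma modc_sum (I : Type) (r : seq I) (P : pred I) (F : I -> R[i]) :
  modc (\sum_(i <- r | P i) F i) <= \sum_(i <- r | P i) modc (F i).
Proof.
elim/big_rec2: _ => [|i y1 y2 _ H]; first by rewrite modc0.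
by rewrite (le_trans (modcD _ _)) // lerD2l.
Qed.

Lemma conjc_realM x z : conjc (x%:C * z) = x%:C * conjc z.
Proof. by case: z => a b; simpc. Qed.

Lemma Re_le_modc z : `|complex.Re z| <= modc z.
Proof. by rewrite -lecR -norm_modc normc_ge_Re. Qed.

Lemma Im_le_modc z : `|complex.Im z| <= modc z.
Proof. by rewrite modcE -sqrtr_sqr ler_wsqrtr // lerDr sqr_ge0. Qed.

Lemma modc_le_ReIm z : modc z <= `|complex.Re z| + `|complex.Im z|.
Proof.
rewrite -(@ler_pXn2r _ 2) ?nnegrE ?modc_ge0 ?addr_ge0 //.
rewrite modc_sqr sqrrD !real_normK ?num_real // -addrA lerD2l lerDr mulrn_wge0 //.
Qed.

Lemma cauchy_real_lim (u : nat -> R) :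
  (forall e : R, 0 < e -> exists N : nat,
     forall m n : nat, (N <= m)%N -> (N <= n)%N -> `|u m - u n| < e) ->
  exists l : R, forall e : R, 0 < e -> exists N : nat,
     forall n : nat, (N <= n)%N -> `|u n - l| < e.
Proof.
move=> H.
have : cvg (u @ \oo).
  apply: R_complete; apply/cauchyP => e e0; have [N HN] := H _ e0.
  exists (u N); exists N => // n /= Nn; rewrite /ball /=; exact: HN.
move=> /cvg_ex[/= l /cvgrPdist_lt Hl]; exists l => e /Hl[N _ HN].
by exists N => n Nn; rewrite distrC; exact: HN.
Qed.

Lemma cauchy_complex_lim (u : nat -> R[i]) :
  (forall e : R, 0 < e -> exists N : nat,
     forall m n : nat, (N <= m)%N -> (N <= n)%N -> modc (u m - u n) < e) ->
  exists l : R[i], forall e : R, 0 < e -> exists N : nat,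
     forall n : nat, (N <= n)%N -> modc (u n - l) < e.
Proof.
move=> H.
have [|a Ha] := @cauchy_real_lim (fun n => complex.Re (u n)).
  move=> e /H[N HN]; exists N => m n Nm Nn.
  by rewrite -raddfB (le_lt_trans (Re_le_modc _)) // HN.
have [|b Hb] := @cauchy_real_lim (fun n => complex.Im (u n)).
  move=> e /H[N HN]; exists N => m n Nm Nn.
  by rewrite -raddfB (le_lt_trans (Im_le_modc _)) // HN.
exists (a +i* b) => e e0.
have [N1 H1] := Ha _ (divr_gt0 e0 (ltr0n R 2)).
have [N2 H2] := Hb _ (divr_gt0 e0 (ltr0n R 2)).
exists (maxn N1 N2) => n; rewrite geq_max => /andP[n1 n2].
rewrite (le_lt_trans (modc_le_ReIm _)) //.
have := H1 _ n1; have := H2 _ n2; case: (u n) => x y /=; lra.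
Qed.

(** The form in which error terms are discarded below: [A] collects the fixed quantities that
    multiply [e], and its sign is left open. *)
Lemma le_of_le_addM (D B A : R) :
  (forall e, 0 < e -> D <= B + e * A) -> D <= B.
Proof.
move=> H; apply/ler_addgt0Pr => e e0.
have A1 : 0 < `|A| + 1 by rewrite ltr_wpDl.
have := H (e / (`|A| + 1)) (divr_gt0 e0 A1).
move=> /le_trans; apply; rewrite lerD2l.
rewrite mulrAC ler_pdivrMr // ler_pM2l //.
by have := ler_norm A; lra.
Qed.

End Modulus.

Arguments modc {R} z : simpl never.

(** * Cauchy's estimate for polynomials *)

Section CauchyEstimate.
Variable R : realType.
Local Notation C := R[i].
Implicit Types (p : {poly C}) (f : C -> C).

(** For orders that are powers of two primitivity is cheap: a root of -1 of order [2 ^ m] has an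
    order dividing [2 ^ m.+1] but not [2 ^ m]. *)
Lemma root_two_power (m : nat) : exists2 omega : C,
  (2 ^ m).-primitive_root omega & modc omega = 1.
Proof.
have [w wN] : exists2 w : C, (2 ^ m).-primitive_root w & True; last first.
  move=> _; exists w => //.
  have := congr1 (@modc R) (prim_expr_order wN); rewrite modcX modc1.
  by move=> /eqP; rewrite pexpr_eq1 ?modc_ge0 ?expn_gt0 // => /eqP ->.
case: m => [|m].
  exists 1 => //; rewrite expn0; apply/andP; split=> //.
  by apply/forallP => i; rewrite ord1 unity_rootE expr1n eqxx.
pose w : C := (2 ^ m).-root (-1).
have wm : w ^+ (2 ^ m) = -1 by rewrite rootCK // expn_gt0.
have w1 : w ^+ (2 ^ m.+1) = 1 by rewrite expnS mulnC exprM wm sqrrN expr1n.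
have [|k kp kd] := @prim_order_exists C (2 ^ m.+1) w _ w1; first by rewrite expn_gt0.
exists w => //.
have /(dvdn_pfactor _ _ (isT : prime 2))[j jm kE] := kd.
move: jm; rewrite leq_eqVlt => /orP[/eqP <-|jm]; first by rewrite -kE.
have : w ^+ (2 ^ m) = 1.
  apply/eqP; rewrite -(prim_order_dvd kp) kE dvdn_exp2l //.
by rewrite wm => /eqP; rewrite eq_sym -subr_eq0 opprK -mulr2n pnatr_eq0.
Qed.

Lemma sum_prim_root_powers (N d : nat) (w : C) : N.-primitive_root w ->
  ~~ (N %| d)%N -> \sum_(k < N) (w ^+ d) ^+ k = 0.
Proof.
move=> wN Nd; have w1 : w ^+ d - 1 != 0.
  by rewrite subr_eq0 -(prim_order_dvd wN).
apply: (mulfI w1); rewrite mulr0 -subrX1 -exprM mulnC exprM.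
by rewrite (prim_expr_order wN) expr1n subrr.
Qed.

(* Averaging over roots of unity of an order exceeding the size isolates one
   coefficient. *)
Lemma cauchy_estimate p (r M : R) (n : nat) : 0 <= r ->
  (forall w, modc w <= r -> modc p.[w] <= M) -> modc p`_n * r ^+ n <= M.
Proof.
move=> r0 H.
have M0 : 0 <= M by rewrite (le_trans (modc_ge0 p.[0])) // H // modc0.
have [np|np] := leqP (size p) n.
  by rewrite nth_default // modc0 mul0r.
pose m := size p; pose N := (2 ^ m)%N.
have mN : (m < N)%N by rewrite ltn_expl.
have N0 : (0 < N)%N by rewrite (leq_ltn_trans _ mN).
have [w wN w1] := root_two_power m.
(* [w ^+ (N - n)] stands for the inverse of [w ^+ n]. The term of degree [j] contributes the sum of
   the powers of [w ^+ (j + (N - n))], which vanishes unless [j = n], because [j] and [n] are below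
   [N]. *)
have E : \sum_(k < N) p.[r%:C * w ^+ k] * (w ^+ (N - n)) ^+ k =
    N%:R * (p`_n * r%:C ^+ n).
  under eq_bigr do rewrite horner_coef mulr_suml.
  rewrite exchange_big /= (bigD1 (Ordinal np)) //= [X in _ + X]big1 ?addr0.
    under eq_bigr => k _.
      rewrite exprMn -mulrA -!exprM (mulnC k) -mulrA -exprD -mulnDl subnKC.
        rewrite exprM (prim_expr_order wN) expr1n mulr1; over.
      by rewrite ltnW // (ltn_trans np).
    by rewrite /= sumr_const card_ord mulr_natl.
  move=> j jn; under eq_bigr => k _.
    rewrite exprMn -mulrA -!exprM (mulnC k) -mulrA -exprD -mulnDl exprM mulrA.
    over.
  rewrite /= -mulr_sumr (sum_prim_root_powers wN) ?mulr0 //.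
  have jm : (j < m)%N by [].
  have {}jn : (j : nat) != n.
    by apply: contra jn => /eqP jn; apply/eqP/val_inj.
  have [ij|ij] := ltnP n j.
    have -> : (j + (N - n) = (j - n) + N)%N by rewrite addnBA ?addnBAC //; lia.
    rewrite dvdn_addl // gtnNdvd //; last by lia.
    by rewrite subn_gt0.
  rewrite gtnNdvd //; last by lia.
  by rewrite addn_gt0 subn_gt0 (ltn_trans np) ?orbT.
have := congr1 (@modc R) E; rewrite !modcM modc_nat modcX modcR ger0_norm //.
move=> E1; have NR : (0 : R) < N%:R by rewrite ltr0n.
rewrite -(ler_pM2l NR) -E1 (le_trans (modc_sum _ _ _)) //.
have -> : N%:R * M = \sum_(k < N) M by rewrite sumr_const card_ord mulr_natl.
apply: ler_sum => k _; rewrite modcM !modcX w1 !expr1n mulr1 H //.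
by rewrite modcM modcX w1 expr1n mulr1 modcR ger0_norm.
Qed.

End CauchyEstimate.

(** * Uniform limits of polynomials *)

Section PolynomialApproximation.
Variable R : realType.
Local Notation C := R[i].
Implicit Types (p : {poly C}) (f g h : C -> C).

(** The working substitute for holomorphy around a closed disk: it follows from a convergent series,
    is stable under differences, and lets Cauchy's estimate pass from polynomials to the limit. *)
Definition poly_approx f (z0 : C) (T : R) := forall e : R, 0 < e ->
  exists p, forall w, modc w <= T -> modc (f (z0 + w) - p.[w]) <= e.

Lemma poly_approxW f z0 (T T' : R) : T' <= T ->
  poly_approx f z0 T -> poly_approx f z0 T'.
Proof.
move=> TT H e /H[p Hp]; exists p => w wT; exact: Hp (le_trans wT TT).
Qed.

Lemma poly_approxB f g z0 T : poly_approx f z0 T -> poly_approx g z0 T ->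
  poly_approx (fun z => f z - g z) z0 T.
Proof.
move=> Hf Hg e e0.
have [p Hp] := Hf _ (divr_gt0 e0 (ltr0n R 2)).
have [q Hq] := Hg _ (divr_gt0 e0 (ltr0n R 2)).
exists (p - q) => w wT; rewrite hornerD hornerN.
have -> : f (z0 + w) - g (z0 + w) - (p.[w] - q.[w]) =
  (f (z0 + w) - p.[w]) - (g (z0 + w) - q.[w]) by ring.
by rewrite (le_trans (modcB _ _)) //; have := Hp _ wT; have := Hq _ wT; lra.
Qed.

Lemma poly_approx_eq f g z0 T :
  (forall w, modc w <= T -> f (z0 + w) = g (z0 + w)) ->
  poly_approx f z0 T -> poly_approx g z0 T.
Proof. by move=> E H e /H[p Hp]; exists p => w wT; rewrite -E // Hp. Qed.

Lemma modc_horner_le p (w : C) (T : R) : modc w <= T ->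
  modc p.[w] <= \sum_(j < size p) modc p`_j * T ^+ j.
Proof.
move=> wT; rewrite horner_coef (le_trans (modc_sum _ _ _)) //.
apply: ler_sum => j _; rewrite modcM modcX ler_wpM2l ?modc_ge0 //.
by rewrite lerXn2r // nnegrE ?modc_ge0 // (le_trans (modc_ge0 w)).
Qed.

Lemma poly_approx_bounded f z0 (T : R) : poly_approx f z0 T ->
  exists M, forall w, modc w <= T -> modc (f (z0 + w)) <= M.
Proof.
move=> /(_ 1 ltr01)[p Hp]; exists (1 + \sum_(j < size p) modc p`_j * T ^+ j).
move=> w wT; rewrite -[f _](subrK p.[w]) (le_trans (modcD _ _)) //.
by rewrite lerD ?Hp // modc_horner_le.
Qed.

Lemma sum_geometric_le (x : R) (N K : nat) : 0 <= x < 1 ->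
  \sum_(N <= n < K) x ^+ n <= x ^+ N / (1 - x).
Proof.
move=> /andP[x0 x1]; have x1' : 0 < 1 - x by rewrite subr_gt0.
rewrite ler_pdivlMr //.
have [NK|KN] := leqP N K; last first.
  by rewrite big_geq ?mul0r ?exprn_ge0 // ltnW.
suff -> : (\sum_(N <= n < K) x ^+ n) * (1 - x) = x ^+ N - x ^+ K.
  by rewrite gerBl exprn_ge0.
rewrite mulr_suml; under eq_bigr do rewrite mulrBr mulr1 -exprSr.
rewrite (@telescope_sumr_eq _ N K (fun n => - x ^+ n)) //.
  by rewrite opprK addrC.
by move=> i _; rewrite opprK addrC.
Qed.

Lemma power_series_tail (a : nat -> C) (A T : R) (w : C) (N K : nat) :
  0 < T -> (forall n, modc (a n) * T ^+ n <= A) -> modc w < T ->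
  modc (\sum_(N <= n < K) a n * w ^+ n) <=
  A * ((modc w / T) ^+ N / (1 - modc w / T)).
Proof.
move=> T0 aA wT.
have A0 : 0 <= A by apply: le_trans (aA 0%N); rewrite mulr_ge0 ?modc_ge0.
have x01 : 0 <= modc w / T < 1.
  by rewrite divr_ge0 ?modc_ge0 ?ltW //= ltr_pdivrMr // mul1r.
rewrite (le_trans (modc_sum _ _ _)) // (le_trans _ (ler_wpM2l A0 (sum_geometric_le N K x01))) //.
rewrite mulr_sumr; apply: ler_sum => n _.
rewrite modcM modcX -{1}[modc w](divfK (lt0r_neq0 T0)) exprMn mulrCA mulrC.
by rewrite ler_wpM2r ?exprn_ge0 //; case/andP: x01.
Qed.

Lemma le0_of_le_geometric (x D B : R) : 0 <= x < 1 -> 0 <= B ->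
  (forall N : nat, D <= B * x ^+ N) -> D <= 0.
Proof.
move=> /andP[x0 x1] B0 H; apply: (@le_of_le_addM _ _ _ B) => e e0.
have x1' : `|x| < 1 by rewrite ger0_norm.
have /cvgrPdist_lt/(_ _ e0)[N _ HN] := cvg_expr x1'.
rewrite add0r; have := HN N (leqnn N); rewrite /= sub0r normrN ger0_norm ?exprn_ge0 //.
by move=> xe; rewrite (le_trans (H N)) // mulrC ler_wpM2r // ltW.
Qed.

(** By Cauchy's estimate the [n]-th coefficients of approximating polynomials form a Cauchy
    sequence, with limit [c n]. The second clause keeps polynomials that are close to [f] and whose
    coefficients are close to [c]; later comparisons of coefficients go through them. *)
Lemma weierstrass f z0 (T M : R) : 0 < T -> poly_approx f z0 T ->
  (forall w, modc w <= T -> modc (f (z0 + w)) <= M) ->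
  exists c : nat -> C,
    [/\ forall n, modc (c n) * T ^+ n <= M,
        forall e : R, 0 < e -> exists p,
          (forall w, modc w <= T -> modc (f (z0 + w) - p.[w]) <= e) /\
          (forall n, modc (p`_n - c n) * T ^+ n <= e)
      & forall w N, modc w < T ->
          modc (f (z0 + w) - \sum_(n < N) c n * w ^+ n) <=
          M * ((modc w / T) ^+ N / (1 - modc w / T))].
Proof.
move=> T0 Hf HM.
have T0' := ltW T0.
have [iv iv0 small] : exists2 iv : nat -> R, forall k, 0 < iv k &
    forall e : R, 0 < e -> exists N, forall k, (N <= k)%N -> iv k < e.
  exists (fun k => k.+1%:R^-1) => [k|e e0]; first by rewrite invr_gt0 ltr0n.
  have [N HN] := ltr_add_invr e0.
  exists N => k Nk; rewrite add0r in HN; apply: le_lt_trans HN.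
  by rewrite lef_pV2 ?posrE ?ltr0n // ler_nat.
have /choice[P HP] : forall k : nat, exists p, forall w, modc w <= T ->
    modc (f (z0 + w) - p.[w]) <= iv k.
  by move=> k; apply: Hf.
have PP k l n : modc ((P k)`_n - (P l)`_n) * T ^+ n <= iv k + iv l.
  rewrite -coefB; apply: cauchy_estimate => // w wT; rewrite hornerD hornerN.
  have -> : (P k).[w] - (P l).[w] =
    (f (z0 + w) - (P l).[w]) - (f (z0 + w) - (P k).[w]) by ring.
  by rewrite (le_trans (modcB _ _)) // addrC lerD ?HP.
have /choice[c Hc] : forall n, exists l, forall e : R, 0 < e -> exists N : nat,
     forall k : nat, (N <= k)%N -> modc ((P k)`_n - l) < e.
  move=> n; apply: cauchy_complex_lim => e e0.
  have Tn : 0 < T ^+ n by rewrite exprn_gt0.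
  have [N HN] := small (e * T ^+ n / 2) (divr_gt0 (mulr_gt0 e0 Tn) (ltr0n R 2)).
  exists N => k l /HN Hk /HN Hl; rewrite -(ltr_pM2r Tn).
  by rewrite (le_lt_trans (PP k l n)) //; lra.
have Pc k n : modc ((P k)`_n - c n) * T ^+ n <= iv k.
  apply: (@le_of_le_addM _ _ _ 2) => e e0.
  have Tn : 0 < T ^+ n by rewrite exprn_gt0.
  have [N1 H1] := small e e0.
  have [N2 H2] := Hc n (e / T ^+ n) (divr_gt0 e0 Tn).
  have {}H1 := H1 _ (leq_maxl N1 N2); have {}H2 := H2 _ (leq_maxr N1 N2).
  have := PP k (maxn N1 N2) n.
  rewrite ltr_pdivlMr // in H2.
  have D := modc_triangle (P (maxn N1 N2))`_n (P k)`_n (c n).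
  rewrite -(ler_pM2r Tn) mulrDl in D; lra.
have Pe (e : R) : 0 < e -> exists p,
    (forall w, modc w <= T -> modc (f (z0 + w) - p.[w]) <= e) /\
    (forall n, modc (p`_n - c n) * T ^+ n <= e).
  move=> /small[N /(_ _ (leqnn N))/ltW Ne].
  exists (P N); split=> [w wT|n]; first by rewrite (le_trans (HP _ _ wT)).
  by rewrite (le_trans (Pc _ _)).
exists c; split => //.
  move=> n; apply: (@le_of_le_addM _ _ _ 2) => e /Pe[p [Hp Hpc]].
  have : modc p`_n * T ^+ n <= M + e.
    apply: cauchy_estimate => // w wT; rewrite -[p.[w]](subrK (f (z0 + w))).
    by rewrite (le_trans (modcD _ _)) // addrC lerD ?HM // modc_distC Hp.
  have := Hpc n; have Tn : 0 < T ^+ n by rewrite exprn_gt0.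
  have D := modcB p`_n (p`_n - c n); rewrite subKr in D.
  rewrite -(ler_pM2r Tn) mulrDl in D; lra.
move=> w N wT.
set x := modc w / T; set G := x ^+ N / (1 - x).
(* The error is at most [e] for replacing [f] by [p], [N * e] for the coefficients below [N], and
   [(M + e) * G] for the tail of [p]. *)
apply: (@le_of_le_addM _ _ _ (1 + N%:R + G)) => e /Pe[p [Hp Hpc]].
have pM n : modc p`_n * T ^+ n <= M + e.
  apply: cauchy_estimate => // v vT; rewrite -[p.[v]](subrK (f (z0 + v))).
  by rewrite (le_trans (modcD _ _)) // addrC lerD ?HM // modc_distC Hp.
have -> : f (z0 + w) - \sum_(n < N) c n * w ^+ n =
   (f (z0 + w) - p.[w]) + (\sum_(n < N) (p`_n - c n) * w ^+ n +
   \sum_(N <= n < maxn N (size p)) p`_n * w ^+ n).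
  rewrite (horner_coef_wide w (leq_maxr N (size p))).
  rewrite -(big_mkord xpredT (fun n => p`_n * w ^+ n)).
  rewrite (big_cat_nat (leq0n N) (leq_maxl N _)) /= big_mkord.
  under [X in _ + (X + _)]eq_bigr do rewrite mulrBl.
  rewrite sumrB; ring.
have H1 := Hp _ (ltW wT).
have H3 := power_series_tail N (maxn N (size p)) T0 pM wT.
have H2 : modc (\sum_(n < N) (p`_n - c n) * w ^+ n) <= N%:R * e.
  rewrite (le_trans (modc_sum _ _ _)) //.
  have -> : N%:R * e = \sum_(k < N) e by rewrite sumr_const card_ord mulr_natl.
  apply: ler_sum => n _; rewrite (le_trans _ (Hpc n)) // modcM modcX.
  rewrite ler_wpM2l ?modc_ge0 // lerXn2r ?nnegrE ?modc_ge0 //; exact: ltW.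
rewrite (le_trans (modcD _ _)) //.
have := modcD (\sum_(n < N) (p`_n - c n) * w ^+ n)
  (\sum_(N <= n < maxn N (size p)) p`_n * w ^+ n).
rewrite -/x -/G in H3; lra.
Qed.

(** An approximant of error [e] is itself bounded by [e] on the small disk, so Cauchy's estimate at
    radius [t] makes its coefficients small, and with them those of [h]. *)
Lemma poly_approx_identity h z0 (t T : R) : 0 < t <= T -> poly_approx h z0 T ->
  (forall w, modc w <= t -> h (z0 + w) = 0) ->
  forall w, modc w < T -> h (z0 + w) = 0.
Proof.
move=> /andP[t0 tT] Hh h0 w wT.
have T0 : 0 < T := lt_le_trans t0 tT.
have [M HM] := poly_approx_bounded Hh.
have [c [_ Hc Hs]] := weierstrass T0 Hh HM.
have c0 n : c n = 0.
  apply/modc_eq0/eqP; rewrite eq_le modc_ge0 andbT.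
  have Tn : 0 < T ^+ n by rewrite exprn_gt0.
  have tn : 0 < t ^+ n by rewrite exprn_gt0.
  rewrite -(pmulr_lle0 _ Tn) mulrC.
  apply: (@le_of_le_addM _ _ _ (1 + T ^+ n / t ^+ n)) => e /Hc[p [Hp Hpc]].
  have E : modc p`_n * t ^+ n <= e.
    apply: cauchy_estimate (ltW t0) _ => v vt.
    by rewrite -modcN -[- _]add0r -(h0 v) // Hp // (le_trans vt).
  rewrite -(ler_pM2r (divr_gt0 Tn tn)) -mulrA [t ^+ n * _]mulrC divfK ?gt_eqF // in E.
  have F := Hpc n; have D := modcB p`_n (p`_n - c n); rewrite subKr in D.
  rewrite -(ler_pM2r Tn) mulrDl in D; lra.
have x01 : 0 <= modc w / T < 1.
  by rewrite divr_ge0 ?modc_ge0 ?ltW //= ltr_pdivrMr // mul1r.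
have x1 : 0 < 1 - modc w / T by rewrite subr_gt0; case/andP: x01.
apply/modc_eq0/eqP; rewrite eq_le modc_ge0 andbT.
have M0 : 0 <= M by rewrite (le_trans _ (HM 0 _)) ?modc_ge0 ?modc0 ?ltW.
apply: (le0_of_le_geometric x01 (divr_ge0 M0 (ltW x1))) => N.
have := Hs w N wT; rewrite big1 ?subr0; last by move=> i _; rewrite c0 mul0r.
by rewrite mulrA mulrAC.
Qed.

Lemma power_series_sum (a : nat -> C) (A T : R) : 0 < T ->
  (forall n, modc (a n) * T ^+ n <= A) ->
  exists g : C -> C, forall w N, modc w < T ->
    modc (g w - \sum_(n < N) a n * w ^+ n) <=
    A * ((modc w / T) ^+ N / (1 - modc w / T)).
Proof.
move=> T0 aA.
have A0 : 0 <= A by apply: le_trans (aA 0%N); rewrite mulr_ge0 ?modc_ge0.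
have H w : exists l : C, modc w < T -> forall N,
    modc (l - \sum_(n < N) a n * w ^+ n) <=
    A * ((modc w / T) ^+ N / (1 - modc w / T)).
  have [wT|] := ltP (modc w) T; last by exists 0.
  have x01 : 0 <= modc w / T < 1.
    by rewrite divr_ge0 ?modc_ge0 ?ltW //= ltr_pdivrMr // mul1r.
  have /andP[x0 x1] := x01; have x1' : 0 < 1 - modc w / T by rewrite subr_gt0.
  set S := fun N => \sum_(n < N) a n * w ^+ n.
  have SS N K : (N <= K)%N -> modc (S K - S N) <=
      A * ((modc w / T) ^+ N / (1 - modc w / T)).
    move=> NK; rewrite /S -!(big_mkord xpredT (fun n => a n * w ^+ n)).
    rewrite (big_cat_nat (leq0n N) NK) /= [X in modc (X - _)]addrC addrK.
    exact: power_series_tail.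
  have [|l Hl] := @cauchy_complex_lim _ S.
    move=> e e0.
    have A1 : 0 < A / (1 - modc w / T) + 1 by rewrite ltr_wpDl // divr_ge0 // ltW.
    have xn1 : `|modc w / T| < 1 by rewrite ger0_norm.
    have /cvgrPdist_lt/(_ _ (divr_gt0 e0 A1))[N _ HN] := cvg_expr xn1.
    have {}HN m : (N <= m)%N -> A * ((modc w / T) ^+ m / (1 - modc w / T)) < e.
      move=> /HN; rewrite /= sub0r normrN ger0_norm ?exprn_ge0 //.
      rewrite ltr_pdivlMr // => He; apply: le_lt_trans He.
      by rewrite mulrCA ler_wpM2l ?exprn_ge0 // lerDl.
    exists N => m n Nm Nn; have [mn|nm] := leqP m n.
      by rewrite modc_distC (le_lt_trans (SS _ _ mn)) // HN.
    by rewrite (le_lt_trans (SS _ _ (ltnW nm))) // HN.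
  exists l => _ N; apply: (@le_of_le_addM _ _ _ 1) => e /Hl[K HK].
  rewrite mulr1 (le_trans (modc_triangle (S (maxn N K)) _ _)) // addrC lerD //.
    exact: SS (leq_maxl N K).
  by rewrite modc_distC ltW // HK // leq_maxr.
by have /choice[g Hg] := H; exists g => w N wT; exact: Hg.
Qed.

(** Recentring a power series needs no rearrangement here: a partial sum composed with ['X + z0%:P]
    is already a polynomial in the displacement. *)
Lemma poly_approx_power_series g (a : nat -> C) (A T : R) z0 (t : R) :
  0 < T -> 0 <= t ->
  (forall w N, modc w < T -> modc (g w - \sum_(n < N) a n * w ^+ n) <=
    A * ((modc w / T) ^+ N / (1 - modc w / T))) ->
  modc z0 + t < T -> poly_approx g z0 t.
Proof.
move=> T0 t0 Hg tT e e0.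
have A0 : 0 <= A.
  have := Hg 0 0%N; rewrite big_ord0 modc0 !mul0r expr0 !subr0 divr1 mulr1 => H.
  by rewrite (le_trans _ (H T0)) ?modc_ge0.
pose x := (modc z0 + t) / T.
have x01 : 0 <= x < 1.
  by rewrite divr_ge0 ?addr_ge0 ?modc_ge0 ?(ltW T0) //= ltr_pdivrMr // mul1r.
have /andP[x0 x1] := x01; have x1' : 0 < 1 - x by rewrite subr_gt0.
have A1 : 0 < A / (1 - x) + 1 by rewrite ltr_wpDl // divr_ge0 // ltW.
have xn1 : `|x| < 1 by rewrite ger0_norm.
have /cvgrPdist_lt/(_ _ (divr_gt0 e0 A1))[N _ /(_ N (leqnn N))] := cvg_expr xn1.
rewrite /= sub0r normrN ger0_norm ?exprn_ge0 // ltr_pdivlMr // => HN.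
exists ((\poly_(n < N) a n) \Po ('X + z0%:P)) => w wt.
have zw : modc (z0 + w) <= modc z0 + t by rewrite (le_trans (modcD _ _)) ?lerD2l.
have Xw : ('X + z0%:P).[w] = z0 + w by rewrite !hornerE addrC.
rewrite horner_comp Xw horner_poly (le_trans (Hg _ N (le_lt_trans zw tT))) //.
have y0 : 0 <= modc (z0 + w) / T by rewrite divr_ge0 ?modc_ge0 // ltW.
have yx : modc (z0 + w) / T <= x by rewrite ler_pM2r ?invr_gt0.
apply: le_trans (ltW HN); rewrite mulrDr mulr1 -[leLHS]addr0 lerD ?exprn_ge0 //.
have y1 : 0 < 1 - modc (z0 + w) / T by rewrite subr_gt0 (le_lt_trans yx).
rewrite mulrCA; apply: ler_pM.
- by rewrite exprn_ge0.
- by rewrite divr_ge0 // ltW.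
- by rewrite lerXn2r ?nnegrE.
- by rewrite ler_wpM2l // lef_pV2 ?posrE // lerB.
Qed.

End PolynomialApproximation.

(** * Coefficients at the origin bounded by expansions at other centres *)

Section GlobalTaylor.
Variable R : realType.
Local Notation C := R[i].
Implicit Types (p : {poly C}) (f g h : C -> C).

Lemma mul_geometric_le (y : R) (N : nat) : 0 <= y < 1 ->
  N.+1%:R * y ^+ N <= (1 - y)^-1.
Proof.
move=> y01; have /andP[y0 y1] := y01.
have := sum_geometric_le 0 N.+1 y01; rewrite expr0 mul1r; apply: le_trans.
have -> : N.+1%:R * y ^+ N = \sum_(0 <= k < N.+1) y ^+ N.
  by rewrite big_mkord sumr_const card_ord mulr_natl.
rewrite !big_mkord; apply: ler_sum => k _; rewrite ler_wiXn2l ?(ltW y1) //.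
by rewrite -ltnS.
Qed.

(** Cauchy's estimate is applied twice to an approximant [p]: in the displacement from [z0], it
    bounds the [n]-th normalised derivative of [p] at [z0]; that derivative is a polynomial in [z0],
    and its [j]-th coefficient is then bounded on the disk of radius [rho2]. *)
Lemma poly_approx_taylor_coef f (c : nat -> C) (rho rho2 eta M : R) (n j : nat) :
  0 < rho2 < rho -> 0 < eta ->
  (forall e : R, 0 < e -> exists p,
     (forall w, modc w <= rho -> modc (f (0 + w) - p.[w]) <= e) /\
     (forall n, modc (p`_n - c n) * rho ^+ n <= e)) ->
  (forall z0, modc z0 <= rho -> poly_approx f z0 eta /\
     forall w, modc w <= eta -> modc (f (z0 + w)) <= M) ->
  modc (c (n + j)%N) * 'C(n + j, n)%:R * rho2 ^+ j * eta ^+ n <= M.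
Proof.
move=> /andP[r20 r2] eta0 Hc Hf.
have rho0 : 0 < rho := lt_trans r20 r2.
(* On the disk of radius [t] around [z0] both the local approximant [r] and the global one [p],
   which is reliable up to [rho] only, are close to [f]; hence their [n]-th coefficients are close
   at scale [t ^+ n]. *)
pose t := Num.min eta ((rho - rho2) / 2).
have t0 : 0 < t by rewrite /t lt_min eta0 divr_gt0 ?subr_gt0.
have te : t <= eta by rewrite /t ge_min lexx.
have tr : rho2 + t <= rho.
  have : t <= (rho - rho2) / 2 by rewrite /t ge_min lexx orbT.
  lra.
have En : 0 < eta ^+ n by rewrite exprn_gt0.
have tn : 0 < t ^+ n by rewrite exprn_gt0.
have rj : 0 < rho2 ^+ j by rewrite exprn_gt0.
have Rn : 0 < rho ^+ (n + j) by rewrite exprn_gt0.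
pose B := eta ^+ n / t ^+ n.
pose D := 'C(n + j, n)%:R * rho2 ^+ j * eta ^+ n / rho ^+ (n + j).
(* [B] is the price of passing from scale [t] to scale [eta], and [D] that of replacing the
   coefficient of [p] by that of [c]. *)
apply: (@le_of_le_addM _ _ _ (1 + 2 * B + D)) => e e0.
have [p [Hp Hpc]] := Hc _ e0.
have key z0 : modc z0 <= rho2 -> modc (p^`N(n)).[z0] <= (M + e + 2 * e * B) / eta ^+ n.
  move=> z0r; have z0r' : modc z0 <= rho := le_trans z0r (ltW r2).
  have [/(_ _ e0)[r Hr] HM] := Hf _ z0r'.
  pose q := \poly_(i < size p) (p^`N(i)).[z0].
  have qE w : q.[w] = p.[z0 + w].
    by rewrite horner_poly -nderiv_taylor //; exact: mulrC.
  have qn : q`_n = (p^`N(n)).[z0].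
    rewrite coef_poly; case: ltnP => // pn.
    by rewrite nderivn_poly0 ?horner0.
  have rn : modc r`_n * eta ^+ n <= M + e.
    apply: cauchy_estimate (ltW eta0) _ => v vT; rewrite -[r.[v]](subrK (f (z0 + v))).
    by rewrite (le_trans (modcD _ _)) // addrC lerD ?HM // modc_distC Hr.
  have qr : modc (q - r)`_n * t ^+ n <= 2 * e.
    apply: cauchy_estimate (ltW t0) _ => v vt; rewrite hornerD hornerN qE.
    have -> : p.[z0 + v] - r.[v] = (f (z0 + v) - r.[v]) - (f (z0 + v) - p.[z0 + v]).
      by ring.
    rewrite (le_trans (modcB _ _)) // mulr2n mulrDl mul1r lerD ?Hr ?(le_trans vt) //.
    rewrite -[f _]/(f (z0 + v)) -[z0 + v]add0r add0r -{1}[z0 + v]add0r Hp //.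
    by rewrite (le_trans (modcD _ _)) // (le_trans _ tr) // lerD.
  rewrite -qn ler_pdivlMr // -[q`_n](subrK r`_n) -coefB.
  rewrite (le_trans (ler_wpM2r (ltW En) (modcD _ _))) // mulrDl addrC lerD //.
  by rewrite /B mulrA ler_pdivlMr // mulrAC ler_wpM2r // ltW.
have := @cauchy_estimate _ _ _ _ j (ltW r20) key.
rewrite coef_nderivn ler_pdivlMr // -(mulr_natr p`_(n + j)) modcM modc_nat => H1.
have H2 := Hpc (n + j)%N.
have H3 : modc (c (n + j)%N) <= modc p`_(n + j) + e / rho ^+ (n + j).
  rewrite -[c _](subKr p`_(n + j)) (le_trans (modcB _ _)) // lerD2l.
  by rewrite ler_pdivlMr.
pose X := 'C(n + j, n)%:R * rho2 ^+ j * eta ^+ n.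
have X0 : 0 <= X by rewrite !mulr_ge0 // ltW.
have H4 := ler_wpM2r X0 H3.
have HX : modc p`_(n + j) * X <= M + e + 2 * e * B.
  by apply: le_trans H1; rewrite /X !mulrA.
have HD : e / rho ^+ (n + j) * X = e * D by rewrite /D /X; ring.
have -> : modc (c (n + j)%N) * 'C(n + j, n)%:R * rho2 ^+ j * eta ^+ n =
  modc (c (n + j)%N) * X by rewrite /X !mulrA.
rewrite mulrDl HD in H4; apply: (le_trans H4).
by apply: le_trans (lerD HX (lexx _)) _; rewrite le_eqVlt; apply/orP; left; apply/eqP; ring.
Qed.

End GlobalTaylor.

(** * Extension of the expansion to the whole disk *)

Section DiskTaylor.
Variable R : realType.
Local Notation C := R[i].
Implicit Types (p : {poly C}) (f g h : C -> C).

(* If [f] has local power series expansions of radius [eta] around each point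
   of the disk of radius [rho], then its expansion at [0] has radius at least
   [rho + eta]: the [n]-th coefficient at [z0] is itself a power series in
   [z0], with coefficients ['C(n + j, n) * c (n + j)], to which Cauchy's
   estimate applies. *)
Lemma poly_approx_extend f (rho eta M : R) : 0 < rho -> 0 < eta ->
  poly_approx f 0 rho ->
  (forall z0, modc z0 <= rho -> poly_approx f z0 eta /\
     forall w, modc w <= eta -> modc (f (z0 + w)) <= M) ->
  poly_approx f 0 (rho + eta / 2).
Proof.
move=> rho0 eta0 f0 Hf.
have fM w : modc w <= rho -> modc (f (0 + w)) <= M.
  by move=> /Hf[_ /(_ 0)]; rewrite modc0 addr0 add0r; apply; rewrite ltW.
have M0 : 0 <= M by rewrite (le_trans _ (fM 0 _)) ?modc_ge0 ?modc0 ?ltW.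
have [c [_ Hc Hs]] := weierstrass rho0 f0 fM.
(* Within [eta / 8] of [rho], so that [rho + eta / 2 < T < T0]; the maximum with [rho / 2] keeps it
   positive. *)
pose rho2 := Num.max (rho / 2) (rho - eta / 8).
have r20 : 0 < rho2 by rewrite lt_max divr_gt0.
have r2 : rho2 < rho by rewrite gt_max; apply/andP; split; lra.
have r2e : rho - eta / 8 <= rho2 by rewrite le_max lexx orbT.
pose T0 := rho2 + eta; pose T := rho + 3 / 4 * eta.
have T0_gt0 : 0 < T0 by rewrite addr_gt0.
have T_gt0 : 0 < T by rewrite /T; lra.
have TT0 : T < T0 by rewrite /T /T0; lra.
have cT0 N : modc (c N) * T0 ^+ N <= N.+1%:R * M.
  (* Each of the [N.+1] terms of the binomial expansion of [(rho2 + eta) ^+ N] is bounded by [M]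
     through the preceding estimate. *)
  rewrite exprDn mulr_sumr.
  have -> : N.+1%:R * M = \sum_(i < N.+1) M by rewrite sumr_const card_ord mulr_natl.
  apply: ler_sum => i _; have iN : (i <= N)%N by rewrite -ltnS.
  have := @poly_approx_taylor_coef _ f c rho rho2 eta M i (N - i) _ eta0 Hc Hf.
  rewrite subnKC // r20 r2 => /(_ isT); apply: le_trans.
  have -> : modc (c N) * (rho2 ^+ (N - i) * eta ^+ i *+ 'C(N, i)) =
    modc (c N) * 'C(N, i)%:R * rho2 ^+ (N - i) * eta ^+ i.
    by rewrite -(mulr_natr (_ * _)); ring.
  by [].
have y01 : 0 <= T / T0 < 1.
  by rewrite divr_ge0 ?ltW //= ltr_pdivrMr // mul1r.
(* Shrinking the radius from [T0] to [T] absorbs the factor [N.+1]. *)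
pose A := M * (1 - T / T0)^-1.
have cT N : modc (c N) * T ^+ N <= A.
  have -> : T ^+ N = T0 ^+ N * (T / T0) ^+ N.
    by rewrite -exprMn mulrC divfK ?gt_eqF.
  rewrite mulrA (le_trans (ler_wpM2r _ (cT0 N))) ?exprn_ge0 //; first by case/andP: y01.
  by rewrite mulrAC mulrC ler_wpM2l // mul_geometric_le.
have [g Hg] := power_series_sum T_gt0 cT.
have A0 : 0 <= A by apply: le_trans (cT 0%N); rewrite mulr_ge0 ?modc_ge0.
have rT : rho < T by rewrite /T ltrDl mulr_gt0.
have fg w : modc w < rho -> f w = g w.
  move=> wr; have wT := lt_trans wr rT; apply/eqP; rewrite -subr_eq0; apply/eqP/modc_eq0.
  apply/eqP; rewrite eq_le modc_ge0 andbT.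
  pose x := modc w / rho; pose y := modc w / T.
  have y0 : 0 <= y by rewrite divr_ge0 ?modc_ge0 // ltW.
  have yx : y <= x by rewrite ler_wpM2l ?modc_ge0 // lef_pV2 ?posrE // ltW.
  have x0 := le_trans y0 yx.
  have x1 : x < 1 by rewrite ltr_pdivrMr // mul1r.
  have y1 : y < 1 := le_lt_trans yx x1.
  have x1' : 0 < 1 - x by rewrite subr_gt0.
  have y1' : 0 < 1 - y by rewrite subr_gt0.
  apply: (@le0_of_le_geometric _ x _ (M / (1 - x) + A / (1 - y))).
  - by rewrite x0.
  - by rewrite addr_ge0 // divr_ge0 // ltW.
  move=> N; have H1 := Hs w N wr; have H2 := Hg w N wT.
  rewrite (le_trans (modc_triangle (\sum_(n < N) c n * w ^+ n) _ _)) //.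
  rewrite mulrDl; apply: lerD.
    by rewrite add0r in H1; rewrite (le_trans H1) // mulrA mulrAC.
  rewrite modc_distC (le_trans H2) // -[leRHS]mulrA ler_wpM2l // mulrC.
  by rewrite ler_wpM2l ?invr_ge0 ?(ltW y1') // lerXn2r ?nnegrE.
have fg2 z : modc z <= rho + eta / 2 -> f z = g z.
  move=> zr; have [/fg//|rz] := ltP (modc z) rho.
  have z0 : 0 < modc z := lt_le_trans rho0 rz.
  (* The point of modulus [rho2] on the ray of [z] lies at distance at most [5/8 * eta] from [z].
     The disk of radius [11/16 * eta] around it contains [z] and stays inside that of radius [T],
     where [g] is a power series; near its centre, inside radius [rho], [f] and [g] agree. *)
  pose z1 : C := (rho2 / modc z)%:C * z.
  have z1E : modc z1 = rho2.
    by rewrite modcM modcR ger0_norm ?divfK ?gt_eqF // divr_ge0 // ltW.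
  have dE : modc (z - z1) = modc z - rho2.
    have -> : z - z1 = (1 - rho2 / modc z)%:C * z.
      by rewrite rmorphB rmorph1 mulrBl mul1r.
    rewrite modcM modcR ger0_norm ?mulrBl ?mul1r ?divfK ?gt_eqF //.
    by rewrite subr_ge0 ler_pdivrMr // mul1r (le_trans (ltW r2)).
  pose T1 := 11 / 16 * eta; pose t := (rho - rho2) / 2.
  have t0 : 0 < t by rewrite /t divr_gt0 ?subr_gt0.
  have tT1 : t <= T1 by rewrite /t /T1; lra.
  have zT1 : modc (z - z1) < T1 by rewrite dE /T1; lra.
  have Ha : poly_approx (fun z => f z - g z) z1 T1.
    apply: poly_approxB.
      have [H _] := Hf z1 (eq_ind_r (fun x => x <= rho) (ltW r2) z1E).
      by apply: poly_approxW H; rewrite /T1; lra.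
    apply: (poly_approx_power_series T_gt0 _ Hg); rewrite ?z1E /T1 /T; lra.
  have := poly_approx_identity (t := t) _ Ha _ zT1.
  rewrite addrCA subrr addr0 t0 tT1 => /(_ isT) H.
  apply/eqP; rewrite -subr_eq0; apply/eqP/H => w wt; rewrite fg ?subrr //.
  rewrite (le_lt_trans (modcD _ _)) // z1E (@le_lt_trans _ _ (rho2 + t)) ?lerD2l //.
  by rewrite /t; lra.
apply: (@poly_approx_eq _ g); first by move=> w wr; rewrite add0r -fg2.
apply: (poly_approx_power_series T_gt0 _ Hg); rewrite ?modc0 /T; lra.
Qed.

(** Shaped for the covering argument: [eta] serves both as a radius and, through [eta^-1], as a
    bound, so that a single parameter has to be shrunk, and the centre may move near [z1]. *)
Lemma locally_analytic_poly_approx f z1 (r : R) (a : nat -> C) : 0 < r ->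
  (forall z : C, `|z - z1| < r%:C ->
      series (fun n => a n * (z - z1) ^+ n : C^o) @ \oo --> (f z : C^o)) ->
  exists2 d : R, 0 < d & forall eta z0, 0 < eta < d -> modc (z0 - z1) < d ->
    poly_approx f z0 eta /\
    forall w, modc w <= eta -> modc (f (z0 + w)) <= eta^-1.
Proof.
move=> r0 Ha.
have Ha' w : modc w < r -> forall e : R, 0 < e -> exists N, forall n, (N <= n)%N ->
    modc (f (z1 + w) - \sum_(k < n) a k * w ^+ k) < e.
  move=> wr e e0; have := Ha (z1 + w).
  rewrite addrC addKr norm_modc ltcR => /(_ wr)/cvgrPdist_lt/(_ e%:C).
  rewrite ltcR => /(_ e0)[N _ HN]; exists N => n /HN /=.
  by rewrite /series /= big_mkord norm_modc ltcR addrC.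
pose T := r / 2; have T0 : 0 < T by rewrite divr_gt0.
have Tr : T < r by rewrite /T; lra.
(* Convergence at the one point [T%:C] suffices: from some index on, a term is the difference of two
   consecutive errors below 1, hence the 2; the finite sum covers the earlier terms. *)
have [A HA] : exists A, forall n, modc (a n) * T ^+ n <= A.
  have Tm : modc T%:C = T by rewrite modcR gtr0_norm.
  have [|N HN] := Ha' T%:C _ 1 ltr01; first by rewrite Tm.
  exists (2 + \sum_(k < N) modc (a k) * T ^+ k) => n.
  have S0 : 0 <= \sum_(k < N) modc (a k) * T ^+ k.
    by apply: sumr_ge0 => k _; rewrite mulr_ge0 ?modc_ge0 ?exprn_ge0 ?ltW.
  have [nN|Nn] := ltnP n N.
    rewrite (bigD1 (Ordinal nN)) //= addrCA lerDl addr_ge0 //.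
    by apply: sumr_ge0 => k _; rewrite mulr_ge0 ?modc_ge0 ?exprn_ge0 ?ltW.
  have H1 := HN _ Nn; have H2 := HN _ (leqW Nn).
  have -> : modc (a n) * T ^+ n = modc (a n * T%:C ^+ n) by rewrite modcM modcX Tm.
  have -> : a n * T%:C ^+ n = (f (z1 + T%:C) - \sum_(k < n) a k * T%:C ^+ k) -
      (f (z1 + T%:C) - \sum_(k < n.+1) a k * T%:C ^+ k) by rewrite big_ord_recr /=; ring.
  rewrite (le_trans (modcB _ _)) //; lra.
have [g Hg] := power_series_sum T0 HA.
have A0 : 0 <= A by apply: le_trans (HA 0%N); rewrite mulr_ge0 ?modc_ge0.
have fg w : modc w < T -> f (z1 + w) = g w.
  move=> wT; have wr := lt_trans wT Tr; apply/eqP; rewrite -subr_eq0; apply/eqP/modc_eq0.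
  apply/eqP; rewrite eq_le modc_ge0 andbT.
  pose x := modc w / T.
  have x0 : 0 <= x by rewrite divr_ge0 ?modc_ge0 // ltW.
  have x1 : x < 1 by rewrite ltr_pdivrMr // mul1r.
  have xn : `|x| < 1 by rewrite ger0_norm.
  have x1' : 0 < 1 - x by rewrite subr_gt0.
  apply: (@le_of_le_addM _ _ _ (1 + A / (1 - x))) => e e0.
  have [N1 H1] := Ha' w wr _ e0.
  have /cvgrPdist_lt/(_ _ e0)[N2 _ H2] := cvg_expr xn.
  have {}H1 := H1 _ (leq_maxl N1 N2); have {}H2 := H2 _ (leq_maxr N1 N2).
  have H3 := Hg w (maxn N1 N2) wT.
  rewrite /= sub0r normrN ger0_norm ?exprn_ge0 // in H2.
  rewrite (le_trans (modc_triangle (\sum_(n < maxn N1 N2) a n * w ^+ n) _ _)) //.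
  rewrite add0r mulrDr mulr1 lerD ?(ltW H1) // modc_distC (le_trans H3) //.
  rewrite mulrCA ler_wpM2r ?(ltW H2) //; last by rewrite divr_ge0 // ltW.
have [M HM] : exists M, forall w, modc w <= T / 2 -> modc (g w) <= M.
  have [|M HM] := @poly_approx_bounded _ g 0 (T / 2).
    apply: (poly_approx_power_series T0 _ Hg); rewrite ?modc0; lra.
  by exists M => w /HM; rewrite add0r.
(* The first bound keeps [z0 + w] within [T / 2] of [z1], the second makes [M] at most [eta^-1]. *)
pose d := Num.min (T / 4) (`|M| + 1)^-1.
have M1 : 0 < `|M| + 1 by rewrite ltr_wpDl.
have dT : d <= T / 4 by rewrite ge_min lexx.
have dM : d <= (`|M| + 1)^-1 by rewrite ge_min lexx orbT.
exists d; first by rewrite lt_min divr_gt0 // invr_gt0.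
move=> eta z0 /andP[eta0 etad] z0d.
have E w : modc w <= eta -> f (z0 + w) = g ((z0 - z1) + w).
  move=> we; rewrite -fg; last by rewrite (le_lt_trans (modcD _ _)) //; lra.
  by congr f; ring.
split; last first.
  move=> w we; rewrite E //; apply: (le_trans (HM _ _)).
    by rewrite (le_trans (modcD _ _)) //; lra.
  rewrite (le_trans (ler_norm M)) // -[`|M|]invrK.
  have [->|M0] := eqVneq `|M| 0; first by rewrite !invr0 invr_ge0 ltW.
  have {}M0 : 0 < `|M| by rewrite lt_def M0 normr_ge0.
  rewrite lef_pV2 ?posrE ?invr_gt0 //.
  by rewrite (le_trans (ltW etad)) // (le_trans dM) // lef_pV2 ?posrE ?lerDl.
have H : poly_approx g (z0 - z1) eta.
  by apply: (poly_approx_power_series T0 _ Hg); lra.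
by move=> e /H[p Hp]; exists p => w we; rewrite E // Hp.
Qed.

(** Compactness of the square [[-1, 1]^2] is used, with the filter of radii at the right of 0 as the
    parameter of the covering. *)
Lemma disk_uniform_radius (P : R -> C -> Prop) (rho : R) : rho < 1 ->
  (forall z1, modc z1 < 1 -> exists2 d : R, 0 < d &
     forall eta z0, 0 < eta < d -> modc (z0 - z1) < d -> P eta z0) ->
  exists2 eta : R, 0 < eta & forall z0, modc z0 <= rho -> P eta z0.
Proof.
move=> rho1 HP.
have K : compact ((`[-1, 1]%classic : set R) `*` (`[-1, 1]%classic : set R)).
  by apply: compact_setX; exact: segment_compact.
have /compact_near_coveringP := K.
move=> /(_ R (0 : R)^'+ (fun eta (p : R * R) => modc (plane p) <= rho -> P eta (plane p)) _).
have near_plane (p : R * R) (d : R) : 0 < d ->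
    \forall p' \near p, modc (plane p' - plane p) < d.
  move=> d0; exists (ball p.1 (d / 2), ball p.2 (d / 2)) => /=.
    by split; apply: nbhsx_ballx; rewrite divr_gt0.
  move=> p' [/= h1 h2]; apply: (le_lt_trans (modc_le_ReIm _)) => /=.
  rewrite distrC [`|_ - p.2|]distrC; move: h1 h2; rewrite /ball /=; lra.
case.
  move=> p _; have [p1|p1] := ltP (modc (plane p)) 1.
    have [d d0 Hd] := HP _ p1.
    exists ([set p' | modc (plane p' - plane p) < d], [set eta | 0 < eta < d]) => /=.
      split; first exact: near_plane.
      near=> e; apply/andP; split; [near: e; exact: nbhs_right_gt|].
      near: e; exact: nbhs_right_lt.
    by move=> [p' eta] /= [h1 h2] _; exact: Hd.
  (* A point of the square outside the open disk has a neighbourhood that misses the disk of radius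
     [rho], where the claim is vacuous. *)
  exists ([set p' | modc (plane p' - plane p) < 1 - rho], setT) => /=.
    by split; [apply: near_plane; rewrite subr_gt0|exact: filterT].
  move=> [p' eta] /= [h _] h'; exfalso.
  have := modcB (plane p') (plane p' - plane p); rewrite subKr; lra.
move=> d /= d0 Hd; exists (d / 2); first by rewrite divr_gt0.
move=> z0 z0r.
have -> : z0 = plane (complex.Re z0, complex.Im z0) by rewrite /plane /=; case: (z0).
apply: (Hd (d / 2)) => /=.
- by rewrite sub0r normrN gtr0_norm ?divr_gt0 //; lra.
- by rewrite divr_gt0.
- have := Re_le_modc z0; have := Im_le_modc z0; rewrite /= !in_itv /= !ler_norml.
  split; lra.
- by rewrite /plane /=; case: (z0) z0r.
Unshelve. all: by end_near.
Qed.

(** Otherwise the radii that admit approximation have a supremum at most [T < 1]. With a uniform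
    [eta] for that supremum, a radius within [eta / 4] of it can be enlarged by [eta / 2], beyond
    the supremum. *)
Lemma analytic_poly_approx f : analytic_on_disk f ->
  forall T : R, T < 1 -> poly_approx f 0 T.
Proof.
move=> Hf T T1.
have unif rho : rho < 1 -> exists2 eta : R, 0 < eta & forall z0, modc z0 <= rho ->
    0 < eta /\ poly_approx f z0 eta /\
    forall w, modc w <= eta -> modc (f (z0 + w)) <= eta^-1.
  move=> r1; apply: (disk_uniform_radius r1) => z1 z1d.
  have [|r [a [r0 Ha]]] := Hf z1; first by rewrite /disk /= norm_modc ltcR.
  have [d d0 Hd] := locally_analytic_poly_approx r0 Ha.
  exists d => // eta z0 ed zd; split; first by case/andP: ed.
  exact: Hd.
apply: contrapT => nT.
pose E := [set rho : R | 0 < rho /\ poly_approx f 0 rho].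
have ubE : ubound E T.
  move=> x [x0 Hx]; rewrite leNgt; apply/negP => Tx; apply: nT.
  exact: poly_approxW (ltW Tx) Hx.
have E0 : E !=set0.
  have [eta e0 /(_ 0)] := unif 0 ltr01; rewrite modc0 lexx => /(_ isT)[_ [H _]].
  by exists eta.
have supE : has_sup E by split => //; exists T.
have sT : sup E <= T by apply: ge_sup.
have [eta e0 H] := unif _ (le_lt_trans sT T1).
have [rho [r0 Hr] rs] := sup_adherent (divr_gt0 e0 (ltr0n R 4)) supE.
have : E (rho + eta / 2).
  split; first by rewrite addr_gt0 // divr_gt0.
  apply: (poly_approx_extend r0 e0 Hr (M := eta^-1)) => z0 zr.
  have [_] := H z0 (le_trans zr (ub_le_sup (ex_intro _ T ubE) (conj r0 Hr))).
  by [].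
move=> /(ub_le_sup (ex_intro _ T ubE)); lra.
Qed.

(** [weierstrass] yields a coefficient sequence for each radius separately; this identifies them
    all. *)
Lemma taylor_coef_unique f (c1 c2 : nat -> C) (T1 T2 : R) : 0 < T1 -> 0 < T2 ->
  (forall e : R, 0 < e -> exists p,
     (forall w, modc w <= T1 -> modc (f (0 + w) - p.[w]) <= e) /\
     (forall n, modc (p`_n - c1 n) * T1 ^+ n <= e)) ->
  (forall e : R, 0 < e -> exists p,
     (forall w, modc w <= T2 -> modc (f (0 + w) - p.[w]) <= e) /\
     (forall n, modc (p`_n - c2 n) * T2 ^+ n <= e)) ->
  c1 =1 c2.
Proof.
move=> T10 T20 H1 H2 n; apply/eqP; rewrite -subr_eq0; apply/eqP/modc_eq0.
apply/eqP; rewrite eq_le modc_ge0 andbT.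
pose t := Num.min T1 T2.
have t0 : 0 < t by rewrite lt_min T10.
have tT1 : t <= T1 by rewrite ge_min lexx.
have tT2 : t <= T2 by rewrite ge_min lexx orbT.
have tn : 0 < t ^+ n by rewrite exprn_gt0.
rewrite -(pmulr_lle0 _ tn) mulrC.
apply: (@le_of_le_addM _ _ _ 4) => e e0.
have [p1 [Hp1 /(_ n) Hc1]] := H1 _ e0; have [p2 [Hp2 /(_ n) Hc2]] := H2 _ e0.
have E : modc (p1 - p2)`_n * t ^+ n <= e + e.
  apply: cauchy_estimate (ltW t0) _ => w wt; rewrite hornerD hornerN.
  have -> : p1.[w] - p2.[w] = (f (0 + w) - p2.[w]) - (f (0 + w) - p1.[w]) by ring.
  by rewrite (le_trans (modcB _ _)) // lerD ?Hp1 ?Hp2 // (le_trans wt).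
have le1 : modc (p1`_n - c1 n) * t ^+ n <= e.
  apply: le_trans Hc1; rewrite ler_wpM2l ?modc_ge0 // lerXn2r ?nnegrE // ltW //.
have le2 : modc (p2`_n - c2 n) * t ^+ n <= e.
  apply: le_trans Hc2; rewrite ler_wpM2l ?modc_ge0 // lerXn2r ?nnegrE // ltW //.
have D : modc (c1 n - c2 n) <=
    modc (p1 - p2)`_n + (modc (p1`_n - c1 n) + modc (p2`_n - c2 n)).
  rewrite coefB.
  have -> : c1 n - c2 n = (p1`_n - p2`_n) - ((p1`_n - c1 n) - (p2`_n - c2 n)) by ring.
  by rewrite (le_trans (modcB _ _)) // lerD2l modcB.
rewrite -(ler_pM2r tn) !mulrDl in D; rewrite mulrC in D; lra.
Qed.

Theorem disk_taylor f : analytic_on_disk f -> exists c : nat -> C,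
  forall r e : R, 0 <= r < 1 -> 0 < e -> exists K, forall N w, (K <= N)%N ->
    modc w <= r -> modc (f w - \sum_(n < N) c n * w ^+ n) <= e.
Proof.
move=> /analytic_poly_approx Hf.
have W T : 0 < T < 1 -> exists M (c : nat -> C), 0 <= M /\
    (forall e : R, 0 < e -> exists p,
       (forall w, modc w <= T -> modc (f (0 + w) - p.[w]) <= e) /\
       (forall n, modc (p`_n - c n) * T ^+ n <= e)) /\
    (forall w N, modc w < T -> modc (f w - \sum_(n < N) c n * w ^+ n) <=
          M * ((modc w / T) ^+ N / (1 - modc w / T))).
  move=> /andP[T0 T1]; have [M HM] := poly_approx_bounded (Hf T T1).
  have [c [_ Hc Hs]] := weierstrass T0 (Hf T T1) HM; exists M, c; split.
    by rewrite (le_trans _ (HM 0 _)) ?modc_ge0 ?modc0 ?ltW.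
  by split => // w N /(Hs _ N); rewrite add0r.
have [|M0 [c [_ [Hc _]]]] := W (1 / 2); first by apply/andP; split; lra.
exists c => r e /andP[r0 r1] e0.
pose T := (1 + r) / 2; have T0 : 0 < T by rewrite /T; lra.
have T1 : T < 1 by rewrite /T; lra.
have [|M [c' [M0' [Hc' Hs]]]] := W T; first by rewrite T0.
have cc : c' =1 c by apply: (taylor_coef_unique T0 _ Hc' Hc); lra.
have rT : r < T by rewrite /T; lra.
pose x := r / T.
have x0 : 0 <= x by rewrite divr_ge0 // ltW.
have x1 : x < 1 by rewrite ltr_pdivrMr // mul1r.
have x1' : 0 < 1 - x by rewrite subr_gt0.
have xn : `|x| < 1 by rewrite ger0_norm.
have A1 : 0 < M / (1 - x) + 1 by rewrite ltr_wpDl // divr_ge0 // ltW.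
have /cvgrPdist_lt/(_ _ (divr_gt0 e0 A1))[K _ HK] := cvg_expr xn.
exists K => N w KN wr; under eq_bigr do rewrite -cc.
rewrite (le_trans (Hs w N (le_lt_trans wr rT))) //.
have := HK N KN; rewrite /= sub0r normrN ger0_norm ?exprn_ge0 // ltr_pdivlMr // => {}HK.
have y0 : 0 <= modc w / T by rewrite divr_ge0 ?modc_ge0 // ltW.
have yx : modc w / T <= x by rewrite ler_pM2r ?invr_gt0.
have y1 : 0 < 1 - modc w / T by rewrite subr_gt0 (le_lt_trans yx).
apply: le_trans (ltW HK); rewrite mulrDr mulr1 -[leLHS]addr0 lerD ?exprn_ge0 //.
rewrite mulrCA; apply: ler_pM.
- by rewrite exprn_ge0.
- by rewrite divr_ge0 // ltW.
- by rewrite lerXn2r ?nnegrE.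
- by rewrite ler_wpM2l // lef_pV2 ?posrE // lerB.
Qed.

End DiskTaylor.

(** * Orthonormal bases of semi-inner product spaces *)

Section SemiInner.
Variables (R : realType) (V : lmodType R[i]) (ip : V -> V -> R[i]).
Local Notation C := R[i].
Local Notation nrm := (ipnorm ip).

(** Weaker than [hilbert], so as to cover [L2disk], on which the form is only semidefinite. *)
Record semi_inner (H : set V) : Prop := SemiInner {
  si_subspace : Defs.subspace H ;
  si_linear : forall (a : C) u v w, H u -> H v -> H w ->
    ip (a *: u + v) w = a * ip u w + ip v w ;
  si_conj : forall u v, H u -> H v -> ip v u = conjc (ip u v) ;
  si_ge0 : forall u, H u -> 0 <= complex.Re (ip u u) }.

Variable H : set V.
Hypothesis siH : semi_inner H.

Let H0 : H 0 := (si_subspace siH).1.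

Lemma si_lin a u v : H u -> H v -> H (a *: u + v).
Proof. exact: (si_subspace siH).2. Qed.

Lemma si_add u v : H u -> H v -> H (u + v).
Proof. by move=> Hu Hv; rewrite -[u]scale1r; exact: si_lin. Qed.

Lemma si_scale a u : H u -> H (a *: u).
Proof. by move=> Hu; rewrite -[_ *: _]addr0; exact: si_lin. Qed.

Lemma si_opp u : H u -> H (- u).
Proof. by move=> Hu; rewrite -scaleN1r; exact: si_scale. Qed.

Lemma si_sub u v : H u -> H v -> H (u - v).
Proof. by move=> Hu Hv; apply: si_add => //; exact: si_opp. Qed.

Lemma si_sum (I : Type) (r : seq I) (P : pred I) (F : I -> V) :
  (forall i, H (F i)) -> H (\sum_(i <- r | P i) F i).
Proof. by move=> HF; elim/big_ind: _ => // u v; exact: si_add. Qed.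

Lemma ipDl u v w : H u -> H v -> H w -> ip (u + v) w = ip u w + ip v w.
Proof. by move=> Hu Hv Hw; rewrite -{1}[u]scale1r (si_linear siH) // mul1r. Qed.

Lemma ip0l w : H w -> ip 0 w = 0.
Proof.
by move=> Hw; apply: (@addrI _ (ip 0 w)); rewrite -ipDl // !addr0.
Qed.

Lemma ipZl a u w : H u -> H w -> ip (a *: u) w = a * ip u w.
Proof.
by move=> Hu Hw; rewrite -[_ *: _]addr0 (si_linear siH) // ip0l // addr0.
Qed.

Lemma ipNl u w : H u -> H w -> ip (- u) w = - ip u w.
Proof. by move=> Hu Hw; rewrite -scaleN1r ipZl // mulN1r. Qed.

Lemma ipBl u v w : H u -> H v -> H w -> ip (u - v) w = ip u w - ip v w.
Proof. by move=> Hu Hv Hw; rewrite ipDl ?ipNl //; exact: si_opp. Qed.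

Lemma ip_suml (I : Type) (r : seq I) (P : pred I) (F : I -> V) w :
  (forall i, H (F i)) -> H w ->
  ip (\sum_(i <- r | P i) F i) w = \sum_(i <- r | P i) ip (F i) w.
Proof.
move=> HF Hw; pose K x (y : C) := H x /\ ip x w = y.
suff [] : K (\sum_(i <- r | P i) F i) (\sum_(i <- r | P i) ip (F i) w) by [].
apply: (big_rec2 K); first by split => //; exact: ip0l.
by move=> i y x _ [Hx <-]; split; [exact: si_add|rewrite ipDl].
Qed.

Lemma ipC u v : H u -> H v -> ip u v = conjc (ip v u).
Proof. by move=> Hu Hv; rewrite (si_conj siH Hv Hu). Qed.

Lemma ip0r w : H w -> ip w 0 = 0.
Proof. by move=> Hw; rewrite ipC // ip0l // rmorph0. Qed.

Lemma ipDr u v w : H u -> H v -> H w -> ip w (u + v) = ip w u + ip w v.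
Proof.
move=> Hu Hv Hw; rewrite ipC //; last exact: si_add.
by rewrite ipDl // rmorphD /= -!ipC.
Qed.

Lemma ipZr a u w : H u -> H w -> ip w (a *: u) = conjc a * ip w u.
Proof.
move=> Hu Hw; rewrite ipC //; last exact: si_scale.
by rewrite ipZl // rmorphM /= -ipC.
Qed.

Lemma ipNr u w : H u -> H w -> ip w (- u) = - ip w u.
Proof. by move=> Hu Hw; rewrite -scaleN1r ipZr // rmorphN rmorph1 mulN1r. Qed.

Lemma ipBr u v w : H u -> H v -> H w -> ip w (u - v) = ip w u - ip w v.
Proof. by move=> Hu Hv Hw; rewrite ipDr ?ipNr //; exact: si_opp. Qed.

Lemma ip_sumr (I : Type) (r : seq I) (P : pred I) (F : I -> V) w :
  (forall i, H (F i)) -> H w ->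
  ip w (\sum_(i <- r | P i) F i) = \sum_(i <- r | P i) ip w (F i).
Proof.
move=> HF Hw; rewrite ipC //; last exact: si_sum.
rewrite ip_suml // rmorph_sum; apply: eq_bigr => i _ /=.
by rewrite -ipC.
Qed.

Lemma ipnorm_ge0 u : 0 <= nrm u.
Proof. exact: sqrtr_ge0. Qed.

Lemma ipnorm_sqr u : H u -> nrm u ^+ 2 = complex.Re (ip u u).
Proof. by move=> Hu; rewrite sqr_sqrtr // (si_ge0 siH). Qed.

Lemma ip_self u : H u -> ip u u = (nrm u ^+ 2)%:C.
Proof.
move=> Hu; rewrite ipnorm_sqr //; have := ipC Hu Hu.
by case: (ip u u) => a b /= [] bN; congr (_ +i* _); lra.
Qed.

Lemma ipnormZ a u : H u -> nrm (a *: u) = modc a * nrm u.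
Proof.
move=> Hu; rewrite /ipnorm ipZl ?ipZr //; last exact: si_scale.
rewrite modcE -sqrtrM; last by rewrite addr_ge0 // sqr_ge0.
congr Num.sqrt; rewrite ip_self //; case: a => x y /=; ring.
Qed.

Lemma ipnormN u : H u -> nrm (- u) = nrm u.
Proof. by move=> Hu; rewrite -scaleN1r ipnormZ // modcN modc1 mul1r. Qed.

Lemma ipnorm_distC u v : H u -> H v -> nrm (u - v) = nrm (v - u).
Proof. by move=> Hu Hv; rewrite -ipnormN ?opprB //; exact: si_sub. Qed.

Lemma ipnorm0 : nrm 0 = 0.
Proof. by rewrite /ipnorm ip0l //= sqrtr0. Qed.

Lemma pythagoras u v : H u -> H v -> ip u v = 0 ->
  nrm (u + v) ^+ 2 = nrm u ^+ 2 + nrm v ^+ 2.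
Proof.
move=> Hu Hv uv; have Huv := si_add Hu Hv.
rewrite !ipnorm_sqr // ipDl // !ipDr // [ip v u]ipC // uv rmorph0 addr0 add0r.
by rewrite raddfD.
Qed.

Lemma ip_cauchy_schwarz u v : H u -> H v -> modc (ip u v) <= nrm u * nrm v.
Proof.
move=> Hu Hv; set c := ip u v; set a := nrm u; set b := nrm v.
have key (s : R) : 0 <= a ^+ 2 - 2 * s * modc c ^+ 2 + s ^+ 2 * modc c ^+ 2 * b ^+ 2.
  have Hw : H (u - (s%:C * c) *: v) by apply: si_sub => //; exact: si_scale.
  have := si_ge0 siH Hw; have Hv' := si_scale (s%:C * c) Hv.
  rewrite ipBl // !ipBr // !ipZr // !ipZl // [ip v u]ipC // !ip_self // -/a -/b -/c.
  rewrite modc_sqr; case: (c) => x y; simpc; rewrite /=; move=> h; apply: le_trans h _.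
  by rewrite le_eqVlt; apply/orP; left; apply/eqP; ring.
rewrite -(@ler_pXn2r _ 2) ?nnegrE ?modc_ge0 ?mulr_ge0 ?ipnorm_ge0 //.
have a0 : 0 <= a := ipnorm_ge0 u; have b0 : 0 <= b := ipnorm_ge0 v.
rewrite exprMn; set q := modc c ^+ 2 in key *.
have q0 : 0 <= q by rewrite exprn_ge0 ?modc_ge0.
(* If [v] has norm 0 the quadratic [key] is affine in [s], and the chosen value would make it -1
   unless [q = 0]. Otherwise [s = (b ^+ 2)^-1] minimises it. *)
have [b1|b1] := eqVneq (b ^+ 2) 0.
  rewrite b1 mulr0 leNgt; apply/negP => q1.
  have := key ((a ^+ 2 + 1) / (2 * q)); rewrite b1 mulr0 addr0.
  have -> : 2 * ((a ^+ 2 + 1) / (2 * q)) * q = a ^+ 2 + 1 by field; rewrite gt_eqF.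
  lra.
have b2 : 0 < b ^+ 2 by rewrite lt_def b1 exprn_ge0.
have := key (b ^+ 2)^-1.
have -> : a ^+ 2 - 2 * (b ^+ 2)^-1 * q + (b ^+ 2)^-1 ^+ 2 * q * b ^+ 2 = a ^+ 2 - q / b ^+ 2.
  by field; rewrite sqrf_eq0 in b1.
by rewrite subr_ge0 ler_pdivrMr.
Qed.

Lemma ipnormD u v : H u -> H v -> nrm (u + v) <= nrm u + nrm v.
Proof.
move=> Hu Hv; have Huv := si_add Hu Hv.
rewrite -(@ler_pXn2r _ 2) ?nnegrE ?addr_ge0 ?ipnorm_ge0 //.
rewrite ipnorm_sqr // ipDl // !ipDr // !ip_self // [ip v u]ipC //.
have := ip_cauchy_schwarz Hu Hv; have := Re_le_modc (ip u v).
rewrite ler_norml sqrrD; case: (ip u v) => x y /= /andP[h1 h2] h3.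
rewrite mulr2n; lra.
Qed.

Lemma ipnormB u v : H u -> H v -> nrm (u - v) <= nrm u + nrm v.
Proof.
by move=> Hu Hv; rewrite -(ipnormN Hv) ipnormD //; exact: si_opp.
Qed.

Lemma semi_inner_sub (M : set V) : M `<=` H -> Defs.subspace M -> semi_inner M.
Proof.
move=> MH Ms; split => // [a u v w|u v|u] *.
- by rewrite (si_linear siH) //; exact: MH.
- by apply: (si_conj siH); exact: MH.
- by apply: (si_ge0 siH); exact: MH.
Qed.

Section Fourier.
Variable e : nat -> V.
Hypothesis onb : orthonormal_basis ip H e.

Let He n : H (e n). Proof. by case: onb. Qed.
Let ee m n : ip (e m) (e n) = (m == n)%:R. Proof. by case: onb. Qed.
Local Hint Resolve He : core.

Definition fourier_sum f N := \sum_(n < N) ip f (e n) *: e n.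

Lemma fourier_sum_in f N : H (fourier_sum f N).
Proof. by apply: si_sum => i; exact: si_scale. Qed.
Local Hint Resolve fourier_sum_in : core.

Lemma ip_basis_sum (c : nat -> C) N m :
  ip (\sum_(n < N) c n *: e n) (e m) = if (m < N)%N then c m else 0.
Proof.
rewrite ip_suml //; last by move=> i; exact: si_scale.
under eq_bigr do rewrite ipZl // ee.
case: ifPn => [mN|/negP mN].
  rewrite (bigD1 (Ordinal mN)) //= eqxx mulr1 big1 ?addr0 // => i im.
  case: eqP => [E|_]; last by rewrite mulr0.
  by case/eqP: im; apply/val_inj.
rewrite big1 // => i _; case: eqP => [E|_]; last by rewrite mulr0.
by case: mN; rewrite -E.
Qed.

Lemma norm_basis_sum (c : nat -> C) N :
  nrm (\sum_(n < N) c n *: e n) ^+ 2 = \sum_(n < N) modc (c n) ^+ 2.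
Proof.
have HS : H (\sum_(n < N) c n *: e n) by apply: si_sum => i; exact: si_scale.
rewrite ipnorm_sqr // ip_sumr //; last by move=> i; exact: si_scale.
rewrite raddf_sum /=; apply: eq_bigr => i _; rewrite ipZr // ip_basis_sum ltn_ord.
by rewrite modc_sqr; case: (c i) => x y /=; ring.
Qed.

Lemma fourier_residual f N m : H f -> (m < N)%N -> ip (f - fourier_sum f N) (e m) = 0.
Proof.
by move=> Hf mN; rewrite ipBl // (ip_basis_sum (fun n => ip f (e n))) mN subrr.
Qed.

Lemma fourier_pythagoras f N : H f ->
  nrm f ^+ 2 = nrm (f - fourier_sum f N) ^+ 2 + \sum_(n < N) modc (ip f (e n)) ^+ 2.
Proof.
move=> Hf; rewrite -(norm_basis_sum (fun n => ip f (e n))) -pythagoras ?subrK //.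
- exact: si_sub.
- exact: fourier_sum_in.
- rewrite ip_sumr //; last 1 first.
  + exact: si_sub.
  + rewrite big1 // => i _; rewrite ipZr ?fourier_residual ?mulr0 //; exact: si_sub.
  by move=> i; exact: si_scale.
Qed.

Lemma bessel f N : H f -> \sum_(n < N) modc (ip f (e n)) ^+ 2 <= nrm f ^+ 2.
Proof. by move=> Hf; rewrite (fourier_pythagoras N Hf) lerDr exprn_ge0 ?ipnorm_ge0. Qed.

Lemma fourier_best f N (c : nat -> C) : H f ->
  nrm (f - fourier_sum f N) <= nrm (f - \sum_(n < N) c n *: e n).
Proof.
move=> Hf; rewrite -(@ler_pXn2r _ 2) ?nnegrE ?ipnorm_ge0 //.
have -> : f - \sum_(n < N) c n *: e n = (f - fourier_sum f N) +
    \sum_(n < N) (ip f (e n) - c n) *: e n.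
  under [X in _ = _ + X]eq_bigr do rewrite scalerBl.
  by rewrite sumrB addrA subrK.
rewrite [leRHS]pythagoras ?lerDl ?exprn_ge0 ?ipnorm_ge0 //.
- exact: si_sub.
- by apply: si_sum => i; exact: si_scale.
- rewrite ip_sumr //; last 1 first.
  + exact: si_sub.
  + rewrite big1 // => i _; rewrite ipZr ?fourier_residual ?mulr0 //; exact: si_sub.
  by move=> i; exact: si_scale.
Qed.

(** [orthonormal_basis] promises one good combination for each error; best approximation transfers
    it to every longer Fourier sum. *)
Lemma fourier_cvg f (d : R) : H f -> 0 < d ->
  exists N, forall K, (N <= K)%N -> nrm (f - fourier_sum f K) < d.
Proof.
move=> Hf d0; case: onb => _ _ /(_ f Hf d d0)[N [c Hc]].
exists N => K NK; apply: le_lt_trans Hc.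
have -> : \sum_(i < N) c i *: e i =
    \sum_(i < K) (if (i < N)%N then c i else 0) *: e i.
  rewrite -!(big_mkord xpredT (fun i => (if (i < N)%N then c i else 0) *: e i)).
  rewrite (big_cat_nat (leq0n N) NK) /= [X in _ + X]big_nat_cond [X in _ + X]big1.
    by rewrite addr0 big_mkord; apply: eq_bigr => i _; rewrite ltn_ord.
  by move=> i /andP[/andP[Ni _] _]; rewrite ltnNge Ni scale0r.
exact: (fourier_best K (fun i => if (i < N)%N then c i else 0)).
Qed.

Lemma ip_fourier_sum f g N : H f -> H g ->
  ip (fourier_sum f N) g = \sum_(n < N) ip f (e n) * conjc (ip g (e n)).
Proof.
move=> Hf Hg; rewrite ip_suml //; last by move=> i; exact: si_scale.
by apply: eq_bigr => i _; rewrite ipZl // [ip (e i) g]ipC.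
Qed.

Lemma parseval f g (d : R) : H f -> H g -> 0 < d -> exists N, forall K, (N <= K)%N ->
  modc (ip f g - \sum_(n < K) ip f (e n) * conjc (ip g (e n))) <= d.
Proof.
move=> Hf Hg d0; have n1 : 0 < nrm g + 1 by rewrite ltr_wpDl ?ipnorm_ge0.
have [N HN] := fourier_cvg Hf (divr_gt0 d0 n1).
exists N => K /HN; rewrite -ip_fourier_sum // -ipBl // ltr_pdivlMr // => HK.
rewrite (le_trans (ip_cauchy_schwarz (si_sub Hf (fourier_sum_in f K)) Hg)) //.
apply: le_trans (ltW HK); rewrite ler_wpM2l ?ipnorm_ge0 //; lra.
Qed.

(** Turns coefficient bounds into norm bounds; with [B = 0] it shows that vanishing coefficients
    force norm 0. *)
Lemma norm_le_of_coef f (B : R) : H f -> 0 <= B ->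
  (forall N, \sum_(n < N) modc (ip f (e n)) ^+ 2 <= B ^+ 2) -> nrm f <= B.
Proof.
move=> Hf B0 HB; apply/ler_addgt0Pr => d d0.
have [N /(_ N (leqnn N)) HN] := fourier_cvg Hf d0.
have -> : f = (f - fourier_sum f N) + fourier_sum f N by rewrite subrK.
rewrite (le_trans (ipnormD _ _)) //; first exact: si_sub.
rewrite addrC lerD ?(ltW HN) // -(@ler_pXn2r _ 2) ?nnegrE ?ipnorm_ge0 //.
by rewrite (norm_basis_sum (fun n => ip f (e n))).
Qed.

End Fourier.
End SemiInner.

(** * Operators that double the index of a basis *)

Section DyadicIndex.

(** A positive [n] is uniquely [(2 i + 1) 2 ^ j], and [i], half of the odd part rounded down, labels
    its orbit under doubling. The fixed point 0 gets [None]. *)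
Definition dyadic_index (n : nat) : option nat :=
  if n == 0%N then None else Some (n %/ 2 ^ logn 2 n)./2.

Lemma dyadic_index_odd_mul i j : dyadic_index (i.*2.+1 * 2 ^ j) = Some i.
Proof.
have p0 : (0 < 2 ^ j)%N by rewrite expn_gt0.
rewrite /dyadic_index -[in X in if X then _ else _](subnK p0) muln_eq0 /= subnK //.
rewrite (gtn_eqF p0) lognM // (pfactorK j (isT : prime 2)).
rewrite (lognE 2 i.*2.+1) /= dvdn2 /= odd_double add0n mulnK //.
by rewrite -[i.*2.+1]add1n -addnn -/(uphalf _) ; congr Some; lia.
Qed.

Lemma dyadic_index_SomeP n i : dyadic_index n = Some i ->
  exists j, n = (i.*2.+1 * 2 ^ j)%N.
Proof.
rewrite /dyadic_index; case: ifPn => // n0 [<-]; exists (logn 2 n).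
have n0' : (0 < n)%N by rewrite lt0n.
have odd_part : odd (n %/ 2 ^ logn 2 n).
  have := pfactor_coprime (isT : prime 2) n0' => -[m cm nE].
  by rewrite {1}nE mulnK ?expn_gt0 // -coprime2n.
have := odd_double_half (n %/ 2 ^ logn 2 n); rewrite odd_part add1n => ->.
by rewrite divnK // pfactor_dvdnn.
Qed.

Lemma dyadic_index_None n : dyadic_index n = None -> n = 0%N.
Proof. by rewrite /dyadic_index; case: eqP. Qed.

Lemma dyadic_index_double n : dyadic_index n.*2 = dyadic_index n.
Proof.
case E : (dyadic_index n) => [i|]; last by rewrite (dyadic_index_None E).
have [j ->] := dyadic_index_SomeP E.
by rewrite -muln2 -mulnA -expnSr dyadic_index_odd_mul.
Qed.

End DyadicIndex.

(** * Norms and reducing subspaces of a doubling operator *)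

Section DoublingShift.
Variables (R : realType) (V : lmodType R[i]) (ip : V -> V -> R[i]).
Local Notation C := R[i].
Local Notation nrm := (ipnorm ip).
Variables (H : set V) (e : nat -> V) (w : nat -> R) (S T : V -> V).
Hypothesis siH : semi_inner ip H.
Hypothesis definite : forall u, H u -> nrm u = 0 -> u = 0.
Hypothesis onb : orthonormal_basis ip H e.
Hypothesis w_gt0 : forall n, 0 < w n.
Hypothesis w_le1 : forall n, w n <= 1.
Hypothesis HS : forall u, H u -> H (S u).
Hypothesis ST : is_adjoint ip H S T.
Hypothesis Te : forall n, T (e n) = (w n)%:C *: e n.*2.

Let He n : H (e n). Proof. by case: onb. Qed.
Let ee m n : ip (e m) (e n) = (m == n)%:R. Proof. by case: onb. Qed.
Let HT u : H u -> H (T u). Proof. by case: ST => -[+ _ _] _; apply. Qed.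
Let Tlin a u v : H u -> H v -> T (a *: u + v) = a *: T u + T v.
Proof. by case: ST => -[_ + _] _; apply. Qed.
Let adj u v : H u -> H v -> ip (S u) v = ip u (T v).
Proof. by case: ST => _; apply. Qed.
Let w_ge0 n : 0 <= w n := ltW (w_gt0 n).
Local Hint Resolve He HT HS w_ge0 : core.
Let scl := si_scale siH.
Local Hint Resolve scl : core.

Lemma coef_ext u v : H u -> H v -> (forall n, ip u (e n) = ip v (e n)) -> u = v.
Proof.
move=> Hu Hv E; have Huv := si_sub siH Hu Hv; apply/eqP; rewrite -subr_eq0; apply/eqP.
apply: definite => //; apply/eqP; rewrite eq_le ipnorm_ge0 andbT.
apply: (norm_le_of_coef siH onb) => // N; rewrite big1 ?expr0n // => i _.
by rewrite (ipBl siH) // E subrr modc0 expr0n.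
Qed.

Lemma S_coef f n : H f -> ip (S f) (e n) = (w n)%:C * ip f (e n.*2).
Proof. by move=> Hf; rewrite adj // Te (ipZr siH) // conjc_real. Qed.

Lemma S_even n : S (e n.*2) = (w n)%:C *: e n.
Proof.
apply: coef_ext; auto => m.
rewrite S_coef // (ipZl siH) // !ee.
case: eqP => [/double_inj ->|nm]; first by rewrite eqxx.
by case: eqP => [nm'|]; rewrite ?mulr0 //; case: nm; rewrite nm'.
Qed.

Lemma S_odd n : S (e n.*2.+1) = 0.
Proof.
apply: coef_ext; auto; first exact: (si_subspace siH).1.
move=> m; rewrite S_coef // (ip0l siH) // ee.
by case: eqP => [E|]; rewrite ?mulr0 //; lia.
Qed.

Lemma T_coef_even f n : H f -> ip (T f) (e n.*2) = (w n)%:C * ip f (e n).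
Proof.
move=> Hf; rewrite (ipC siH (HT Hf) (He _)) -adj // S_even (ipZl siH) // conjc_realM.
by rewrite -(ipC siH).
Qed.

Lemma T_coef_odd f n : H f -> ip (T f) (e n.*2.+1) = 0.
Proof. by move=> Hf; rewrite (ipC siH (HT Hf) (He _)) -adj // S_odd (ip0l siH) // rmorph0. Qed.

Lemma sum_double (F : nat -> R) N :
  \sum_(m < N.*2) F m = \sum_(n < N) (F n.*2 + F n.*2.+1).
Proof.
by elim: N => [|N IH]; rewrite ?big_ord0 // doubleS !big_ord_recr /= IH addrA.
Qed.

Lemma modc_w_le (z : C) n : modc ((w n)%:C * z) ^+ 2 <= modc z ^+ 2.
Proof.
rewrite lerXn2r ?nnegrE ?modc_ge0 // modcM modcR ger0_norm //.
by rewrite ler_piMl ?modc_ge0.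
Qed.

Lemma T_contraction f : H f -> nrm (T f) <= nrm f.
Proof.
move=> Hf; apply: (norm_le_of_coef siH onb); auto; first exact: ipnorm_ge0.
move=> N; apply: le_trans (bessel siH onb N Hf).
apply: (@le_trans _ _ (\sum_(n < N.*2) modc (ip (T f) (e n)) ^+ 2)).
  rewrite -!(big_mkord xpredT (fun n => modc (ip (T f) (e n)) ^+ 2)).
  have NN : (N <= N.*2)%N by rewrite -addnn leq_addl.
  by rewrite (big_cat_nat (leq0n N) NN) /= lerDl sumr_ge0 // => i _; rewrite exprn_ge0 ?modc_ge0.
rewrite (sum_double (fun n => modc (ip (T f) (e n)) ^+ 2)); apply: ler_sum => n _.
by rewrite T_coef_odd // modc0 expr0n addr0 T_coef_even // modc_w_le.
Qed.

Lemma S_contraction f : H f -> nrm (S f) <= nrm f.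
Proof.
move=> Hf; apply: (norm_le_of_coef siH onb); auto; first exact: ipnorm_ge0.
move=> N; apply: le_trans (bessel siH onb N.*2 Hf).
rewrite (sum_double (fun n => modc (ip f (e n)) ^+ 2)); apply: ler_sum => n _.
by rewrite S_coef // (le_trans (modc_w_le _ _)) // lerDl exprn_ge0 ?modc_ge0.
Qed.

(** [is_adjoint] asserts linearity of the adjoint [T]; it passes to [S] through the coefficients. *)
Lemma S_linear a u v : H u -> H v -> S (a *: u + v) = a *: S u + S v.
Proof.
move=> Hu Hv; have Hw := si_lin siH a Hu Hv.
apply: coef_ext; [exact: HS|by apply: (si_lin siH); exact: HS|].
move=> n; rewrite S_coef // !(si_linear siH); auto.
by rewrite !S_coef // mulrDr; ring.
Qed.

Lemma contractive_of_contraction (A : V -> V) : (forall u, H u -> H (A u)) ->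
  (forall a u v, H u -> H v -> A (a *: u + v) = a *: A u + A v) ->
  (forall u, H u -> nrm (A u) <= nrm u) -> contractive ip H A.
Proof.
move=> HA Alin Ac; split; first by split => //; exists 1 => u Hu; rewrite mul1r Ac.
have H0 := (si_subspace siH).1; apply: ge_sup.
  exists (nrm (A 0)); exists 0 => //; split=> //.
  by rewrite (ipnorm0 siH).
by move=> x [u [Hu u1] <-]; rewrite (le_trans (Ac _ Hu)).
Qed.

Lemma doubling_contractive : contractive ip H T.
Proof. by apply: contractive_of_contraction => //; exact: T_contraction. Qed.

Lemma halving_contractive : contractive ip H S.
Proof.
by apply: contractive_of_contraction => //; [exact: S_linear|exact: S_contraction].
Qed.

(* [e 1] is in the kernel of [S] but not in that of its adjoint. *)
Lemma halving_not_hyponormal : ~ hyponormal ip H S.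
Proof.
case=> _ [S' [[HS' S'lin _] adj'] Hpos].
have S'1 : H (S' (e 1)) by apply: HS'.
have H0 := (si_subspace siH).1.
have S'0 : S' 0 = 0.
  have := S'lin 1 0 0 H0 H0; rewrite !scale1r addr0 => /eqP.
  by rewrite -subr_eq0 opprD addrA subrr sub0r oppr_eq0 => /eqP.
have := Hpos _ (He 1); rewrite (S_odd 0) S'0 sub0r (ipNl siH) //; last exact: HS.
rewrite adj' // (ip_self siH) // oppr_ge0 -[0]/(0%:C) lecR => h.
have S'10 : S' (e 1) = 0.
  apply: definite => //; apply/eqP; rewrite -[_ == 0](expf_eq0 _ 2) eq_le h.
  by rewrite exprn_ge0 ?ipnorm_ge0.
(* Positivity at [e 1] forces [S' (e 1) = 0], whereas [S (e 2)] is [w 1] times [e 1]; the pairing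
   would give [w 1 = 0]. *)
have := adj' (e 2) (e 1) (He 2) (He 1).
rewrite (S_even 1) (ipZl siH) // ee S'10 (ip0r siH) // mulr1.
by move=> /(congr1 (@complex.Re R)) /= /eqP; rewrite gt_eqF.
Qed.

(** The closed span of the [e n] of index [o], described by vanishing coefficients so that
    closedness is just continuity of the form. *)
Definition dyadic_space (o : option nat) : set V :=
  [set f | H f /\ forall n, dyadic_index n != o -> ip f (e n) = 0].

Lemma basis_dyadic n : dyadic_space (dyadic_index n) (e n).
Proof.
by split=> // m; rewrite ee; case: (n =P m) => // ->; rewrite eqxx.
Qed.

Lemma dyadic_subspace o : Defs.subspace (dyadic_space o).
Proof.
have H0 := (si_subspace siH).1.
split; first by split => // n _; rewrite (ip0l siH).
move=> a u v [Hu Zu] [Hv Zv]; split; first exact: (si_lin siH).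
by move=> n no; rewrite (si_linear siH) // Zu // Zv // mulr0 addr0.
Qed.

Lemma dyadic_semi_inner o : semi_inner ip (dyadic_space o).
Proof. by apply: (semi_inner_sub siH); [move=> u []|exact: dyadic_subspace]. Qed.

Lemma dyadic_closed o : closed_subspace ip H (dyadic_space o).
Proof.
split; [exact: dyadic_subspace|by move=> u []|].
move=> x l Hx Hl xl; split=> // n no; apply/modc_eq0/eqP.
rewrite eq_le modc_ge0 andbT; apply/ler_addgt0Pr => d d0; rewrite add0r.
have /cvgrPdist_lt/(_ _ d0)[N _ /(_ N (leqnn N))] := xl.
rewrite /= sub0r normrN ger0_norm ?ipnorm_ge0 // => /ltW Nd.
have [HxN xN0] := Hx N.
have -> : ip l (e n) = - ip (x N - l) (e n) by rewrite (ipBl siH) // xN0 // sub0r opprK.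
rewrite modcN (le_trans (ip_cauchy_schwarz siH _ _)) //; first exact: (si_sub siH).
have -> : nrm (e n) = 1 by rewrite /ipnorm ee eqxx /= sqrtr1.
by rewrite mulr1.
Qed.

Lemma dyadic_T o u : dyadic_space o u -> dyadic_space o (T u).
Proof.
move=> [Hu Zu]; split; first exact: HT.
move=> n; rewrite -(odd_double_half n); case: (odd n) => /=.
  by rewrite add1n T_coef_odd.
rewrite add0n dyadic_index_double => no.
by rewrite T_coef_even // Zu // mulr0.
Qed.

Lemma dyadic_S o u : dyadic_space o u -> dyadic_space o (S u).
Proof.
move=> [Hu Zu]; split; first exact: HS.
by move=> n no; rewrite S_coef // Zu ?mulr0 // dyadic_index_double.
Qed.

Lemma dyadic_reducing o : reducing ip H T (dyadic_space o).
Proof.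
split; [exact: dyadic_closed|exact: dyadic_T|].
move=> u Hu uM v Mv; have [Hv _] := Mv.
have [HSv _] := dyadic_S Mv.
by rewrite (ipC siH (HT Hu) Hv) -adj // (ipC siH) // uM ?rmorph0 //; exact: dyadic_S.
Qed.

Lemma dyadic_orthogonal i j u v : i != j -> dyadic_space i u -> dyadic_space j v ->
  ip u v = 0.
Proof.
move=> ij [Hu Zu] [Hv Zv]; apply/modc_eq0/eqP; rewrite eq_le modc_ge0 andbT.
apply/ler_addgt0Pr => d d0; rewrite add0r.
have [N /(_ N (leqnn N))] := parseval siH onb Hu Hv d0.
rewrite big1 ?subr0 // => n _.
have [ni|ni] := eqVneq (dyadic_index n) i; last by rewrite Zu // mul0r.
by rewrite Zv ?rmorph0 ?mulr0 // ni.
Qed.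

Lemma dyadic_sum : orthogonal_sum ip H T dyadic_space.
Proof.
split; [exact: dyadic_reducing|exact: dyadic_orthogonal|].
move=> f Hf d d0; have [N /(_ N (leqnn N)) HN] := fourier_cvg siH onb Hf d0.
(* A Fourier sum of length [N] is regrouped by index; [undup] counts each index once. *)
exists (undup [seq dyadic_index n | n <- iota 0 N]).
exists (fun o => \sum_(n < N | dyadic_index n == o) ip f (e n) *: e n).
split.
  move=> o; apply: (big_ind (dyadic_space o)); first exact: (dyadic_subspace o).1.
    by move=> x y; exact: (si_add (dyadic_semi_inner o)).
  move=> n /eqP <-; apply: (si_scale (dyadic_semi_inner _)); exact: basis_dyadic.
suff -> : \sum_(o <- undup [seq dyadic_index n | n <- iota 0 N])
    \sum_(n < N | dyadic_index n == o) ip f (e n) *: e n = fourier_sum ip e f N by [].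
rewrite (exchange_big_dep xpredT) //=; apply: eq_bigr => n _.
rewrite -big_filter (_ : seq.filter _ _ = [:: dyadic_index n]) ?big_seq1 //.
have U : uniq (undup [seq dyadic_index n | n <- iota 0 N]) := undup_uniq _.
apply: perm_small_eq => //; apply: uniq_perm => //; first exact: filter_uniq.
move=> o; rewrite mem_filter mem_seq1 mem_undup eq_sym.
case: eqP => // ->; apply: map_f; by rewrite mem_iota add0n /=.
Qed.

Lemma dyadic_None : dyadic_space None = [set c *: e 0 | c in [set: C]].
Proof.
rewrite predeqE => f; split=> [[Hf Zf]|[c _ <-]].
  exists (ip f (e 0)) => //; apply: coef_ext; auto => n.
  rewrite (ipZl siH) // ee; case: eqP => [<-|n0]; first by rewrite mulr1.
  rewrite mulr0 Zf //; apply/negP => /eqP/dyadic_index_None n0'.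
  by apply: n0; rewrite n0'.
by apply: (si_scale (dyadic_semi_inner None)); exact: (basis_dyadic 0).
Qed.

Lemma bounded_of_invariant (M : set V) : M `<=` H -> (forall u, M u -> M (T u)) ->
  bounded_operator ip ip M M T.
Proof.
move=> MH MT; split => //.
  by move=> a u v /MH Hu /MH Hv; exact: Tlin.
by exists 1 => u /MH Hu; rewrite mul1r T_contraction.
Qed.

Lemma dyadic_None_normal : normal_operator ip (dyadic_space None) T.
Proof.
have MH : dyadic_space None `<=` H by move=> u [].
have bT := bounded_of_invariant MH (@dyadic_T None).
split => //; exists T => //; split => // u v.
rewrite dyadic_None => -[a _ <-] [b _ <-].
have H0 := (si_subspace siH).1.
have TZ c : T (c *: e 0) = (w 0)%:C *: (c *: e 0).
  have := Tlin c (He 0) H0; rewrite addr0 => ->; rewrite Te scalerA mulrC -scalerA.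
  have -> : T 0 = 0.
    have := Tlin 1 H0 H0; rewrite !scale1r addr0 => /eqP.
    by rewrite -subr_eq0 opprD addrA subrr sub0r oppr_eq0 => /eqP.
  by rewrite addr0.
by rewrite !TZ (ipZl siH) ?(ipZr siH) ?conjc_real; auto.
Qed.

(** Among the indices below [m * 2 ^ J] only the [m * 2 ^ j] with [j < J] carry a coefficient. At
    these cut points the Fourier sums of the full basis are those of the summand, which yields
    density there. *)
Lemma dyadic_fourier_sum i f J : dyadic_space (Some i) f ->
  fourier_sum ip e f (i.*2.+1 * 2 ^ J) =
  \sum_(j < J) ip f (e (i.*2.+1 * 2 ^ j)%N) *: e (i.*2.+1 * 2 ^ j)%N.
Proof.
move=> [Hf Zf]; set m := i.*2.+1.
elim: J => [|J IH].
  rewrite big_ord0 expn0 muln1 /fourier_sum big1 // => -[n nm] _ /=.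
  rewrite Zf ?scale0r //; apply/negP => /eqP/dyadic_index_SomeP[j nE].
  move: nm; rewrite nE -/m -{2}[m]muln1 ltn_pmul2l // ltnNge expn_gt0 //.
rewrite big_ord_recr /= -IH /fourier_sum.
rewrite -!(big_mkord xpredT (fun n => ip f (e n) *: e n)).
have lt1 : (m * 2 ^ J < m * 2 ^ J.+1)%N by rewrite ltn_pmul2l // ltn_exp2l.
rewrite (big_cat_nat (leq0n _) (ltnW lt1)) /=; congr (_ + _).
rewrite big_ltn // big_nat_cond big1 ?addr0 // => n /andP[/andP[n1 n2] _].
rewrite Zf ?scale0r //; apply/negP => /eqP/dyadic_index_SomeP[j nE].
move: n1 n2; rewrite nE -/m !ltn_pmul2l // !ltn_exp2l //; lia.
Qed.

Lemma dyadic_basis i :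
  orthonormal_basis ip (dyadic_space (Some i)) (fun j => e (i.*2.+1 * 2 ^ j)%N).
Proof.
split.
- by move=> j; rewrite -(dyadic_index_odd_mul i j); exact: basis_dyadic.
- by move=> m n; rewrite ee eqn_pmul2l // eqn_exp2l.
move=> f Mf d d0; have [Hf _] := Mf.
have [N HN] := fourier_cvg siH onb Hf d0.
exists N, (fun j => ip f (e (i.*2.+1 * 2 ^ j)%N)).
rewrite -dyadic_fourier_sum //; apply: HN.
by rewrite (leq_trans (ltnW (ltn_expl N (isT : 1 < 2)%N))) // leq_pmull.
Qed.

Lemma dyadic_weighted_shift i : weighted_shift ip (dyadic_space (Some i)) T
  (fun j => w (i.*2.+1 * 2 ^ j)%N).
Proof.
split=> //; first by exists 1.
exists (fun j => e (i.*2.+1 * 2 ^ j)%N); first exact: dyadic_basis.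
by move=> j; rewrite Te expnS mulnCA mul2n.
Qed.

Lemma doubling_normal_plus_shifts (Q : set V -> (nat -> R) -> Prop) :
  (forall i, Q (dyadic_space (Some i)) (fun j => w (i.*2.+1 * 2 ^ j)%N)) ->
  normal_plus_shifts ip H T Q.
Proof.
move=> HQ; exists dyadic_space, (fun i j => w (i.*2.+1 * 2 ^ j)%N); split.
- exact: dyadic_sum.
- rewrite dyadic_None; exists (e 0) => // e00.
  have := ee 0 0; rewrite e00 (ip0l siH); last exact: (si_subspace siH).1.
  by move=> /eqP; rewrite eq_sym oner_eq0.
- exact: dyadic_None_normal.
- by move=> i; split; [exact: dyadic_weighted_shift|exact: HQ].
Qed.

End DoublingShift.

(** * Integration on the disk *)

Section SquareIntegrable.
Context d (T : measurableType d) (R : realType).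
Variables (mu : {measure set T -> \bar R}) (D : set T).
Hypothesis mD : measurable D.
Implicit Types u v w : T -> R.

Definition sqint u := measurable_fun D u /\
  (\int[mu]_(p in D) (u p ^+ 2)%:E < +oo)%E.

Definition rdot u v : R := Rintegral mu D (fun p => u p * v p).

Lemma sqint_integrable u : sqint u -> mu.-integrable D (EFin \o (fun p => u p ^+ 2)).
Proof.
move=> [mu_ fu]; apply/integrableP; split.
  by apply/measurable_EFinP; exact: measurable_funX.
under eq_integral do rewrite /= ger0_norm ?sqr_ge0 //.
exact: fu.
Qed.

Lemma sqint_mul u v : sqint u -> sqint v -> mu.-integrable D (EFin \o (fun p => u p * v p)).
Proof.
move=> su sv; have [mu_ _] := su; have [mv _] := sv.
have H := integrableD mD (sqint_integrable su) (sqint_integrable sv).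
apply: le_integrable H => //.
  by apply/measurable_EFinP; exact: measurable_funM.
move=> p Dp /=; rewrite lee_fin [leRHS]ger0_norm ?addr_ge0 ?sqr_ge0 //.
have h1 := sqr_ge0 (u p - v p); have h2 := sqr_ge0 (u p + v p).
rewrite sqrrB in h1; rewrite sqrrD in h2.
by rewrite ler_norml; apply/andP; split; lra.
Qed.

Lemma sqintZ (a : R) u : sqint u -> sqint (fun p => a * u p).
Proof.
move=> su; have [mu_ _] := su; split; first exact: measurable_funM.
have H := integrableZl mD (a ^+ 2) (sqint_integrable su).
have /integrableP[_] := H; apply: le_lt_trans.
apply: ge0_le_integral => //.
- by move=> p _; rewrite lee_fin sqr_ge0.
- by apply/measurable_EFinP; apply: measurable_funX; exact: measurable_funM.
- by have /integrableP[+ _] := H; exact: measurableT_comp.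
- by move=> p _; rewrite /= lee_fin exprMn ler_norm.
Qed.

Lemma sqintD u v : sqint u -> sqint v -> sqint (fun p => u p + v p).
Proof.
move=> su sv; have [mu_ _] := su; have [mv _] := sv.
split; first exact: measurable_funD.
have H := integrableZl mD 2 (integrableD mD (sqint_integrable su) (sqint_integrable sv)).
have /integrableP[mH] := H; apply: le_lt_trans.
apply: ge0_le_integral => //.
- by move=> p _; rewrite lee_fin sqr_ge0.
- by apply/measurable_EFinP; apply: measurable_funX; exact: measurable_funD.
- exact: measurableT_comp.
- move=> p _; rewrite /= lee_fin (le_trans _ (ler_norm _)) //.
  by have := sqr_ge0 (u p - v p); rewrite sqrrB sqrrD; lra.
Qed.

Lemma rdotC u v : rdot u v = rdot v u.
Proof. by rewrite /rdot; under eq_fun do rewrite mulrC. Qed.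

Lemma rdotDl u v w : sqint u -> sqint v -> sqint w ->
  rdot (fun p => u p + v p) w = rdot u w + rdot v w.
Proof.
move=> su sv sw; rewrite /rdot -RintegralD //; [|exact: sqint_mul..].
by apply: eq_Rintegral => p _; rewrite mulrDl.
Qed.

Lemma rdotZl (a : R) u w : sqint u -> sqint w ->
  rdot (fun p => a * u p) w = a * rdot u w.
Proof.
move=> su sw; rewrite /rdot -RintegralZl //; last exact: sqint_mul.
by apply: eq_Rintegral => p _; rewrite mulrA.
Qed.

Lemma rdot_ge0 u : 0 <= rdot u u.
Proof. by apply: Rintegral_ge0 => p _; rewrite -expr2 sqr_ge0. Qed.

End SquareIntegrable.

(** * The semi-inner product on [L2disk] *)

Section L2Disk.
Variable R : realType.
Local Notation C := R[i].
Local Notation V := (C -> C^o).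
Local Notation mu := ((@lebesgue_measure R \x @lebesgue_measure R)%E).
Local Notation D := (@disk2 R).
Local Notation RR := (measurableTypeR R * measurableTypeR R)%type.
Implicit Types f g h : V.

Lemma disk2E : D = [set p | p.1 ^+ 2 + p.2 ^+ 2 < 1].
Proof.
rewrite predeqE => p; rewrite /disk2 /disk /plane /= norm_modc ltcR modcE /=.
rewrite -[X in _ < X]sqrtr1 ltr_sqrt //.
Qed.

Lemma measurable_fst_real : @measurable_fun _ _ RR R setT (fun p => p.1).
Proof. exact: (@measurable_fst _ _ (measurableTypeR R) (measurableTypeR R)). Qed.

Lemma measurable_snd_real : @measurable_fun _ _ RR R setT (fun p => p.2).
Proof. exact: (@measurable_snd _ _ (measurableTypeR R) (measurableTypeR R)). Qed.

Lemma measurable_sqr_norm :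
  @measurable_fun _ _ RR R setT (fun p => p.1 ^+ 2 + p.2 ^+ 2).
Proof.
by apply: measurable_funD; apply: measurable_funX;
  [exact: measurable_fst_real|exact: measurable_snd_real].
Qed.

Lemma measurable_disk2 : measurable (D : set RR).
Proof.
rewrite disk2E.
have -> : [set p : R * R | p.1 ^+ 2 + p.2 ^+ 2 < 1] =
  setT `&` (fun p : RR => p.1 ^+ 2 + p.2 ^+ 2) @^-1` `]-oo, 1[%classic.
  by rewrite setTI predeqE => p /=; rewrite in_itv.
exact: measurable_sqr_norm.
Qed.

Lemma L2disk_sqint f : L2disk f <->
  [/\ forall z, ~ disk z -> f z = 0, sqint mu D (re_part f) & sqint mu D (im_part f)].
Proof.
have mD := measurable_disk2; split=> [[f0 mr mi fi]|[f0 sr si]].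
  have mr' : @measurable_fun _ _ RR R D (re_part f) := mr.
  have mi' : @measurable_fun _ _ RR R D (im_part f) := mi.
  split => //; (split => //; apply: le_lt_trans fi; apply: ge0_le_integral => //).
  - by move=> p _; rewrite lee_fin sqr_ge0.
  - by apply/measurable_EFinP; exact: measurable_funX.
  - by apply/measurable_EFinP; apply: measurable_funD; exact: measurable_funX.
  - by move=> p _; rewrite lee_fin lerDl sqr_ge0.
  - by move=> p _; rewrite lee_fin sqr_ge0.
  - by apply/measurable_EFinP; exact: measurable_funX.
  - by apply/measurable_EFinP; apply: measurable_funD; exact: measurable_funX.
  - by move=> p _; rewrite lee_fin lerDr sqr_ge0.
have [mr _] := sr; have [mi _] := si; split => //.
have /integrableP[_] := integrableD mD (sqint_integrable sr) (sqint_integrable si).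
apply: le_lt_trans; apply: ge0_le_integral => //.
- by move=> p _; rewrite lee_fin addr_ge0 ?sqr_ge0.
- by apply/measurable_EFinP; apply: measurable_funD; exact: measurable_funX.
- apply: measurableT_comp => //; apply/measurable_EFinP.
  by apply: measurable_funD; exact: measurable_funX.
- by move=> p _; rewrite /= lee_fin ler_norm.
Qed.

Lemma dotE f g : L2disk f -> L2disk g -> dot f g = (pi^-1)%:C *
  ((rdot mu D (re_part f) (re_part g) + rdot mu D (im_part f) (im_part g)) +i*
   (rdot mu D (im_part f) (re_part g) - rdot mu D (re_part f) (im_part g))).
Proof.
have mD := measurable_disk2.
move=> /L2disk_sqint[_ rf imf] /L2disk_sqint[_ rg ig].
rewrite /dot /disk_integral; congr (_ * (_ +i* _)).
  rewrite /rdot -RintegralD //; [|exact: sqint_mul..].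
  apply: eq_Rintegral => p _; rewrite /re_part /im_part.
  by case: (f _) => a b; case: (g _) => c d /=; ring.
rewrite /rdot -RintegralB //; [|exact: sqint_mul..].
apply: eq_Rintegral => p _; rewrite /re_part /im_part.
by case: (f _) => a b; case: (g _) => c d /=; ring.
Qed.

Lemma re_part_lin (a : C) f g p : re_part (a *: f + g) p =
  complex.Re a * re_part f p + (- complex.Im a * im_part f p + re_part g p).
Proof.
rewrite /re_part /im_part; change ((a *: f + g) (plane p)) with (a * f (plane p) + g (plane p)).
by case: a => x y; case: (f _) => b c; case: (g _) => d e /=; ring.
Qed.

Lemma im_part_lin (a : C) f g p : im_part (a *: f + g) p =
  complex.Re a * im_part f p + (complex.Im a * re_part f p + im_part g p).
Proof.
rewrite /re_part /im_part; change ((a *: f + g) (plane p)) with (a * f (plane p) + g (plane p)).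
by case: a => x y; case: (f _) => b c; case: (g _) => d e /=; ring.
Qed.

Lemma L2disk_subspace : Defs.subspace (@L2disk R).
Proof.
have mD := measurable_disk2; split.
  apply/L2disk_sqint; split => //.
    split; first exact: measurable_cst.
    rewrite (_ : (fun _ => _) = cst 0%E) ?integral0 ?ltry //.
    by apply/funext => p; rewrite /re_part /= expr0n.
  split; first exact: measurable_cst.
  rewrite (_ : (fun _ => _) = cst 0%E) ?integral0 ?ltry //.
  by apply/funext => p; rewrite /im_part /= expr0n.
move=> a f g /L2disk_sqint[f0 rf imf] /L2disk_sqint[g0 rg ig].
apply/L2disk_sqint; split.
- move=> z dz; change (a * f z + g z = 0).
  by rewrite f0 // g0 // mulr0 addr0.
- rewrite (_ : re_part _ = fun p => complex.Re a * re_part f p +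
    (- complex.Im a * im_part f p + re_part g p)); last first.
    by apply/funext => p; exact: re_part_lin.
  by do 2?[apply: sqintD => //]; exact: sqintZ.
- rewrite (_ : im_part _ = fun p => complex.Re a * im_part f p +
    (complex.Im a * re_part f p + im_part g p)); last first.
    by apply/funext => p; exact: im_part_lin.
  by do 2?[apply: sqintD => //]; exact: sqintZ.
Qed.

Lemma L2disk_semi_inner : semi_inner (@dot R) (@L2disk R).
Proof.
have mD := measurable_disk2; split.
- exact: L2disk_subspace.
- move=> a f g h Lf Lg Lh; have Ls := L2disk_subspace.2 a f g Lf Lg.
  rewrite !dotE //.
  have /L2disk_sqint[_ rf imf] := Lf; have /L2disk_sqint[_ rg ig] := Lg.
  have /L2disk_sqint[_ rh ih] := Lh.
  rewrite (_ : re_part (a *: f + g) = fun p => complex.Re a * re_part f p +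
    (- complex.Im a * im_part f p + re_part g p)); last first.
    by apply/funext => p; exact: re_part_lin.
  rewrite (_ : im_part (a *: f + g) = fun p => complex.Re a * im_part f p +
    (complex.Im a * re_part f p + im_part g p)); last first.
    by apply/funext => p; exact: im_part_lin.
  have E u v w k (x y : R) : sqint mu D u -> sqint mu D v -> sqint mu D w -> sqint mu D k ->
      rdot mu D (fun p => x * u p + (y * v p + w p)) k =
      x * rdot mu D u k + (y * rdot mu D v k + rdot mu D w k).
    move=> su sv sw sk; have su' := sqintZ mD x su; have sv' := sqintZ mD y sv.
    have svw := sqintD mD sv' sw.
    by rewrite (rdotDl mD su' svw sk) (rdotDl mD sv' sw sk) !rdotZl.
  rewrite !E //; case: a Ls => x y _; simpc; congr (_ +i* _); rewrite /=; ring.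
- move=> f g Lf Lg; rewrite !dotE // conjc_realM; congr (_ * _).
  rewrite /= [rdot mu D (re_part g) (re_part f)]rdotC [rdot mu D (im_part g) (im_part f)]rdotC.
  rewrite [rdot mu D (im_part g) (re_part f)]rdotC [rdot mu D (re_part g) (im_part f)]rdotC.
  by congr (_ +i* _); ring.
- move=> f Lf; rewrite dotE //=; simpc; rewrite /= mulr_ge0 ?invr_ge0 ?pi_ge0 //.
  by rewrite addr_ge0 // rdot_ge0.
Qed.

End L2Disk.

(** * Invariance of area under rotations *)

Section AreaInvariance.
Variable R : realType.
Local Notation lam := (@lebesgue_measure R).
Local Notation mu := ((lam \x lam)%E).
Local Notation RT := (measurableTypeR R).
Local Notation RR := (RT * RT)%type.

Lemma measurable_translation (t : R) :
  @measurable_fun _ _ RT RT setT (fun y => y + t).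
Proof.
have h : @measurable_fun _ _ RT R setT (fun y : R => y + t).
  by apply: measurable_funD; [exact: measurable_id|exact: measurable_cst].
exact: h.
Qed.

Lemma lebesgue_translation (t : R) (A : set RT) : measurable A ->
  lam ((fun y => y + t) @^-1` A) = lam A.
Proof.
move=> mA; rewrite -[LHS]/(pushforward lam ((fun y => y + t) : _ -> RT) A).
apply/esym/lebesgue_measure_unique => //=; first exact: measurable_translation.
move=> _ _ [[a b]] _ <-; rewrite /pushforward.
have -> : (fun y => y + t) @^-1` `]a, b] = `]a - t, b - t]%classic.
  by rewrite predeqE => y /=; rewrite !in_itv /= ltrBlDr lerBrDr.
by rewrite !lebesgue_measure_itv /= !lte_fin ltrD2r -!EFinB opprB addrA subrK.
Qed.

Definition area_invariant (phi : RR -> RR) : Prop :=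
  measurable_fun setT phi /\
  forall A : set RR, measurable A -> mu (phi @^-1` A) = mu A.

Lemma area_invariant_comp phi psi : area_invariant phi -> area_invariant psi ->
  area_invariant (phi \o psi).
Proof.
move=> [m1 i1] [m2 i2]; split; first exact: measurableT_comp.
move=> A mA; rewrite comp_preimage i2 ?i1 //.
by rewrite -[X in measurable X]setTI; exact: m1.
Qed.

Lemma measurable_shear (t : R) :
  measurable_fun setT (fun p : RR => (p.1, p.2 + t * p.1) : RR).
Proof.
apply: measurable_fun_pair; first exact: measurable_fst.
have h : @measurable_fun _ _ RR R setT (fun p => p.2 + t * p.1).
  apply: measurable_funD; first exact: measurable_snd_real.
  by apply: measurable_funM; [exact: measurable_cst|exact: measurable_fst_real].
exact: h.
Qed.

(** The product measure integrates the lengths of the vertical sections, and a shear translates each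
    section. *)
Lemma shear_invariant (t : R) :
  area_invariant (fun p : RR => (p.1, p.2 + t * p.1) : RR).
Proof.
split; first exact: measurable_shear.
move=> A mA; rewrite /product_measure1; apply: eq_integral => x _ /=.
transitivity (lam ((fun y => y + t * x) @^-1` xsection A x)).
  by congr (lam _); rewrite predeqE => y /=; rewrite /xsection /= !in_setE.
by apply: lebesgue_translation; exact: measurable_xsection.
Qed.

Lemma swap_invariant : area_invariant (fun p : RR => (p.2, p.1) : RR).
Proof.
have ms : measurable_fun setT (fun p : RR => (p.2, p.1) : RR) := @measurable_swap _ _ RT RT.
split => // A mA.
rewrite -[LHS]/(pushforward mu (fun p : RR => (p.2, p.1) : RR) A).
apply/esym/product_measure_unique => //= X Y mX mY; rewrite /pushforward.
have -> : (fun p : RR => (p.2, p.1) : RR) @^-1` (X `*` Y) = Y `*` X.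
  by rewrite predeqE => p /=; split=> -[].
by rewrite product_measure1E // muleC.
Qed.

(* A rotation is a product of three shears. *)
Lemma rotation_invariant (c s : R) : c ^+ 2 + s ^+ 2 = 1 -> c != -1 ->
  area_invariant (fun p : RR => (c * p.1 - s * p.2, s * p.1 + c * p.2) : RR).
Proof.
(* For the rotation by an angle [theta] this is minus the tangent of [theta / 2], hence the
   exclusion of [c = -1]. Conjugation by the swap [W] turns [S t] into a horizontal shear. *)
move=> cs c1; pose t := - s / (1 + c).
have c10 : 1 + c != 0 by rewrite addrC -[1]opprK subr_eq0.
pose S r := (fun p : RR => (p.1, p.2 + r * p.1) : RR).
pose W := (fun p : RR => (p.2, p.1) : RR).
have E : (fun p : RR => (c * p.1 - s * p.2, s * p.1 + c * p.2) : RR) =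
    (W \o S t \o W) \o S s \o (W \o S t \o W).
  have st : 1 + s * t = c.
    have s2 : s ^+ 2 = 1 - c ^+ 2 by lra.
    have -> : s * t = - (1 - c ^+ 2) / (1 + c) by rewrite -s2 /t; field.
    by field.
  have tc : t * (1 + c) = - s by rewrite /t divfK.
  apply/funext => -[x y]; rewrite /W /S /=.
  have E2 : y + s * (x + t * y) = s * x + c * y by rewrite -[in RHS]st; ring.
  rewrite E2; congr (_, _).
  have -> : x + t * y + t * (s * x + c * y) = (1 + s * t) * x + t * (1 + c) * y by ring.
  by rewrite st tc; ring.
rewrite E; have iW := swap_invariant.
have iX : area_invariant (W \o S t \o W).
  do 2!apply: area_invariant_comp => //; exact: shear_invariant.
do 2!apply: area_invariant_comp => //; exact: shear_invariant.
Qed.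

Lemma Rintegral_invariant (phi : RR -> RR) (D : set RR) (u : RR -> R) :
  area_invariant phi -> measurable D -> @measurable_fun _ _ RR R setT u ->
  phi @^-1` D = D -> mu.-integrable D (EFin \o (u \o phi)) ->
  Rintegral mu D (u \o phi) = Rintegral mu D u.
Proof.
move=> [mphi iphi] mD mu_ phiD iu; rewrite /Rintegral; congr fine.
transitivity (\int[pushforward mu phi]_(x in D) (EFin \o u) x)%E.
  rewrite integral_pushforward ?phiD //.
  by apply/measurable_EFinP.
by apply: eq_measure_integral => //= A mA _; exact: iphi.
Qed.

End AreaInvariance.

(** * Area under a half circle *)

Section DiskArea.
Variable R : realType.
Local Notation lam := (@lebesgue_measure R).
Local Notation mu := ((lam \x lam)%E).
Local Notation RT := (measurableTypeR R).
Local Notation RR := (RT * RT)%type.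

Lemma within_continuous (f : R -> R) (A : set R) : continuous f -> {within A, continuous f}.
Proof. by move=> cf; apply: continuous_subspaceT. Qed.

(** The substitution [x = r sin t] turns the integrand into [2 r^2 cos^2 t], with primitive
    [r^2 (t + sin t cos t)]. *)
Lemma integral_half_circle (r : R) : 0 <= r ->
  (\int[lam]_(x in `[(- r)%R, r]) (2 * Num.sqrt (r ^+ 2 - x ^+ 2))%R%:E)%E = (pi * r ^+ 2)%:E.
Proof.
move=> r0; pose F : R -> R := fun t => r * sin t.
pose G : R -> R := fun x => 2 * Num.sqrt (r ^+ 2 - x ^+ 2).
have pi0 : - (pi / 2) <= pi / 2 :> R by have := pi_ge0 R; lra.
have Fa : F (- (pi / 2)) = - r by rewrite /F sinN sin_pihalf mulrN1.
have Fb : F (pi / 2) = r by rewrite /F sin_pihalf mulr1.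
have [->|r1] := eqVneq r 0.
  by rewrite oppr0 set_itv1 integral_set1 expr0n mulr0.
have {}r0 : 0 < r by rewrite lt_def r1.
have dF (x : R) : is_derive x 1 F (r * cos x).
  have -> : F = (cst r * sin)%R by [].
  apply: is_derive_eq; by rewrite scaler0 addr0.
have F'E : derive1 F = fun x => r * cos x.
  by apply/funext => x; rewrite derive1E (@derive_val _ _ _ _ _ _ _ (dF x)).
have cF : continuous F.
  by move=> x; apply: cvgM; [exact: cvg_cst|exact: continuous_sin].
have cF' : continuous (fun x => r * cos x).
  by move=> x; apply: cvgM; [exact: cvg_cst|exact: continuous_cos].
have cG : continuous G.
  have c1 : continuous (fun x : R => r ^+ 2 - x ^+ 2).
    by move=> x; apply: (@cvgB _ R^o); [exact: cvg_cst|exact: exprn_continuous].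
  have c2 : continuous (fun x : R => Num.sqrt (r ^+ 2 - x ^+ 2)).
    by move=> x; apply: (continuous_comp (c1 x)); exact: sqrt_continuous.
  by move=> x; apply: cvgM; [exact: cvg_cst|exact: c2].
have -> : `[- r, r]%classic = `[F (- (pi / 2)), F (pi / 2)]%classic by rewrite Fa Fb.
rewrite (@integration_by_substitution_increasing R F G) //; last first.
- exact: within_continuous.
- split.
  + by move=> x _; apply: ex_derive.
  + by apply: cvg_at_right_filter; exact: cF.
  + by apply: cvg_at_left_filter; exact: cF.
- by rewrite F'E; apply/cvg_ex; eexists; apply: cvg_at_left_filter; exact: cF'.
- by rewrite F'E; apply/cvg_ex; eexists; apply: cvg_at_right_filter; exact: cF'.
- by move=> x _; rewrite F'E; exact: cF'.
- by move=> x y xI yI xy; rewrite ltr_pM2l // ltr_sin.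
pose H : R -> R := fun t => r ^+ 2 * (t + sin t * cos t).
pose h : R -> R := fun t => 2 * r ^+ 2 * cos t ^+ 2.
transitivity (\int[lam]_(x in `[(- (pi / 2))%R, (pi / 2)%R]) (h x)%:E)%E.
  apply: eq_integral => x; rewrite inE /= => xI; congr EFin.
  have c0 : 0 <= cos x by apply: cos_ge0_pihalf.
  rewrite F'E; change (2 * Num.sqrt (r ^+ 2 - (r * sin x) ^+ 2) * (r * cos x) = h x).
  have -> : (r ^+ 2 - (r * sin x) ^+ 2) = (r * cos x) ^+ 2.
    have c2 : cos x ^+ 2 = 1 - sin x ^+ 2 by rewrite -(cos2Dsin2 x) addrK.
    by rewrite !exprMn c2; ring.
  rewrite sqrtr_sqr ger0_norm; last by rewrite mulr_ge0 // ltW.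
  by rewrite /h; ring.
have dH (x : R) : is_derive x 1 H (h x).
  have -> : H = (cst (r ^+ 2) * (id + sin * cos))%R by [].
  apply: is_derive_eq; rewrite scaler0 addr0 /h /GRing.scale /=.
  have s2 : sin x ^+ 2 = 1 - cos x ^+ 2 by rewrite -(cos2Dsin2 x) [cos x ^+ 2 + _]addrC addrK.
  by rewrite mulrN -expr2 s2; ring.
have cH : continuous H.
  move=> x; apply: cvgM; first exact: cvg_cst.
  apply: (@cvgD _ R^o); first exact: cvg_id.
  by apply: cvgM; [exact: continuous_sin|exact: continuous_cos].
rewrite (@continuous_FTC2 _ h H) //.
- rewrite /H -EFinB; congr EFin; rewrite cosN cos_pihalf !mulr0 !addr0; by field.
- by have := pi_gt0 R; lra.
- apply: within_continuous => x; apply: cvgM; first exact: cvg_cst.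
  by apply: (@continuous_comp _ _ _ cos (fun y => y ^+ 2));
    [exact: continuous_cos|exact: exprn_continuous].
- split.
  + by move=> x _; apply: ex_derive.
  + by apply: cvg_at_right_filter; exact: cH.
  + by apply: cvg_at_left_filter; exact: cH.
- by move=> x _; rewrite derive1E (@derive_val _ _ _ _ _ _ _ (dH x)).
Qed.
End DiskArea.

(** * Integrals of powers of the radius *)

Section RadialMoments.
Variable R : realType.
Local Notation lam := (@lebesgue_measure R).
Local Notation mu := ((lam \x lam)%E).
Local Notation RT := (measurableTypeR R).
Local Notation RR := (RT * RT)%type.

Definition sqr_norm (p : R * R) : R := p.1 ^+ 2 + p.2 ^+ 2.

Lemma sqr_norm_ge0 p : 0 <= sqr_norm p.
Proof. by rewrite addr_ge0 ?sqr_ge0. Qed.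

(** The bounds are squared radii: the area is then linear in them, and the integrands are powers of
    the variable. *)
Definition annulus (a b : R) : set RR := [set p | a <= sqr_norm p < b].

Lemma measurable_annulus a b : measurable (annulus a b).
Proof.
have -> : annulus a b = setT `&` (fun p : RR => p.1 ^+ 2 + p.2 ^+ 2) @^-1` `[a, b[%classic.
  by rewrite setTI predeqE => p /=; rewrite in_itv.
exact: measurable_sqr_norm.
Qed.

Lemma area_annulus0 (u : R) : 0 <= u -> mu (annulus 0 u) = (pi * u)%:E.
Proof.
move=> u0; set r := Num.sqrt u.
have r0 : 0 <= r by rewrite sqrtr_ge0.
have ru : r ^+ 2 = u by rewrite sqr_sqrtr.
rewrite -{2}ru -(integral_half_circle r0).
rewrite [RHS]integral_mkcond /product_measure1; apply: eq_integral => x _ /=.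
(* [Num.sqrt] of a negative number is 0, so the formula also covers the empty sections. *)
have S : xsection (annulus 0 u) x =
    `]- Num.sqrt (u - x ^+ 2), Num.sqrt (u - x ^+ 2)[%classic.
  rewrite predeqE => y; rewrite /xsection /= in_setE /annulus /= sqr_norm_ge0 /sqr_norm /=.
  rewrite in_itv /= -ltr_norml; have [h|h] := ltP (u - x ^+ 2) 0.
    rewrite ltr0_sqrtr // normr_lt0; have := sqr_ge0 y; split => // ; lra.
  have -> : (`|y| < Num.sqrt (u - x ^+ 2)) = (y ^+ 2 < u - x ^+ 2).
    rewrite -(@ltr_pXn2r _ 2) ?nnegrE ?sqrtr_ge0 // sqr_sqrtr //.
    by rewrite real_normK ?num_real.
  by rewrite ltrBrDl.
rewrite S lebesgue_measure_itv /= lte_fin patchE.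
have s0 : 0 <= Num.sqrt (u - x ^+ 2) by rewrite sqrtr_ge0.
rewrite -EFinB ru.
have -> : (if - Num.sqrt (u - x ^+ 2) < Num.sqrt (u - x ^+ 2) then
    (Num.sqrt (u - x ^+ 2) - - Num.sqrt (u - x ^+ 2))%:E else 0%E) =
    (2 * Num.sqrt (u - x ^+ 2))%:E.
  by case: ltP => h; congr EFin; lra.
case: ifPn => //; rewrite notin_setE /= in_itv /= -ler_norml => /negP; rewrite -ltNge => rx.
rewrite ler0_sqrtr ?mulr0 // subr_le0 -ru -[x ^+ 2]real_normK ?num_real //.
by rewrite lerXn2r ?nnegrE // ltW.
Qed.

Lemma annulus_cat a b c : a <= b <= c -> annulus a c = annulus a b `|` annulus b c.
Proof.
move=> /andP[ab bc]; rewrite predeqE => p; rewrite /annulus /=; split.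
  by move=> /andP[h1 h2]; have [h|h] := ltP (sqr_norm p) b;
    [left; rewrite h1|right; rewrite h2].
by move=> [/andP[h1 h2]|/andP[h1 h2]]; apply/andP; split => //;
  [exact: lt_le_trans bc|exact: le_trans h1].
Qed.

Lemma annulus_disj a b c : [disjoint annulus a b & annulus b c].
Proof.
apply/disj_setPS => p [] /=; rewrite /annulus /= => /andP[_ h1] /andP[h2 _].
by have := lt_le_trans h1 h2; rewrite ltxx.
Qed.

Lemma area_annulus (a b : R) : 0 <= a <= b -> mu (annulus a b) = (pi * (b - a))%:E.
Proof.
move=> /andP[a0 ab].
have E : mu (annulus 0 b) = (mu (annulus 0 a) + mu (annulus a b))%E.
  rewrite -measureU; [|exact: measurable_annulus..|].
    by rewrite -annulus_cat ?a0.
  exact/disj_set2P/annulus_disj.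
rewrite !area_annulus0 ?(le_trans a0) // in E.
have fn : mu (annulus a b) \is a fin_num.
  rewrite ge0_fin_numE ?measure_ge0 // (@le_lt_trans _ _ (pi * b)%:E) ?ltry //.
  by rewrite E leeDr // lee_fin mulr_ge0 ?pi_ge0.
move: E; rewrite -(fineK fn) -EFinD => -[E]; congr EFin; lra.
Qed.

Definition radial_integral (t : nat) (a b : R) : \bar R :=
  (\int[mu]_(p in annulus a b) (sqr_norm p ^+ t)%:E)%E.

Lemma measurable_sqr_norm_pow t (A : set RR) :
  @measurable_fun _ _ RR R A (fun p => sqr_norm p ^+ t).
Proof.
apply: (@measurable_funTS _ _ RR R); apply: measurable_funX; exact: measurable_sqr_norm.
Qed.

Lemma radial_integral_bounds t (a b : R) : 0 <= a <= b ->
  ((a ^+ t * (pi * (b - a)))%:E <= radial_integral t a b <= (b ^+ t * (pi * (b - a)))%:E)%E.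
Proof.
move=> ab; have /andP[a0 ab'] := ab; have b0 := le_trans a0 ab'.
have cstE (c : R) : 0 <= c -> (\int[mu]_(p in annulus a b) (cst c%:E p) = (c * (pi * (b - a)))%:E)%E.
  move=> c0; rewrite integral_cst; last exact: measurable_annulus.
  by rewrite EFinM; congr (_ * _)%E; exact: area_annulus.
rewrite -!cstE ?exprn_ge0 //; apply/andP; split; apply: ge0_le_integral.
- exact: measurable_annulus.
- by move=> p _; rewrite lee_fin exprn_ge0.
- exact: measurable_cst.
- by apply/measurable_EFinP; exact: measurable_sqr_norm_pow.
- move=> p /= /andP[h1 h2]; rewrite lee_fin lerXn2r ?nnegrE //.
  exact: sqr_norm_ge0.
- exact: measurable_annulus.
- by move=> p _; rewrite lee_fin exprn_ge0 // sqr_norm_ge0.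
- by apply/measurable_EFinP; exact: measurable_sqr_norm_pow.
- exact: measurable_cst.
- move=> p /= /andP[h1 h2]; rewrite lee_fin lerXn2r ?nnegrE ?sqr_norm_ge0 //.
  exact: ltW.
Qed.

(* Two functions with increments pinched between [a ^ t * (b - a)] and
   [b ^ t * (b - a)] agree, by telescoping over a subdivision of [0, u]. *)
Lemma pinched_increments_unique (t : nat) (c u : R) (f g : R -> R) :
  0 <= c -> 0 <= u -> f 0 = g 0 ->
  (forall a b, 0 <= a <= b -> a ^+ t * (c * (b - a)) <= f b - f a <= b ^+ t * (c * (b - a))) ->
  (forall a b, 0 <= a <= b -> a ^+ t * (c * (b - a)) <= g b - g a <= b ^+ t * (c * (b - a))) ->
  f u = g u.
Proof.
move=> c0 u0 fg0 Hf Hg.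
have key (n : nat) : (0 < n)%N -> `|f u - g u| <= u ^+ t * (c * (u / n%:R)).
  move=> n0; have n1 : (0 : R) < n%:R by rewrite ltr0n.
  pose h := u / n%:R; have h0 : 0 <= h by rewrite divr_ge0 // ltW.
  (* A step from [a] to [b] adds at most [(b ^+ t - a ^+ t) * (c * h)], which turns the bound at [a]
     exactly into the bound at [b]. *)
  have H k : `|f (k%:R * h) - g (k%:R * h)| <= (k%:R * h) ^+ t * (c * h).
    elim: k => [|k IH].
      by rewrite mul0r fg0 subrr normr0 mulr_ge0 ?exprn_ge0 // mulr_ge0.
    have kh : 0 <= k%:R * h <= k.+1%:R * h.
      by rewrite mulr_ge0 //= ler_wpM2r // ler_nat.
    have kE : k.+1%:R * h - k%:R * h = h by rewrite -mulrBl -natrB // subSnn mul1r.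
    have /andP[f1 f2] := Hf _ _ kh; have /andP[g1 g2] := Hg _ _ kh.
    rewrite kE in f1 f2 g1 g2; rewrite !ler_norml in IH *.
    by move/andP: IH => [i1 i2]; apply/andP; split; lra.
  by have := H n; rewrite /h [n%:R * _]mulrC divfK // gt_eqF.
apply/eqP; rewrite -subr_eq0 -normr_le0; apply/ler_addgt0Pr => e e0; rewrite add0r.
pose B := u ^+ t * (c * u).
have B0 : 0 <= B by rewrite mulr_ge0 ?exprn_ge0 // mulr_ge0.
have [N HN] := ltr_add_invr (divr_gt0 e0 (ltr_pwDr ltr01 B0)).
have B1 : 0 < B + 1 by rewrite ltr_wpDl.
rewrite add0r ltr_pdivlMr // in HN.
rewrite (le_trans (key N.+1 isT)) //.
have -> : u ^+ t * (c * (u / N.+1%:R)) = N.+1%:R^-1 * B by rewrite /B; ring.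
by rewrite (le_trans _ (ltW HN)) // ler_wpM2l ?invr_ge0 // lerDl.
Qed.

Lemma expr_increment (t : nat) (a b : R) : 0 <= a <= b ->
  a ^+ t * (b - a) <= (b ^+ t.+1 - a ^+ t.+1) / t.+1%:R <= b ^+ t * (b - a).
Proof.
move=> /andP[a0 ab]; have b0 := le_trans a0 ab.
have t1 : (0 : R) < t.+1%:R by rewrite ltr0n.
have ba : 0 <= b - a by rewrite subr_ge0.
rewrite ler_pdivlMr // ler_pdivrMr // subrXX /=; set S := \sum_(i < _) _.
have E x : x * (b - a) * t.+1%:R = (b - a) * \sum_(i < t.+1) x.
  by rewrite sumr_const card_ord -mulr_natr; ring.
rewrite !E; apply/andP; split; rewrite ler_wpM2l //; apply: ler_sum => i _;
  have it : (i <= t)%N by rewrite -ltnS.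
- have -> : a ^+ t = a ^+ (t - i) * a ^+ i by rewrite -exprD subnK.
  by rewrite ler_wpM2r ?exprn_ge0 // lerXn2r ?nnegrE.
- have -> : b ^+ t = b ^+ (t - i) * b ^+ i by rewrite -exprD subnK.
  by rewrite ler_wpM2l ?exprn_ge0 // lerXn2r ?nnegrE.
Qed.

(** Both sides, as functions of [u], vanish at 0 and have increments pinched in the same way;
    uniqueness replaces polar coordinates. *)
Lemma radial_integralE t (u : R) : 0 <= u ->
  radial_integral t 0 u = (pi * u ^+ t.+1 / t.+1%:R)%:E.
Proof.
move=> u0.
have fn a b : 0 <= a <= b -> radial_integral t a b \is a fin_num.
  move=> ab; have /andP[h1 h2] := radial_integral_bounds t ab.
  by apply/fin_numP; split; apply/eqP => E; rewrite E in h1 h2.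
have cat a b : 0 <= a <= b ->
    fine (radial_integral t 0 b) - fine (radial_integral t 0 a) = fine (radial_integral t a b).
  move=> ab; have /andP[a0 ab'] := ab.
  have -> : radial_integral t 0 b = (radial_integral t 0 a + radial_integral t a b)%E.
    rewrite /radial_integral (@annulus_cat 0 a b) ?a0 // ge0_integral_setU //.
    - exact: measurable_annulus.
    - exact: measurable_annulus.
    - by apply/measurable_EFinP; exact: measurable_sqr_norm_pow.
    - by move=> p _; rewrite lee_fin exprn_ge0 // sqr_norm_ge0.
    - exact: annulus_disj.
  by rewrite fineD ?fn ?lexx // addrC addKr.
rewrite -[LHS]fineK ?fn ?lexx //; congr EFin.
apply: (@pinched_increments_unique t pi u
  (fun x => fine (radial_integral t 0 x)) (fun x => pi * x ^+ t.+1 / t.+1%:R)) => //.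
- exact: pi_ge0.
- rewrite expr0n mulr0 mul0r /radial_integral.
  have -> : annulus 0 0 = set0.
    rewrite predeqE => p; split => //; rewrite /annulus /= => /andP[h1 h2].
    by have := le_lt_trans h1 h2; rewrite ltxx.
  by rewrite integral_set0.
- move=> a b ab; rewrite cat //; have := radial_integral_bounds t ab.
  by rewrite -{1 2}(fineK (fn _ _ ab)) !lee_fin.
- move=> a b ab; have /andP[h1 h2] := expr_increment t ab.
  have -> : pi * b ^+ t.+1 / t.+1%:R - pi * a ^+ t.+1 / t.+1%:R =
    pi * ((b ^+ t.+1 - a ^+ t.+1) / t.+1%:R) by ring.
  by rewrite ![_ * (pi * _)]mulrCA !ler_wpM2l ?pi_ge0.
Qed.

End RadialMoments.

(** * Inner products of the functions [z ^ a * conjc z ^ b] *)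

Section DiskMonomials.
Variable R : realType.
Local Notation C := R[i].
Local Notation V := (C -> C^o).
Local Notation lam := (@lebesgue_measure R).
Local Notation mu := ((lam \x lam)%E).
Local Notation RT := (measurableTypeR R).
Local Notation RR := (RT * RT)%type.
Local Notation D := (@disk2 R).
Implicit Types f g h phi : V.

Lemma plane_surj (z : C) : z = plane (complex.Re z, complex.Im z).
Proof. by case: z. Qed.

Lemma disk_modc (z : C) : disk z <-> modc z < 1.
Proof. by rewrite /disk /= norm_modc ltcR. Qed.

Lemma modc_plane (p : R * R) : modc (plane p) ^+ 2 = sqr_norm p.
Proof. by rewrite modc_sqr. Qed.

Lemma disk2_annulus : D = annulus 0 1.
Proof. by rewrite disk2E predeqE => p; rewrite /annulus /= sqr_norm_ge0. Qed.

Definition cmeasurable f := @measurable_fun _ _ RR R setT (re_part f) /\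
  @measurable_fun _ _ RR R setT (im_part f).

Lemma cmeasurable_mul f g : cmeasurable f -> cmeasurable g ->
  cmeasurable (fun z => f z * g z).
Proof.
move=> [rf imf] [rg ig]; split.
  rewrite (_ : re_part _ = fun p => re_part f p * re_part g p - im_part f p * im_part g p).
    by apply: measurable_funB; exact: measurable_funM.
  by apply/funext => p; rewrite /re_part /im_part /=; case: (f _) => a b; case: (g _).
rewrite (_ : im_part _ = fun p => re_part f p * im_part g p + im_part f p * re_part g p).
  by apply: measurable_funD; exact: measurable_funM.
by apply/funext => p; rewrite /re_part /im_part /=; case: (f _) => a b; case: (g _).
Qed.

Lemma cmeasurable_conj f : cmeasurable f -> cmeasurable (fun z => conjc (f z)).
Proof.
move=> [rf imf]; split.
  rewrite (_ : re_part _ = re_part f) //.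
  by apply/funext => p; rewrite /re_part; case: (f _).
rewrite (_ : im_part _ = fun p => - im_part f p); first exact: measurable_funN.
by apply/funext => p; rewrite /im_part; case: (f _).
Qed.

Lemma cmeasurable_cst (c : C) : cmeasurable (fun _ => c).
Proof. by split; exact: measurable_cst. Qed.

Lemma cmeasurable_id : cmeasurable (fun z => z).
Proof. by split; [exact: measurable_fst_real|exact: measurable_snd_real]. Qed.

Lemma cmeasurable_exp f n : cmeasurable f -> cmeasurable (fun z => f z ^+ n).
Proof.
move=> mf; elim: n => [|n IH]; first exact: cmeasurable_cst.
rewrite (_ : (fun _ => _) = fun z => f z * f z ^+ n); first exact: cmeasurable_mul.
by apply/funext => z; rewrite exprS.
Qed.

Definition disk_indicator (r : R) : V := fun z => if modc z < r then 1 else 0.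

Lemma measurable_indicator_real (r : R) :
  @measurable_fun _ _ RR R setT (fun p => if modc (plane p) < r then 1 else 0).
Proof.
(* Squaring loses the sign of [r]; the boolean multiplicity sets the threshold to 0 when [r] is
   negative. *)
have -> : (fun p : RR => if modc (plane p) < r then 1 else 0 : R) =
    (fun p => if sqr_norm p < r ^+ 2 *+ (0 <= r)%R then 1 else 0).
  apply/funext => p; have [r0|r0] := leP 0 r.
    by rewrite mulr1n -modc_plane ltr_pXn2r // nnegrE ?modc_ge0.
  by rewrite mulr0n !ltNge (le_trans (ltW r0)) ?modc_ge0 // sqr_norm_ge0.
apply: measurable_fun_ifT => //.
apply: (@measurable_fun_ltr _ RR R _ (fun p => sqr_norm p)) => //.
exact: measurable_sqr_norm.
Qed.

Lemma cmeasurable_indicator r : cmeasurable (disk_indicator r).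
Proof.
split.
  rewrite (_ : re_part _ = fun p => if modc (plane p) < r then 1 else 0).
    exact: measurable_indicator_real.
  by apply/funext => p; rewrite /re_part /disk_indicator; case: ifP.
rewrite (_ : im_part _ = cst 0); first exact: measurable_cst.
by apply/funext => p; rewrite /im_part /disk_indicator; case: ifP.
Qed.

Lemma L2disk_mul phi h (M : R) : cmeasurable phi ->
  (forall z, disk z -> modc (phi z) <= M) -> L2disk h -> L2disk (fun z => phi z * h z).
Proof.
move=> [rphi iphi] phiM Lh; have mD : measurable (D : set RR) := @measurable_disk2 R.
have /L2disk_sqint[h0 sr si] := Lh; have [mr _] := sr; have [mi _] := si.
have mrphi := measurable_funTS rphi (D := D); have miphi := measurable_funTS iphi (D := D).
have m1 : @measurable_fun _ _ RR R D (re_part (fun z => phi z * h z)).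
  rewrite (_ : re_part _ = fun p => re_part phi p * re_part h p - im_part phi p * im_part h p).
    by apply: measurable_funB; exact: measurable_funM.
  by apply/funext => p; rewrite /re_part /im_part /=; case: (phi _) => a b; case: (h _).
have m2 : @measurable_fun _ _ RR R D (im_part (fun z => phi z * h z)).
  rewrite (_ : im_part _ = fun p => re_part phi p * im_part h p + im_part phi p * re_part h p).
    by apply: measurable_funD; exact: measurable_funM.
  by apply/funext => p; rewrite /re_part /im_part /=; case: (phi _) => a b; case: (h _).
split => //; first by move=> z dz; rewrite h0 // mulr0.
have H := integrableZl mD (M ^+ 2) (integrableD mD (sqint_integrable sr) (sqint_integrable si)).
have /integrableP[mH] := H; apply: le_lt_trans; apply: ge0_le_integral => //.
- by move=> p _; rewrite lee_fin addr_ge0 ?sqr_ge0.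
- by apply/measurable_EFinP; apply: measurable_funD; exact: measurable_funX.
- exact: measurableT_comp.
- move=> p Dp; rewrite /= lee_fin (le_trans _ (ler_norm _)) //.
  rewrite /re_part /im_part -!modc_sqr modcM exprMn ler_wpM2r ?sqr_ge0 //.
  have := phiM _ Dp; move=> hM; rewrite lerXn2r ?nnegrE ?modc_ge0 //.
  exact: le_trans (modc_ge0 _) hM.
Qed.

Lemma L2disk_indicator1 : L2disk (disk_indicator 1).
Proof.
have mD : measurable (D : set RR) := @measurable_disk2 R.
have [m1 m2] := cmeasurable_indicator 1.
apply/L2disk_sqint; split.
- by move=> z /disk_modc/negP dz; rewrite /disk_indicator (negbTE dz).
- split; first exact: (measurable_funTS m1).
  apply: (@le_lt_trans _ _ (\int[mu]_(p in D) (cst 1%:E p))%E).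
    apply: ge0_le_integral => //.
    + by move=> p _; rewrite lee_fin sqr_ge0.
    + by apply/measurable_EFinP; apply: measurable_funX; exact: (measurable_funTS m1).
    + move=> p _; rewrite lee_fin /re_part /disk_indicator.
      by case: ifP => _ /=; rewrite ?expr1n ?expr0n.
  rewrite integral_cst // mul1e disk2_annulus.
  by have := @area_annulus0 R 1 ler01; rewrite /= => ->; rewrite ltry.
- split; first exact: (measurable_funTS m2).
  rewrite (_ : (fun _ => _) = cst 0%E) ?integral0 ?ltry //.
  apply/funext => p; rewrite /im_part /disk_indicator.
  by case: ifP => _ /=; rewrite expr0n.
Qed.

Lemma integrable_dot f g : L2disk f -> L2disk g ->
  mu.-integrable D (EFin \o re_part (fun z => f z * conjc (g z))) /\
  mu.-integrable D (EFin \o im_part (fun z => f z * conjc (g z))).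
Proof.
have mD : measurable (D : set RR) := @measurable_disk2 R.
move=> /L2disk_sqint[_ rf imf] /L2disk_sqint[_ rg ig]; split.
  have H := integrableD mD (sqint_mul mD rf rg) (sqint_mul mD imf ig).
  apply: eq_integrable H => // p _; rewrite /= -EFinD; congr EFin; rewrite /re_part /im_part.
  by case: (f _) => a b; case: (g _) => c d /=; ring.
have H := integrableB mD (sqint_mul mD imf rg) (sqint_mul mD rf ig).
apply: eq_integrable H => // p _; rewrite /= -EFinB; congr EFin; rewrite /re_part /im_part.
by case: (f _) => a b; case: (g _) => c d /=; ring.
Qed.

(** The rotation preserves the integral and multiplies the integrand by [alpha], so
    [alpha * dot f g = dot f g]. The case [omega = -1] is outside the reach of the factorisation
    into shears. *)
Lemma dot_rotation_eq0 f g (omega alpha : C) : L2disk f -> L2disk g ->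
  modc omega = 1 -> omega != -1 -> alpha != 1 ->
  (forall z, f (omega * z) * conjc (g (omega * z)) = alpha * (f z * conjc (g z))) ->
  dot f g = 0.
Proof.
move=> Lf Lg o1 oN1 a1 fg; have siL := L2disk_semi_inner R.
have mD : measurable (D : set RR) := @measurable_disk2 R.
have Laf : L2disk (alpha *: f) := si_scale siL alpha Lf.
pose h : V := fun z => f z * conjc (g z).
pose rot : RR -> RR := fun p => (complex.Re omega * p.1 - complex.Im omega * p.2,
  complex.Im omega * p.1 + complex.Re omega * p.2).
have prot p : plane (rot p) = omega * plane p.
  by rewrite /plane /rot /=; case: (omega) => c s; simpc; rewrite /= [s * _ + _]addrC.
have irot : area_invariant rot.
  apply: rotation_invariant; first by rewrite -modc_sqr o1 expr1n.
  apply: contra oN1 => /eqP cN; have := modc_sqr omega; rewrite o1 expr1n cN.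
  rewrite sqrrN expr1n => /eqP; rewrite -subr_eq0 opprD addrA subrr sub0r oppr_eq0 sqrf_eq0.
  by move=> /eqP sN; rewrite [omega]plane_surj /plane /= cN sN eq_complex /= oppr0 !eqxx.
have Drot : rot @^-1` D = D.
  by rewrite predeqE => p; rewrite /disk2 /= prot !disk_modc modcM o1 mul1r.
have [ir ii] := integrable_dot Lf Lg; have [iar iai] := integrable_dot Laf Lg.
have hE : (fun z => (alpha *: f) z * conjc (g z)) = (fun z => h (omega * z)).
  by apply/funext => z; rewrite /h fg -mulrA.
have h0 p : ~ D p -> h (plane p) = 0.
  by move=> nD; have [f0 _ _ _] := Lf; rewrite /h f0 // mul0r.
(* The change of variables asks for measurability on the whole plane; it holds because the integrand
   vanishes off the disk. *)
have mT (part : V -> R * R -> R) : (forall p, h (plane p) = 0 -> part h p = 0) ->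
    mu.-integrable D (EFin \o part h) -> @measurable_fun _ _ RR R setT (part h).
  move=> p0 /integrableP[/measurable_EFinP mh _].
  rewrite (_ : part h = (part h) \_ (D : set RR)); first exact/(measurable_restrictT _ mD).
  apply/funext => p; rewrite patchE; case: ifPn => //; rewrite notin_setE => /h0.
  exact: p0.
have H : alpha * dot f g = dot f g.
  rewrite -(ipZl siL) // /dot hE /disk_integral -/h; congr (_ * (_ +i* _)).
    rewrite -(@Rintegral_invariant R rot D (re_part h)) //.
    - by congr (Rintegral _ _ _); apply/funext => p; rewrite /re_part /= prot.
    - by apply: mT ir => p hp; rewrite /re_part hp.
    - apply: eq_integrable iar => // p _.
      by rewrite /= hE /re_part /= -prot.
  rewrite -(@Rintegral_invariant R rot D (im_part h)) //.
  - by congr (Rintegral _ _ _); apply/funext => p; rewrite /im_part /= prot.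
  - by apply: mT ii => p hp; rewrite /im_part hp.
  - apply: eq_integrable iai => // p _.
    by rewrite /= hE /im_part /= -prot.
apply/eqP; move/eqP: H; rewrite -subr_eq0 -{2}[dot f g]mul1r -mulrBl mulf_eq0.
by rewrite subr_eq0 (negbTE a1).
Qed.

(** The cut-off radius [r] is a parameter because norms are later estimated on disks smaller than
    the unit disk. *)
Definition zmonomial (a b : nat) (r : R) : V :=
  fun z => if modc z < r then z ^+ a * conjc z ^+ b else 0.

Lemma zmonomialE a b r : r <= 1 -> zmonomial a b r =
  fun z => (disk_indicator r z * (z ^+ a * conjc z ^+ b)) * disk_indicator 1 z.
Proof.
move=> r1; apply/funext => z; rewrite /zmonomial /disk_indicator.
case: ifP => zr; last by rewrite !mul0r.
by rewrite (lt_le_trans zr r1) mulr1 mul1r.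
Qed.

Lemma cmeasurable_monomial a b : cmeasurable (fun z => z ^+ a * conjc z ^+ b).
Proof.
apply: cmeasurable_mul; apply: cmeasurable_exp; first exact: cmeasurable_id.
by apply: cmeasurable_conj; exact: cmeasurable_id.
Qed.

Lemma modc_monomial_le1 a b (z : C) : modc z < 1 -> modc (z ^+ a * conjc z ^+ b) <= 1.
Proof.
move=> z1; rewrite modcM !modcX modcJ -exprD exprn_ile1 ?modc_ge0 //.
exact: ltW.
Qed.

Lemma L2disk_zmonomial a b r : r <= 1 -> L2disk (zmonomial a b r).
Proof.
move=> r1; rewrite zmonomialE //; apply: (@L2disk_mul _ _ 1).
- by apply: cmeasurable_mul; [exact: cmeasurable_indicator|exact: cmeasurable_monomial].
- move=> z /disk_modc z1; rewrite /disk_indicator; case: ifP => _.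
    by rewrite mul1r modc_monomial_le1.
  by rewrite mul0r modc0.
- exact: L2disk_indicator1.
Qed.

(* The integrand is multiplied by a nontrivial character of the rotation group;
   rotations of order [2 ^ m] suffice to see it. *)
Lemma dot_zmonomial_neq a b a' b' r r' : r <= 1 -> r' <= 1 -> (a + b' != b + a')%N ->
  dot (zmonomial a b r) (zmonomial a' b' r') = 0.
Proof.
(* [2 ^ m] exceeds 2, which keeps [w] away from -1, and the difference of the two exponents, which
   makes the character nontrivial at [w]. *)
move=> r1 r1' nab; pose m := (a + b + a' + b').+2.
have [w wP w1] := root_two_power R m.
have mN : (m < 2 ^ m)%N by exact: ltn_expl.
have wx n : (0 < n < 2 ^ m)%N -> w ^+ n != 1.
  move=> /andP[n0 nN]; rewrite -(prim_order_dvd wP).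
  by apply/negP => /(dvdn_leq n0); rewrite leqNgt nN.
have wJ : w * conjc w = 1.
  by have := add_Re2_Im2 w; rewrite sqr_normc -modc_sqr w1 expr1n => <-.
have wJn n : w ^+ n * conjc w ^+ n = 1 by rewrite -exprMn wJ expr1n.
apply: (@dot_rotation_eq0 _ _ w (w ^+ (a + b') * conjc w ^+ (b + a'))).
- exact: L2disk_zmonomial.
- exact: L2disk_zmonomial.
- exact: w1.
- apply: contra_neq (wx 2 _) => [->|]; first by rewrite sqrrN expr1n.
  by rewrite /= (leq_ltn_trans _ mN).
- have [lt|] := ltnP (a + b') (b + a').
    apply: contra_neq (wx (b + a' - (a + b'))%N _) => [E|]; last first.
      by rewrite subn_gt0 lt /= (leq_ltn_trans _ mN) // /m; lia.
    rewrite -[in LHS](subnKC (ltnW lt)) [conjc w ^+ _]exprD mulrA wJn mul1r in E.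
    by rewrite -[LHS]mulr1 -E wJn.
  rewrite leq_eqVlt eq_sym (negbTE nab) /= => lt.
  apply: contra_neq (wx (a + b' - (b + a'))%N _) => [E|]; last first.
    by rewrite subn_gt0 lt /= (leq_ltn_trans _ mN) // /m; lia.
  rewrite -E -{2}(subnK (ltnW lt)) exprD -mulrA wJn mulr1 //.
- move=> z; rewrite /zmonomial modcM w1 mul1r.
  case: ifP => _; last by rewrite !mul0r mulr0.
  case: ifP => _; last by rewrite rmorph0 !mulr0.
  rewrite !rmorphM !rmorphXn /= !conjcK !exprMn !exprD !rmorphM /= !conjcK.
  by move: (conjc w) (conjc z) => w' z'; rewrite !exprMn; ring.
Qed.

(** The integrand is radial, a power of the squared modulus supported on the smaller of the two
    disks. *)
Lemma dot_zmonomial_eq a b a' b' r r' : 0 <= r -> r <= r' -> r' <= 1 -> (a + b' = b + a')%N ->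
  dot (zmonomial a b r) (zmonomial a' b' r') =
  ((r ^+ 2) ^+ (a + b').+1 / (a + b').+1%:R)%:C.
Proof.
move=> r0 rr r1 ab; have mD : measurable (D : set RR) := @measurable_disk2 R.
pose t := (a + b')%N; pose h : V := fun z => if modc z < r then (modc z ^+ 2 ^+ t)%:C else 0.
have hE : (fun z => zmonomial a b r z * conjc (zmonomial a' b' r' z)) = h.
  apply/funext => z; rewrite /zmonomial /h; case: ifP => zr; last by rewrite mul0r.
  rewrite (lt_le_trans zr rr).
  have -> : (modc z ^+ 2 ^+ t)%:C = (z * conjc z) ^+ t.
    by rewrite rmorphXn /= modc_sqr add_Re2_Im2 sqr_normc.
  have zt : z ^+ t = z ^+ a * z ^+ b' by rewrite /t exprD.
  have jt : conjc z ^+ t = conjc z ^+ b * conjc z ^+ a' by rewrite /t ab exprD.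
  rewrite exprMn zt jt rmorphM !rmorphXn /= conjcK.
  by move: (conjc z) => z'; ring.
have rD : annulus 0 (r ^+ 2) `<=` (D : set RR).
  rewrite disk2_annulus => p /andP[p0 pr]; apply/andP; split => //.
  by apply: lt_le_trans pr _; rewrite exprn_ile1 // (le_trans rr).
have Er : Rintegral mu D (re_part h) = pi * (r ^+ 2) ^+ t.+1 / t.+1%:R.
  have -> : re_part h = (fun p => sqr_norm p ^+ t) \_ (annulus 0 (r ^+ 2)).
    apply/funext => p; rewrite /re_part /h patchE -(modc_plane p).
    have -> : (p \in annulus 0 (r ^+ 2)) = (modc (plane p) < r).
      apply/idP/idP; rewrite in_setE /annulus /= -modc_plane exprn_ge0 ?modc_ge0 //=;
        by rewrite ltr_pXn2r ?nnegrE ?modc_ge0.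
    by case: ifP.
  rewrite -Rintegral_mkcondr setIC (setIidl rD) /Rintegral.
  by have := radial_integralE t (exprn_ge0 2 r0); rewrite /radial_integral => ->.
have Ei : Rintegral mu D (im_part h) = 0.
  rewrite (_ : im_part h = cst 0) ?Rintegral_cst ?mul0r //.
  by apply/funext => p; rewrite /im_part /h; case: ifP.
rewrite /dot /disk_integral hE /area Er Ei.
by simpc; rewrite -!mulrA mulKf ?gt_eqF ?pi_gt0.
Qed.

End DiskMonomials.

(** * Norms on smaller disks *)

Section DiskCut.
Variable R : realType.
Local Notation C := R[i].
Local Notation V := (C -> C^o).
Local Notation mu := ((@lebesgue_measure R \x @lebesgue_measure R)%E).
Local Notation RT := (measurableTypeR R).
Local Notation RR := (RT * RT)%type.
Local Notation D := (@disk2 R).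
Local Notation nrm := (ipnorm (@dot R)).
Implicit Types f g h : V.

Let siL := L2disk_semi_inner R.

Lemma measurable_modc_sqr h : L2disk h ->
  @measurable_fun _ _ RR R D (fun p => modc (h (plane p)) ^+ 2).
Proof.
move=> [_ mr mi _].
rewrite (_ : (fun p => _) = fun p => re_part h p ^+ 2 + im_part h p ^+ 2); last first.
  by apply/funext => p; rewrite modc_sqr.
by apply: measurable_funD; apply: (@measurable_funX _ RR).
Qed.

Lemma integral_modc_sqr h : L2disk h ->
  (\int[mu]_(p in D) (modc (h (plane p)) ^+ 2)%:E = (pi * nrm h ^+ 2)%:E)%E.
Proof.
move=> Lh; have mD : measurable (D : set RR) := @measurable_disk2 R.
have /L2disk_sqint[_ sr si] := Lh; have [mr fr] := sr; have [mi fi] := si.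
rewrite (ipnorm_sqr siL) // dotE //= mul0r subr0 mulrA mulfV ?gt_eqF ?pi_gt0 // mul1r.
rewrite EFinD /rdot /Rintegral.
transitivity (\int[mu]_(p in D) ((re_part h p ^+ 2)%:E + (im_part h p ^+ 2)%:E))%E.
  by apply: eq_integral => p _; rewrite modc_sqr.
rewrite ge0_integralD //.
- by congr (_ + _)%E; rewrite fineK ?ge0_fin_numE ?integral_ge0 // => p _; rewrite lee_fin sqr_ge0.
- by move=> p _; rewrite lee_fin sqr_ge0.
- by apply/measurable_EFinP; exact: measurable_funX.
- by move=> p _; rewrite lee_fin sqr_ge0.
- by apply/measurable_EFinP; exact: measurable_funX.
Qed.

Lemma ipnorm_le_pointwise h g : L2disk h -> L2disk g ->
  (forall z, disk z -> modc (h z) <= modc (g z)) -> nrm h <= nrm g.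
Proof.
move=> Lh Lg hg; have mD : measurable (D : set RR) := @measurable_disk2 R.
rewrite -(@ler_pXn2r _ 2) ?nnegrE ?ipnorm_ge0 //.
rewrite -(ler_pM2l (pi_gt0 R)) -lee_fin -!integral_modc_sqr //.
apply: ge0_le_integral => //.
- by move=> p _; rewrite lee_fin sqr_ge0.
- by apply/measurable_EFinP; exact: measurable_modc_sqr.
- by apply/measurable_EFinP; exact: measurable_modc_sqr.
- by move=> p Dp; rewrite lee_fin lerXn2r ?nnegrE ?modc_ge0 // hg.
Qed.

Definition cut r h : V := fun z => disk_indicator r z * h z.

Lemma cutE r h z : cut r h z = if modc z < r then h z else 0.
Proof. by rewrite /cut /disk_indicator; case: ifP; rewrite ?mul1r ?mul0r. Qed.

Lemma L2disk_cut r h : L2disk h -> L2disk (cut r h).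
Proof.
apply: (@L2disk_mul _ _ _ 1); first exact: cmeasurable_indicator.
by move=> z _; rewrite /disk_indicator; case: ifP; rewrite ?modc1 ?modc0.
Qed.

Lemma ipnorm_cut_le r h : L2disk h -> nrm (cut r h) <= nrm h.
Proof.
move=> Lh; apply: ipnorm_le_pointwise => //; first exact: L2disk_cut.
by move=> z _; rewrite cutE; case: ifP => // _; rewrite modc0 modc_ge0.
Qed.

Lemma ipnorm_cut_bounded r h (M : R) : L2disk h -> 0 <= M ->
  (forall z, disk z -> modc z < r -> modc (h z) <= M) -> nrm (cut r h) <= M.
Proof.
move=> Lh M0 hM; have L1 := L2disk_indicator1 R.
have n1 : nrm (disk_indicator 1) = 1.
  have -> : @disk_indicator R 1 = zmonomial 0 0 1.
    by apply/funext => z; rewrite /zmonomial !expr0 mulr1.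
  by rewrite /ipnorm dot_zmonomial_eq //= !expr1n divr1 sqrtr1.
have -> : M = nrm (M%:C *: (disk_indicator 1 : V)).
  by rewrite (ipnormZ siL) // n1 modcR ger0_norm ?mulr1.
apply: ipnorm_le_pointwise; first exact: L2disk_cut.
  exact: si_scale siL _ _ L1.
move=> z dz; have /disk_modc z1 := dz; rewrite cutE.
change (modc (if modc z < r then h z else 0) <= modc (M%:C * disk_indicator 1 z)).
rewrite /disk_indicator z1 mulr1 modcR ger0_norm //.
by case: ifP => [/hM|_]; [exact|rewrite modc0].
Qed.

(** Monotone convergence along the radii [1 - 1 / (n + 1)]. *)
Lemma ipnorm_le_cuts h (B : R) : L2disk h -> 0 <= B ->
  (forall r, 0 <= r < 1 -> nrm (cut r h) <= B) -> nrm h <= B.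
Proof.
move=> Lh B0 hB; have mD : measurable (D : set RR) := @measurable_disk2 R.
pose r (n : nat) : R := 1 - n.+1%:R^-1.
have rn n : 0 <= r n < 1.
  by rewrite subr_ge0 invf_le1 ?ltr0n // ler1n /= gtrBl invr_gt0 ltr0n.
have r0 n : 0 <= r n by have /andP[] := rn n.
pose F n : set RR := annulus 0 (r n ^+ 2).
have memF n p : F n p <-> modc (plane p) < r n.
  rewrite /F /annulus /= sqr_norm_ge0 /= -modc_plane.
  by rewrite ltr_pXn2r ?nnegrE ?modc_ge0.
have FD n : F n `<=` D.
  by move=> p /memF h1; apply/disk_modc; apply: lt_trans h1 _; have /andP[] := rn n.
have UF : \bigcup_n F n = D.
  rewrite predeqE => p; split=> [[n _ /FD]//|/disk_modc p1].
  have d0 : 0 < 1 - modc (plane p) by rewrite subr_gt0.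
  have [N HN] := ltr_add_invr d0; exists N => //; apply/memF.
  by rewrite /r; move: HN; rewrite add0r; set x := _^-1; lra.
have ndF : nondecreasing_seq F.
  apply/nondecreasing_seqP => n; rewrite subsetEset => p /memF h1; apply/memF.
  by apply: lt_le_trans h1 _; rewrite lerD2l lerN2 lef_pV2 ?posrE ?ltr0n // ler_nat.
have mh := measurable_modc_sqr Lh.
have H := @ge0_nondecreasing_set_cvg_integral _ RR R F
  (fun p => (modc (h (plane p)) ^+ 2)%:E) mu ndF
  (fun n => measurable_annulus _ _)
  (fun n => (measurable_EFinP _ _).2 (measurable_funS mD (@FD n) mh))
  (fun n p _ => (sqr_ge0 _ : (0 <= _%:E)%E)).
rewrite UF integral_modc_sqr // in H.
rewrite -(@ler_pXn2r _ 2) ?nnegrE ?ipnorm_ge0 // -(ler_pM2l (pi_gt0 R)) -lee_fin.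
rewrite -(cvg_lim _ H) //; apply: lime_le; first by apply/cvg_ex; eexists; exact: H.
apply: nearW => n.
apply: (@le_trans _ _ (pi * nrm (cut (r n) h) ^+ 2)%:E); last first.
  by rewrite lee_fin ler_pM2l ?pi_gt0 // lerXn2r ?nnegrE ?ipnorm_ge0 // hB.
rewrite -integral_modc_sqr; last exact: L2disk_cut.
rewrite -{1}(setIidr (@FD n)) integral_mkcondr le_eqVlt; apply/orP; left; apply/eqP.
apply: eq_integral => p _; rewrite patchE cutE.
have -> : (p \in F n) = (modc (plane p) < r n).
  by apply/idP/idP; rewrite in_setE => /memF.
by case: ifP => // _; rewrite modc0 expr0n.
Qed.

End DiskCut.

(** * The Bergman space *)

Lemma cvgZD (K : numFieldType) (V : normedModType K) (a : K) (u v : nat -> V) (x y : V) :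
  u @ \oo --> x -> v @ \oo --> y -> (fun n => a *: u n + v n) @ \oo --> a *: x + y.
Proof. by move=> ux vy; apply: cvgD vy; exact: cvgZl_tmp. Qed.

Section Bergman.
Variable R : realType.
Local Notation C := R[i].
Local Notation V := (C -> C^o).
Local Notation nrm := (ipnorm (@dot R)).
Implicit Types f g h : V.

Let siL := L2disk_semi_inner R.

Lemma bergman_subspace : Defs.subspace (@bergman R).
Proof.
split.
  split; first exact: (si_subspace siL).1.
  move=> z0 _; exists 1, (fun _ => 0); split => // z _.
  rewrite (_ : series _ = cst 0); first exact: cvg_cst.
  by apply/funext => n; rewrite /series /= big1 // => i _; rewrite mul0r.
move=> a f g [Lf af] [Lg ag]; split; first exact: (si_subspace siL).2.
move=> z0 dz0; have [r1 [c1 [r10 H1]]] := af _ dz0; have [r2 [c2 [r20 H2]]] := ag _ dz0.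
exists (Num.min r1 r2), (fun n => a * c1 n + c2 n); split; first by rewrite lt_min r10.
move=> z; rewrite norm_modc ltcR lt_min => /andP[z1 z2].
have h1 := H1 z; rewrite norm_modc ltcR in h1; have {}h1 := h1 z1.
have h2 := H2 z; rewrite norm_modc ltcR in h2; have {}h2 := h2 z2.
rewrite (_ : series _ = (fun n => a * series (fun n => c1 n * (z - z0) ^+ n : C^o) n +
  series (fun n => c2 n * (z - z0) ^+ n : C^o) n : C^o)).
  exact: (@cvgZD R[i] R[i]^o _ _ _ _ _ h1 h2).
apply/funext => n; rewrite /series /= mulr_sumr -big_split /=.
by apply: eq_bigr => i _; rewrite mulrDl mulrA.
Qed.

Lemma bergman_L2disk : @bergman R `<=` @L2disk R.
Proof. by move=> f []. Qed.

Lemma bergman_semi_inner : semi_inner (@dot R) (@bergman R).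
Proof. exact: (semi_inner_sub siL bergman_L2disk bergman_subspace). Qed.

Let siB := bergman_semi_inner.

Lemma monomialE n : @monomial R n = (Num.sqrt n.+1%:R)%:C *: (zmonomial n 0 1 : V).
Proof.
apply/funext => z; rewrite /monomial norm_modc ltcR.
transitivity ((Num.sqrt n.+1%:R)%:C * zmonomial n 0 1 z) => //; rewrite /zmonomial.
by case: ifP => _; rewrite ?mulr0 // expr0 mulr1.
Qed.

Lemma zmonomial_bergman n : bergman (zmonomial n 0 1 : V).
Proof.
split; first exact: L2disk_zmonomial.
(* The coefficients are those of the binomial expansion of [(z0 + (z - z0)) ^+ n]. The radius keeps
   [z] inside the disk, outside of which the monomial is set to 0. *)
move=> z0 /disk_modc dz0; exists (1 - modc z0), (fun i => z0 ^+ (n - i) *+ 'C(n, i)).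
split; first by rewrite subr_gt0.
move=> z; rewrite norm_modc ltcR => zz0.
have z1 : modc z < 1.
  by rewrite -[z](subrK z0) (le_lt_trans (modcD _ _)) // -ltrBrDr.
apply: cvg_near_cst; exists n.+1 => // N /= nN.
rewrite /zmonomial z1 expr0 mulr1 -{2}[z](subrK z0) [z - z0 + z0]addrC exprDn.
rewrite /series /= (big_cat_nat (n := n.+1)) //= [X in _ + X]big_nat_cond [X in _ + X]big1.
  by rewrite addr0 big_mkord; apply: eq_bigr => i _; rewrite mulrnAl.
by move=> i /andP[/andP[ni _] _]; rewrite bin_small // mulr0n mul0r.
Qed.

Lemma monomial_bergman n : bergman (@monomial R n).
Proof. by rewrite monomialE; apply: si_scale siB _ _ _; exact: zmonomial_bergman. Qed.

Lemma monomial_orthonormal m n : dot (@monomial R m) (monomial n) = (m == n)%:R.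
Proof.
have Lz k : L2disk (zmonomial k 0 1 : V) by exact: L2disk_zmonomial.
rewrite !monomialE (ipZl siL) //; last exact: si_scale siL _ _ _.
rewrite (ipZr siL) //; have [->|mn] := eqVneq m n; last first.
  by rewrite dot_zmonomial_neq ?mulr0 // addn0 add0n.
rewrite dot_zmonomial_eq //; last by rewrite addn0 add0n.
rewrite !expr1n addn0; simpc; congr (_ +i* _).
by rewrite mulrA -expr2 sqr_sqrtr ?mulfV ?pnatr_eq0.
Qed.

Lemma cut_sub r f g : cut r (f - g) = cut r f - cut r g.
Proof. by apply/funext => z; rewrite /cut mulrBr. Qed.

Lemma cut_zpoly r N (c : nat -> C) : r <= 1 ->
  cut r (\sum_(n < N) c n *: (zmonomial n 0 1 : V)) =
  \sum_(n < N) c n *: (zmonomial n 0 r : V).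
Proof.
move=> r1; apply/funext => z; rewrite cutE !fct_sumE.
case: ifP => zr.
  apply: eq_bigr => i _; transitivity (c i * zmonomial i 0 1 z) => //.
  by transitivity (c i * zmonomial i 0 r z) => //; rewrite /zmonomial zr (lt_le_trans zr r1).
rewrite big1 // => i _; transitivity (c i * zmonomial i 0 r z) => //.
by rewrite /zmonomial zr mulr0.
Qed.

Lemma ipnorm_zpoly r N (c : nat -> C) : 0 <= r <= 1 ->
  nrm (\sum_(n < N) c n *: (zmonomial n 0 r : V)) ^+ 2 =
  \sum_(n < N) modc (c n) ^+ 2 * ((r ^+ 2) ^+ n.+1 / n.+1%:R).
Proof.
move=> /andP[r0 r1]; have Lz n : L2disk (zmonomial n 0 r : V) by exact: L2disk_zmonomial.
have Lcz n : L2disk (c n *: (zmonomial n 0 r : V)) := si_scale siL _ (Lz n).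
have LS : L2disk (\sum_(n < N) c n *: (zmonomial n 0 r : V)).
  by apply: (si_sum siL) => i; exact: Lcz.
rewrite (ipnorm_sqr siL) // (ip_sumr siL) //.
rewrite raddf_sum; apply: eq_bigr => i _; rewrite (ipZr siL) // (ip_suml siL) //.
rewrite (bigD1 i) // big1 ?addr0 => [|j ji].
  rewrite (ipZl siL) // dot_zmonomial_eq //; last by rewrite addn0 add0n.
  by rewrite addn0 modc_sqr; case: (c i) => x y /=; ring.
rewrite (ipZl siL) // dot_zmonomial_neq ?mulr0 // addn0 add0n.
by apply: contra ji => /eqP ji; apply/eqP/val_inj.
Qed.

Lemma sum_ord_sub (U : zmodType) (F : nat -> U) (N K : nat) : (N <= K)%N ->
  \sum_(n < K) F n - \sum_(n < N) F n = \sum_(n < K) if (n < N)%N then 0 else F n.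
Proof.
move=> NK; rewrite -!(big_mkord xpredT) -(big_mkord xpredT (fun n => if (n < N)%N then 0 else F n)).
rewrite !(big_cat_nat (leq0n N) NK) /= addrAC subrr add0r.
rewrite [X in X + _]big_nat_cond [X in X + _]big1 ?add0r.
  by apply: eq_big_nat => n /andP[Nn _]; rewrite ltnNge Nn.
by move=> n /andP[/andP[_ ->]].
Qed.

Lemma nonneg_series_tail (a : nat -> R) (B e : R) : (forall n, 0 <= a n) ->
  (forall N, \sum_(n < N) a n <= B) -> 0 < e ->
  exists N, forall K, (N <= K)%N -> \sum_(n < K) a n - \sum_(n < N) a n <= e.
Proof.
move=> a0 aB e0; pose u N := \sum_(n < N) a n.
have ndu : nondecreasing_seq u.
  by apply/nondecreasing_seqP => n; rewrite /u big_ord_recr lerDl.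
have ub : has_ubound (range u) by exists B => _ [N _ <-]; exact: aB.
have cu := nondecreasing_cvgn ndu ub.
have /cvgrPdist_lt/(_ _ e0)[N _ /(_ N (leqnn N))] := cu.
rewrite ltr_norml => /andP[_ h]; exists N => K NK.
have := nondecreasing_cvgn_le ndu (cvgP _ cu) K; rewrite (cvg_lim _ cu) //.
by rewrite -/(u K) -/(u N); lra.
Qed.

Definition zpoly (c : nat -> C) N : V := \sum_(n < N) c n *: (zmonomial n 0 1 : V).

Lemma zpoly_L2disk c N : L2disk (zpoly c N).
Proof.
apply: (si_sum siL) => n; apply: (si_scale siL); exact: L2disk_zmonomial.
Qed.

Lemma ipnorm_zpoly1 c N :
  nrm (zpoly c N) ^+ 2 = \sum_(n < N) modc (c n) ^+ 2 / n.+1%:R.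
Proof.
rewrite ipnorm_zpoly ?ler01 ?lexx //; apply: eq_bigr => i _.
by rewrite !expr1n mul1r.
Qed.

(** For the last clause: on the disk of radius [r], orthogonality makes the norms of the partial
    sums increase with [N], and the partial sums converge to [f] there; then [r] tends to 1. *)
Lemma bergman_taylor f : bergman f -> exists c : nat -> C,
  [/\ forall z, disk z -> (forall n, c n = 0) -> f z = 0,
      forall r e : R, 0 <= r < 1 -> 0 < e -> exists K, forall N, (K <= N)%N ->
        nrm (cut r (f - zpoly c N)) <= e
    & forall N, nrm (zpoly c N) <= nrm f].
Proof.
move=> [Lf af]; have [c Hc] := disk_taylor af; exists c.
have subE N z : (f - zpoly c N) z = f z - zpoly c N z by [].
have pE N z : modc z < 1 -> zpoly c N z = \sum_(n < N) c n * z ^+ n.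
  move=> z1; rewrite /zpoly fct_sumE; apply: eq_bigr => i _.
  by transitivity (c i * zmonomial i 0 1 z) => //; rewrite /zmonomial z1 expr0 mulr1.
have approx (r e : R) : 0 <= r < 1 -> 0 < e -> exists K, forall N, (K <= N)%N ->
    nrm (cut r (f - zpoly c N)) <= e.
  move=> r01 e0; have [K HK] := Hc r e r01 e0; exists K => N KN.
  apply: ipnorm_cut_bounded; [|exact: ltW|].
    by apply: (si_sub siL) => //; exact: zpoly_L2disk.
  by move=> z /disk_modc z1 zr; rewrite subE pE // HK // ltW.
split => //.
- move=> z /disk_modc z1 c0; apply/modc_eq0/eqP; rewrite eq_le modc_ge0 andbT.
  apply/ler_addgt0Pr => e e0; rewrite add0r.
  have [|K /(_ K z (leqnn K) (lexx _))] := Hc (modc z) e _ e0; first by rewrite modc_ge0.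
  by rewrite big1 ?subr0 // => n _; rewrite c0 mul0r.
- move=> N; apply: ipnorm_le_cuts => //; [exact: zpoly_L2disk|exact: ipnorm_ge0|].
  move=> r /andP[r0 r1]; apply/ler_addgt0Pr => e e0.
  have [|K0 HK] := approx r e _ e0; first by rewrite r0.
  pose K := maxn K0 N; have {}HK := HK K (leq_maxl _ _).
  have LpK := zpoly_L2disk c K.
  apply: (@le_trans _ _ (nrm (cut r (zpoly c K)))).
    rewrite /zpoly !(cut_zpoly _ _ (ltW r1)) -(@ler_pXn2r _ 2) ?nnegrE ?ipnorm_ge0 //.
    have r01 : 0 <= r <= 1 by rewrite r0 ltW.
    rewrite !ipnorm_zpoly // -subr_ge0.
    rewrite (sum_ord_sub (fun n => modc (c n) ^+ 2 * ((r ^+ 2) ^+ n.+1 / n.+1%:R))) ?leq_maxr //.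
    apply: sumr_ge0 => n _; case: ifP => // _.
    by rewrite mulr_ge0 ?sqr_ge0 // divr_ge0 // exprn_ge0 // sqr_ge0.
  have -> : cut r (zpoly c K) = cut r f - cut r (f - zpoly c K).
    by rewrite cut_sub opprB addrC subrK.
  apply: le_trans (ipnormB siL (L2disk_cut r Lf) (L2disk_cut r (si_sub siL Lf LpK))) _.
  by rewrite lerD ?ipnorm_cut_le.
Qed.

(* The Taylor series converges uniformly on smaller disks only, so the norms are
   estimated on the disk of radius [r < 1], uniformly in [r]. *)
Lemma monomial_basis : orthonormal_basis (@dot R) (@bergman R) (@monomial R).
Proof.
split; [exact: monomial_bergman|exact: monomial_orthonormal|].
move=> f Bf e e0; have Lf := bergman_L2disk Bf.
have [c [_ approx bnd]] := bergman_taylor Bf.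
have e3 : 0 < e / 3 by rewrite divr_gt0.
have a0 n : 0 <= modc (c n) ^+ 2 / n.+1%:R :> R by rewrite divr_ge0 ?sqr_ge0.
have [|N HN] := nonneg_series_tail (B := nrm f ^+ 2) a0 _ (exprn_gt0 2 e3).
  by move=> N; rewrite -ipnorm_zpoly1 lerXn2r ?nnegrE ?ipnorm_ge0.
exists N, (fun n => c n * (Num.sqrt n.+1%:R)^-1%:C).
have -> : \sum_(i < N) (c i * (Num.sqrt i.+1%:R)^-1%:C) *: @monomial R i = zpoly c N.
  apply: eq_bigr => i _; rewrite monomialE scalerA -mulrA -rmorphM /= mulVf ?mulr1 //.
have LpN := zpoly_L2disk c N.
apply: (@le_lt_trans _ _ (e / 3 + e / 3)); last by lra.
apply: ipnorm_le_cuts; [exact: (si_sub siL)|by rewrite addr_ge0 // ltW|].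
(* [K] depends on [r], but the difference of the two partial sums is controlled by the choice of [N]
   alone. *)
move=> r r01; have [K0 HK] := approx r _ r01 e3; pose K := maxn K0 N.
have {}HK := HK K (leq_maxl _ _); have LpK := zpoly_L2disk c K.
have -> : f - zpoly c N = (f - zpoly c K) - (zpoly c N - zpoly c K).
  by rewrite opprB addrA subrK.
rewrite cut_sub.
apply: le_trans (ipnormB siL (L2disk_cut r (si_sub siL Lf LpK))
  (L2disk_cut r (si_sub siL LpN LpK))) _.
rewrite lerD // (le_trans (ipnorm_cut_le r (si_sub siL LpN LpK))) //.
rewrite -(@ler_pXn2r _ 2) ?nnegrE ?ipnorm_ge0 ?(ltW e3) // (ipnorm_distC siL) //.
apply: le_trans (HN K (leq_maxr _ _)).
rewrite {1}/zpoly (sum_ord_sub (fun n => c n *: (zmonomial n 0 1 : V))) ?leq_maxr //.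
have -> : \sum_(n < K) (if (n < N)%N then 0 else c n *: (zmonomial n 0 1 : V)) =
    zpoly (fun n => if (n < N)%N then 0 else c n) K.
  by apply: eq_bigr => i _; case: ifP => // _; rewrite scale0r.
rewrite ipnorm_zpoly1 (sum_ord_sub (fun n => modc (c n) ^+ 2 / n.+1%:R)) ?leq_maxr //.
by apply: ler_sum => n _; case: ifP => // _; rewrite modc0 expr0n mul0r.
Qed.

(** The partial sums have norm at most that of [f], so norm 0 kills every Taylor coefficient. *)
Lemma bergman_definite f : bergman f -> nrm f = 0 -> f = 0.
Proof.
move=> Bf f0; have [c [cf _ bnd]] := bergman_taylor Bf.
apply/funext => z; have [dz|ndz] := pselect (disk z); last first.
  by have [[f_out _ _ _] _] := Bf; exact: f_out.
apply: cf => // n; have := bnd n.+1; rewrite f0 => p0.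
have {}p0 : nrm (zpoly c n.+1) = 0 by apply/eqP; rewrite eq_le p0 ipnorm_ge0.
have := ipnorm_zpoly1 c n.+1; rewrite p0 expr0n /= => /esym/eqP.
rewrite psumr_eq0; last by move=> i _; rewrite divr_ge0 ?sqr_ge0.
move=> /allP/(_ ord_max); rewrite mem_index_enum => /(_ isT) /=.
by rewrite mulf_eq0 invr_eq0 pnatr_eq0 orbF sqrf_eq0 => /eqP/modc_eq0.
Qed.

End Bergman.

(** * Moments of the weights *)

Section QRatioMoments.
Variables (R : realFieldType) (q : R).
Hypothesis q01 : 0 < q < 1.
Let q0 : 0 < q. Proof. by case/andP: q01. Qed.
Let q1 : q < 1. Proof. by case/andP: q01. Qed.

(** The q-Pochhammer symbol [(-x; q)_n]; [qfact n] is [(q; q)_n], so that the quotients of [qfact]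
    in [sfE] and [sfO] are Gaussian binomial coefficients. *)
Definition qpoch (x : R) n := \prod_(j < n) (1 + x * q ^+ j).
Definition qfact n := \prod_(j < n) (1 - q ^+ j.+1).

Lemma qpochS x n : qpoch x n.+1 = qpoch x n * (1 + x * q ^+ n).
Proof. by rewrite /qpoch big_ord_recr. Qed.

Lemma qpochSl x n : qpoch x n.+1 = (1 + x) * qpoch (x * q) n.
Proof.
rewrite /qpoch big_ord_recl expr0 mulr1; congr (_ * _).
by apply: eq_bigr => j _; rewrite exprS mulrA.
Qed.

Lemma qfactS n : qfact n.+1 = qfact n * (1 - q ^+ n.+1).
Proof. by rewrite /qfact big_ord_recr. Qed.

Lemma qfact0 : qfact 0 = 1.
Proof. by rewrite /qfact big_ord0. Qed.

Lemma qpoch0 x : qpoch x 0 = 1.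
Proof. by rewrite /qpoch big_ord0. Qed.

Lemma qpoch_gt0 x n : 0 < x -> 0 < qpoch x n.
Proof.
by move=> x0; apply: prodr_gt0 => j _; rewrite addr_gt0 // mulr_gt0 // exprn_gt0.
Qed.

Lemma qfact_gt0 n : 0 < qfact n.
Proof.
by apply: prodr_gt0 => j _; rewrite subr_gt0 exprn_ilt1 // ltW.
Qed.

Section Weights.
Variables a b : R.
Hypothesis a0 : 0 < a.
Hypothesis b0 : 0 < b.

(* The moments [qpoch a n / qpoch b n] are those of the little q-Jacobi
   polynomials (with a negative parameter).  Their Stieltjes continued fraction
   has coefficients [sfA 0, sfC 0, sfA 1, sfC 1, ...], and [sfE], [sfO] are the
   even and odd rows of the associated Stieltjes matrix. *)
Definition sfA l :=
  if l is l'.+1 then q ^+ l * (1 + a * q ^+ l) * (1 + b * q ^+ l') /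
    ((1 + b * q ^+ (2 * l').+1) * (1 + b * q ^+ (2 * l').+2))
  else (1 + a) / (1 + b).

Definition sfC l := q ^+ l * (1 - q ^+ l.+1) * (b * q ^+ l - a) /
  ((1 + b * q ^+ (2 * l)) * (1 + b * q ^+ (2 * l).+1)).

Definition sfE i l := if (l <= i)%N then
  qfact i / (qfact l * qfact (i - l)) *
    (qpoch (a * q ^+ l) (i - l) / qpoch (b * q ^+ (2 * l)) (i - l)) else 0.

Definition sfO i l := if (l <= i)%N then
  qfact i / (qfact l * qfact (i - l)) *
    (qpoch (a * q ^+ l.+1) (i - l) / qpoch (b * q ^+ (2 * l).+1) (i - l)) else 0.

Let bq l : 0 < b * q ^+ l. Proof. by rewrite mulr_gt0 // exprn_gt0. Qed.
Let bq1 l : 1 + b * q ^+ l != 0. Proof. by rewrite gt_eqF // addr_gt0. Qed.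
Let fn0 n : qfact n != 0. Proof. by rewrite gt_eqF // qfact_gt0. Qed.
Let fq n : 1 - q ^+ n.+1 != 0.
Proof. by rewrite gt_eqF // subr_gt0 exprn_ilt1 // ltW. Qed.
Let pb l n : qpoch (b * q ^+ l) n != 0. Proof. by rewrite gt_eqF // qpoch_gt0. Qed.

Lemma sfEE i : sfE i i = 1.
Proof.
by rewrite /sfE leqnn subnn !qpoch0 qfact0 divr1 !mulr1 divff.
Qed.

Lemma sfOO i : sfO i i = 1.
Proof.
by rewrite /sfO leqnn subnn !qpoch0 qfact0 divr1 !mulr1 divff.
Qed.

Lemma sfE0 i : sfE i 0 = qpoch a i / qpoch b i.
Proof.
by rewrite /sfE leq0n subn0 muln0 expr0 !mulr1 qfact0 mul1r divff // mul1r.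
Qed.

Lemma sfE_gt i l : (i < l)%N -> sfE i l = 0.
Proof. by move=> il; rewrite /sfE leqNgt il. Qed.

Lemma sfO_gt i l : (i < l)%N -> sfO i l = 0.
Proof. by move=> il; rewrite /sfO leqNgt il. Qed.

(** Together with [sfE_rec] these are the recurrences that characterise the rows of the Stieltjes
    matrix. *)
Lemma sfO_rec i l : sfO i l = sfE i l + sfC l * sfE i l.+1.
Proof.
have [li|] := ltnP l i; last first.
  rewrite leq_eqVlt => /orP[/eqP ->|il].
    by rewrite sfOO sfEE sfE_gt // mulr0 addr0.
  by rewrite sfO_gt // !sfE_gt ?mulr0 ?addr0 // ltnW.
have [d ->] : exists d, i = (l.+1 + d)%N by exists (i - l.+1)%N; rewrite subnKC.
rewrite /sfO /sfE leq_addr (leq_trans (leqnSn l) (leq_addr _ _)).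
have -> : (l.+1 + d - l = d.+1)%N by rewrite addSnnS addKn.
rewrite addKn /sfC.
(* With [i = l + 1 + d], all q-Pochhammer symbols are expressed by two of length [d]; what remains
   is a rational identity in [q ^+ l] and [q ^+ d]. *)
have p1 : qpoch (a * q ^+ l) d.+1 = (1 + a * q ^+ l) * qpoch (a * q ^+ l.+1) d.
  by rewrite qpochSl -mulrA -exprSr.
have p2 : qpoch (a * q ^+ l.+1) d.+1 =
   qpoch (a * q ^+ l.+1) d * (1 + a * q ^+ l * q * q ^+ d).
  by rewrite qpochS exprSr !mulrA.
have r1 : qpoch (b * q ^+ (2 * l).+1) d.+1 =
    (1 + b * q ^+ (2 * l).+1) * qpoch (b * q ^+ (2 * l.+1)) d.
  by rewrite qpochSl -mulrA -exprSr mulnS.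
have r2 : qpoch (b * q ^+ (2 * l)) d.+1 * (1 + b * q ^+ (2 * l).+1 * q ^+ d) =
    (1 + b * q ^+ (2 * l)) * ((1 + b * q ^+ (2 * l).+1) * qpoch (b * q ^+ (2 * l.+1)) d).
  by rewrite qpochSl -r1 qpochS -[b * _ * q]mulrA -exprSr mulrA.
have r2' : qpoch (b * q ^+ (2 * l)) d.+1 =
    (1 + b * q ^+ (2 * l)) * ((1 + b * q ^+ (2 * l).+1) * qpoch (b * q ^+ (2 * l.+1)) d) /
    (1 + b * q ^+ (2 * l).+1 * q ^+ d).
  by rewrite -r2 mulfK // -mulrA -exprD.
have nz1 : 1 + b * q ^+ (2 * l).+1 * q ^+ d != 0 by rewrite -mulrA -exprD.
rewrite p1 p2 r1 r2' (qfactS l) (qfactS d).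
have := fq l; have := fq d; have := bq1 (2 * l); have := bq1 (2 * l).+1; move: nz1.
have := pb (2 * l.+1) d; have := fn0 l; have := fn0 d.
move: (qpoch (b * _) d) (qpoch (a * _) d) (qfact l) (qfact d) (qfact _).
rewrite !exprSr mulnC exprM.
move: (q ^+ l) (q ^+ d) => y z r p fl fd fi *.
by field; do ! [apply/andP; split].
Qed.

Lemma sfE_rec i l :
  sfE i.+1 l = (if l is l'.+1 then sfO i l' else 0) + sfA l * sfO i l.
Proof.
case: l => [|l].
  rewrite add0r sfE0 /sfA /sfO leq0n subn0 muln0 !expr1 !qpochSl.
  rewrite qfact0 mul1r divff // mul1r.
  by field; rewrite !gt_eqF ?qpoch_gt0 ?mulr_gt0 ?addr_gt0.
have [li|] := ltnP l i; last first.
  rewrite leq_eqVlt => /orP[/eqP ->|il].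
    by rewrite sfOO sfEE sfO_gt // mulr0 addr0.
  by rewrite sfE_gt // !sfO_gt ?mulr0 ?addr0 // ltnW.
have [d ->] : exists d, i = (l.+1 + d)%N by exists (i - l.+1)%N; rewrite subnKC.
rewrite /sfO /sfE leq_addr ltnS (leq_trans (leqnSn l) (leq_addr _ _)).
have -> : (l.+1 + d - l = d.+1)%N by rewrite addSnnS addKn.
have -> : ((l.+1 + d).+1 - l.+1 = d.+1)%N by lia.
rewrite addKn /sfA.
have p1 : qpoch (a * q ^+ l.+1) d.+1 = (1 + a * q ^+ l.+1) * qpoch (a * q ^+ l.+2) d.
  by rewrite qpochSl -mulrA -exprSr.
have r1 : qpoch (b * q ^+ (2 * l.+1)) d.+1 =
    (1 + b * q ^+ (2 * l).+2) * qpoch (b * q ^+ (2 * l.+1).+1) d.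
  by rewrite qpochSl -mulrA -exprSr mulnS.
have r2 : qpoch (b * q ^+ (2 * l).+1) d.+1 * (1 + b * q ^+ (2 * l).+2 * q ^+ d) =
    (1 + b * q ^+ (2 * l).+1) *
    ((1 + b * q ^+ (2 * l).+2) * qpoch (b * q ^+ (2 * l.+1).+1) d).
  by rewrite qpochSl -r1 qpochS -[b * _ * q]mulrA -exprSr mulrA mulnS.
have nz1 : 1 + b * q ^+ (2 * l).+2 * q ^+ d != 0 by rewrite -mulrA -exprD.
have r2' : qpoch (b * q ^+ (2 * l).+1) d.+1 = (1 + b * q ^+ (2 * l).+1) *
    ((1 + b * q ^+ (2 * l).+2) * qpoch (b * q ^+ (2 * l.+1).+1) d) /
    (1 + b * q ^+ (2 * l).+2 * q ^+ d).
  by rewrite -r2 mulfK.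
have gS : qfact (l.+1 + d).+1 = qfact (l.+1 + d) * (1 - q ^+ l * q * q ^+ d * q).
  by rewrite qfactS exprSr exprD exprSr.
rewrite p1 r1 r2' gS (qfactS l) (qfactS d).
have := fq l; have := fq d; have := bq1 (2 * l).+1; have := bq1 (2 * l).+2; move: nz1.
have := pb (2 * l.+1).+1 d; have := fn0 l; have := fn0 d.
move: (qpoch (b * _) d) (qpoch (a * _) d) (qfact l) (qfact d) (qfact _).
rewrite !exprSr mulnC exprM.
move: (q ^+ l) (q ^+ d) => y z r p fl fd fi *.
by field; do ! [apply/andP; split].
Qed.

(** The diagonal factor in the decomposition [L D L^T] of the Hankel matrix, whose unit triangular
    factor is [sfE]. *)
Definition sfK l := \prod_(t < l) (sfA t * sfC t).

(** The right-hand side is symmetric in [i] and [j], which allows a unit to be moved from one row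
    index to the other. The shift of [l] uses [sfK l.+1 = sfK l * (sfA l * sfC l)]. *)
Lemma sf_symmetric N i j : (i.+1 < N)%N -> (j.+1 < N)%N ->
  \sum_(l < N) sfK l * sfE i.+1 l * sfE j l = \sum_(l < N) sfK l * sfA l * sfO i l * sfO j l.
Proof.
case: N => // N iN jN.
under eq_bigr do rewrite sfE_rec mulrDr mulrDl.
rewrite big_split /= big_ord_recl mulr0 mul0r add0r.
under [RHS]eq_bigr do rewrite (sfO_rec j) mulrDr.
rewrite [RHS]big_split /= addrC; congr (_ + _).
  by apply: eq_bigr => l _; rewrite mulrA.
rewrite big_ord_recr /= sfE_gt ?mulr0 ?addr0; last by rewrite ltnW.
apply: eq_bigr => l _; rewrite /bump /= add1n /sfK big_ord_recr /=; ring.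
Qed.

(** For [i = 0] only [l = 0] survives; the induction moves units from [i] to [j], applying the
    symmetry once in each direction. *)
Lemma sf_gram i j N : ((i + j).+1 < N)%N ->
  qpoch a (i + j) / qpoch b (i + j) = \sum_(l < N) sfK l * sfE i l * sfE j l.
Proof.
elim: i j => [|i IH] j ijN.
  rewrite add0n -sfE0; case: N ijN => // N _; rewrite big_ord_recl big1 ?addr0 => [|l _].
    by rewrite /sfK big_ord0 sfEE !mul1r.
  by rewrite [sfE 0 _]sfE_gt // mulr0 mul0r.
rewrite addSnnS in ijN *; rewrite IH // sf_symmetric; [|lia|lia].
under eq_bigr => l _ do rewrite mulrAC.
rewrite sf_symmetric; [|lia|lia]; apply: eq_bigr => l _; ring.
Qed.

Lemma sfA_gt0 l : 0 < sfA l.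
Proof.
case: l => [|l]; first by rewrite divr_gt0 ?addr_gt0.
by rewrite divr_gt0 ?mulr_gt0 ?addr_gt0 ?exprn_gt0 // mulr_gt0 // exprn_gt0.
Qed.

(** For [q = 1/2] and [b = (s + 1) a] the hypothesis reads [2 ^ l <= s + 1]. *)
Lemma sfC_ge0 l : a <= b * q ^+ l -> 0 <= sfC l.
Proof.
move=> ab; rewrite divr_ge0 ?mulr_ge0 ?subr_ge0 ?(ltW (exprn_gt0 _ _)) //.
- by rewrite exprn_ile1 // ltW.
- by rewrite ltW // addr_gt0.
- by rewrite ltW // addr_gt0.
Qed.

Lemma sfK_ge0 k l : (l <= k.+1)%N -> a <= b * q ^+ k -> 0 <= sfK l.
Proof.
move=> lk ab; apply: prodr_ge0 => t _; rewrite mulr_ge0 ?(ltW (sfA_gt0 _)) // sfC_ge0 //.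
apply: le_trans ab _; rewrite ler_wpM2l ?(ltW b0) // ler_wiXn2l ?ltW //.
by have := ltn_ord t; lia.
Qed.

(* Schur's product theorem, applied to the Gram decomposition [sf_gram]. *)
Lemma qratio_hankel_psd k K (x : 'I_K -> R) : (K <= k.+2)%N -> a <= b * q ^+ k ->
  0 <= \sum_(i < K) \sum_(j < K)
    x i * x j * (qpoch a (i + j) / qpoch b (i + j)) ^+ 2.
Proof.
(* All indices are at most [k + 1], so this [N] meets the bound of [sf_gram] for every entry. *)
move=> Kk ab; pose N := (2 * k + 5)%N.
have -> : \sum_(i < K) \sum_(j < K)
    x i * x j * (qpoch a (i + j) / qpoch b (i + j)) ^+ 2 =
  \sum_(l < N) \sum_(m < N) sfK l * sfK m *
    (\sum_(i < K) x i * sfE i l * sfE i m) ^+ 2.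
  transitivity (\sum_(i < K) \sum_(j < K) \sum_(l < N) \sum_(m < N)
      x i * x j * (sfK l * sfE i l * sfE j l * (sfK m * sfE i m * sfE j m))).
    apply: eq_bigr => i _; apply: eq_bigr => j _.
    rewrite (@sf_gram i j N); last by rewrite /N; have := ltn_ord i; have := ltn_ord j; lia.
    rewrite expr2 big_distrlr mulr_sumr; apply: eq_bigr => l _.
    by rewrite mulr_sumr.
  under eq_bigr do rewrite exchange_big /=; rewrite exchange_big /=.
  apply: eq_bigr => l _.
  under eq_bigr do rewrite exchange_big /=; rewrite exchange_big /=.
  apply: eq_bigr => m _.
  rewrite expr2 mulr_suml mulr_sumr; apply: eq_bigr => i _.
  rewrite !mulr_sumr; apply: eq_bigr => j _; ring.
apply: sumr_ge0 => l _; apply: sumr_ge0 => m _.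
(* Beyond [k + 1] the triangular factor vanishes, so only coefficients of known sign remain. *)
have [lk|kl] := leqP l k.+1; last first.
  rewrite big1 => [|i _]; first by rewrite expr0n mulr0.
  have il : (i < l)%N by have := ltn_ord i; lia.
  by rewrite (sfE_gt il) mulr0 mul0r.
have [mk|km] := leqP m k.+1; last first.
  rewrite big1 => [|i _]; first by rewrite expr0n mulr0.
  have im : (i < m)%N by have := ltn_ord i; lia.
  by rewrite (sfE_gt im) mulr0.
by rewrite mulr_ge0 ?sqr_ge0 // mulr_ge0 // (sfK_ge0 _ ab).

Qed.

End Weights.
End QRatioMoments.

(** * The Hankel matrices of the shifts *)

Section KHyponormality.
Variable R : realType.

Definition bergman_weight (s n : nat) : R := n.+1%:R / (n.+1 + s)%:R.

Lemma bergman_weight_gt0 s n : 0 < bergman_weight s n.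
Proof. by rewrite divr_gt0 ?ltr0n. Qed.

Lemma bergman_weight_le1 s n : bergman_weight s n <= 1.
Proof. by rewrite ler_pdivrMr ?ltr0n // mul1r ler_nat leq_addr. Qed.

Lemma moment_add (alpha : nat -> R) n j :
  moment alpha (n + j) = moment alpha n * moment (fun i => alpha (n + i)%N) j.
Proof.
elim: j => [|j IH]; first by rewrite addn0 [moment _ 0]big_ord0 mulr1.
by rewrite addnS [LHS]big_ord_recr /= -/(moment alpha _) IH /moment big_ord_recr /= mulrA.
Qed.

Lemma moment_ge0 (alpha : nat -> R) n : 0 <= moment alpha n.
Proof. by apply: prodr_ge0 => j _; rewrite sqr_ge0. Qed.

(** Dividing numerator and denominator of a weight by [m * 2 ^ i] gives
    [(1 + a q ^ i) / (1 + b q ^ i)]. *)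
Lemma bergman_moment s m j : (0 < m)%N ->
  moment (fun i => bergman_weight s (m * 2 ^ i)) j =
  (qpoch 2^-1 (m%:R^-1) j / qpoch 2^-1 (s.+1%:R / m%:R) j) ^+ 2.
Proof.
move=> m0; rewrite /moment /qpoch -prodf_div -prodrXl; apply: eq_bigr => i _.
have m1 : (0 : R) < m%:R by rewrite ltr0n.
have p1 : (0 : R) < 2 ^+ i by rewrite exprn_gt0.
have s0 : (0 : R) < s.+1%:R by rewrite ltr0n.
congr (_ ^+ 2); rewrite /bergman_weight addSnnS natrD -natr1 natrM natrX exprVn.
move: m1 p1 s0; move: (m%:R : R) (2 ^+ i : R) (s.+1%:R : R) => x y z x0 y0 z0.
have xy : 0 < x * y by rewrite mulr_gt0.
by field; rewrite !gt_eqF ?addr_gt0.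
Qed.

(** Dropping the first [n] weights replaces [m] by [m * 2 ^ n] and leaves [b / a = s + 1] unchanged,
    so one criterion serves all [n]. *)
Lemma bergman_k_hyponormal s k m : (0 < m)%N -> (2 ^ k <= s.+1)%N ->
  k_hyponormal (fun i => bergman_weight s (m * 2 ^ i)) k.
Proof.
move=> m0 ks n; split.
  by apply/matrixP => i j; rewrite !mxE addnAC.
move=> x; rewrite mxE.
have q01 : 0 < (2^-1 : R) < 1 by apply/andP; split; lra.
pose M := (m * 2 ^ n)%N; have M0 : (0 < M)%N by rewrite muln_gt0 m0 expn_gt0.
have M1 : (0 : R) < M%:R by rewrite ltr0n.
have a0 : (0 : R) < M%:R^-1 by rewrite invr_gt0.
have b0 : (0 : R) < s.+1%:R / M%:R by rewrite divr_gt0 // ltr0n.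
have ab : M%:R^-1 <= s.+1%:R / M%:R * (2^-1 : R) ^+ k.
  rewrite mulrAC ler_peMl ?(ltW a0) // exprVn ler_pdivlMr ?exprn_gt0 // mul1r.
  by rewrite -natrX ler_nat.
have := qratio_hankel_psd q01 a0 b0 (fun i => x i 0) (leqnSn k.+1) ab.
move=> /(mulr_ge0 (moment_ge0 (fun i => bergman_weight s (m * 2 ^ i)) n)).
move=> /le_trans; apply; rewrite le_eqVlt; apply/orP; left; apply/eqP.
rewrite mulr_sumr.
under [RHS]eq_bigr => j _ do rewrite mxE mulr_suml.
rewrite [RHS]exchange_big /=; apply: eq_bigr => i _; rewrite mulr_sumr.
apply: eq_bigr => j _; rewrite !mxE -addnA moment_add.
have -> : (fun l => bergman_weight s (m * 2 ^ (n + l))) =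
    (fun l => bergman_weight s (M * 2 ^ l)) by apply/funext => l; rewrite expnD mulnA.
rewrite (bergman_moment s (i + j) M0); ring.
Qed.

End KHyponormality.

(** * Moments of finitely atomic measures *)

Section AtomicMoments.
Variable R : realType.

(* For [b = 2 ^ k * a] the product [qpoch a n / qpoch b n] telescopes to a
   polynomial of degree [k] in [2 ^- n]. *)
Lemma qpoch_double_quotient (a : R) k n : 0 < a ->
  qpoch 2^-1 a n / qpoch 2^-1 (2 ^+ k * a) n =
  \prod_(l < k) ((1 + 2 ^+ l.+1 * a * 2^-1 ^+ n) / (1 + 2 ^+ l.+1 * a)).
Proof.
move=> a0; have q01 : 0 < (2^-1 : R) < 1 by apply/andP; split; lra.
have p0 l : 0 < 2 ^+ l * a by rewrite mulr_gt0 // exprn_gt0.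
elim: k => [|k IH].
  by rewrite expr0 mul1r big_ord0 divff // gt_eqF // qpoch_gt0.
rewrite big_ord_recr /= -IH.
have E : qpoch 2^-1 (2 ^+ k.+1 * a) n * (1 + 2 ^+ k.+1 * a * 2^-1 ^+ n) =
    (1 + 2 ^+ k.+1 * a) * qpoch 2^-1 (2 ^+ k * a) n.
  rewrite -qpochS qpochSl; congr (_ * qpoch _ _ _).
  by rewrite exprS; field.
have n1 : 1 + 2 ^+ k.+1 * a != 0 by rewrite gt_eqF // addr_gt0.
have n2 : qpoch 2^-1 (2 ^+ k * a) n != 0 by rewrite gt_eqF // qpoch_gt0.
have n3 : qpoch 2^-1 (2 ^+ k.+1 * a) n != 0 by rewrite gt_eqF // qpoch_gt0.
have -> : 1 + 2 ^+ k.+1 * a * 2^-1 ^+ n =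
  (1 + 2 ^+ k.+1 * a) * qpoch 2^-1 (2 ^+ k * a) n / qpoch 2^-1 (2 ^+ k.+1 * a) n.
  by rewrite -E [RHS]mulrC mulKf.
by field; rewrite n1 n2 n3.
Qed.

(** The moments are values at [q ^ n] of a polynomial [p ^ 2 / p(1) ^ 2]. Its coefficients are the
    masses, since [(q ^ n) ^ i = (q ^ i) ^ n]. *)
Lemma bergman_moments_atomic k m : (0 < m)%N ->
  exists (d : nat) (c : 'I_d -> R), (forall i, 0 <= c i) /\
    forall n, moment (fun i => bergman_weight R (2 ^ k - 1) (m * 2 ^ i)) n =
      \sum_i c i * (2^-1 ^+ i) ^+ n.
Proof.
move=> m0; have m1 : (0 : R) < m%:R by rewrite ltr0n.
pose a : R := m%:R^-1; have a0 : 0 < a by rewrite invr_gt0.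
pose p : {poly R} := \prod_(l < k) (1 + (2 ^+ l.+1 * a)%:P * 'X).
have pE x : p.[x] = \prod_(l < k) (1 + 2 ^+ l.+1 * a * x).
  by rewrite horner_prod; apply: eq_bigr => l _; rewrite !hornerE.
have p1 : 0 < p.[1].
  rewrite pE; apply: prodr_gt0 => l _.
  by rewrite addr_gt0 // !mulr_gt0 // exprn_gt0.
have mul_nn (u v : {poly R}) : (forall i, 0 <= u`_i) -> (forall i, 0 <= v`_i) ->
    forall i, 0 <= (u * v)`_i.
  by move=> u0 v0 i; rewrite coefM; apply: sumr_ge0 => j _; rewrite mulr_ge0.
have pnn i : 0 <= (p ^+ 2)`_i.
  suff p_nn : forall j, 0 <= p`_j by exact: mul_nn.
  apply: (big_ind (fun u : {poly R} => forall j, 0 <= u`_j)) => [j|u v|l _ j].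
  - by rewrite coef1 ler0n.
  - exact: mul_nn.
  - by rewrite coefD coef1 coefCM coefX addr_ge0 // !mulr_ge0 ?exprn_ge0 // ltW.
exists (size (p ^+ 2)), (fun i => (p ^+ 2)`_i / p.[1] ^+ 2); split.
  by move=> i; rewrite divr_ge0 ?sqr_ge0.
move=> n; rewrite bergman_moment //.
have -> : (2 ^ k - 1).+1%:R / m%:R = 2 ^+ k * a :> R.
  by rewrite -subSn ?expn_gt0 // subn1 /= natrX.
rewrite qpoch_double_quotient // prodf_div.
transitivity ((p ^+ 2).[2^-1 ^+ n] / p.[1] ^+ 2).
  rewrite horner_exp -expr_div_n !pE; congr ((_ / _) ^+ 2).
  by apply: eq_bigr => l _; rewrite mulr1.
rewrite horner_coef mulr_suml; apply: eq_bigr => i _.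
by rewrite mulrAC -!exprM mulnC.
Qed.

End AtomicMoments.

(** * Subnormal shifts *)

Section ComplexSequences.
Variable R : realType.
Local Notation C := R[i].

Lemma cvg_complexP (u : nat -> C) (l : C) :
  (forall e : R, 0 < e -> exists N : nat, forall n, (N <= n)%N -> modc (u n - l) < e) <->
  (u : nat -> C^o) @ \oo --> (l : C^o).
Proof.
split=> [H|/cvgrPdist_lt H].
  apply/cvgrPdist_lt => e e0.
  have eR : e = (complex.Re e)%:C by rewrite RRe_real // gtr0_real.
  have e0' : 0 < complex.Re e by rewrite eR ltcR in e0.
  have [N HN] := H _ e0'; exists N => // n /= Nn.
  by rewrite norm_modc eR ltcR modc_distC HN.
move=> e e0; have [|N _ HN] := H e%:C; first by rewrite ltcR.
by exists N => n /HN /=; rewrite norm_modc ltcR modc_distC.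
Qed.

Lemma cvg_complex (u : nat -> C) (a b : R) :
  (fun n => complex.Re (u n)) @ \oo --> a -> (fun n => complex.Im (u n)) @ \oo --> b ->
  (u : nat -> C^o) @ \oo --> (a +i* b : C^o).
Proof.
move=> /cvgrPdist_lt Ha /cvgrPdist_lt Hb; apply/cvg_complexP => e e0.
have [N1 _ H1] := Ha _ (divr_gt0 e0 (ltr0n R 2)).
have [N2 _ H2] := Hb _ (divr_gt0 e0 (ltr0n R 2)).
exists (maxn N1 N2) => n; rewrite geq_max => /andP[n1 n2].
rewrite (le_lt_trans (modc_le_ReIm _)) //.
have := H1 _ n1; have := H2 _ n2; rewrite /= distrC [`|_ - complex.Re _|]distrC.
case: (u n) => x y /=; lra.
Qed.

Lemma cvg_finite_sum (J : Type) (r : seq J) (u : J -> nat -> R) (l : J -> R) :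
  (forall j, u j @ \oo --> l j) ->
  (fun n => \sum_(j <- r) u j n) @ \oo --> \sum_(j <- r) l j.
Proof.
move=> H; elim: r => [|j r IH].
  rewrite big_nil; under eq_fun do rewrite big_nil; exact: cvg_cst.
rewrite big_cons; under eq_fun do rewrite big_cons; exact: cvgD.
Qed.

Lemma cvg_conjc (u : nat -> C) (l : C) : (u : nat -> C^o) @ \oo --> (l : C^o) ->
  ((fun n => conjc (u n)) : nat -> C^o) @ \oo --> (conjc l : C^o).
Proof.
move=> /cvg_complexP H; apply/cvg_complexP => e /H[N HN].
by exists N => n /HN; rewrite -rmorphB modcJ.
Qed.

Lemma bounded_sums_cvg (u v : nat -> R) (B : R) : (forall n, `|u n| <= v n) ->
  (forall N, \sum_(n < N) v n <= B) -> cvg (series u @ \oo).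
Proof.
move=> uv vB; apply: normed_cvg; apply: nondecreasing_is_cvgn.
  by apply: nondecreasing_series => n _ _ /=.
exists B => _ [N _ <-]; apply: le_trans (vB N); rewrite /= seriesEord /=.
by apply: ler_sum => n _.
Qed.

End ComplexSequences.

(** * The Hilbert space of square-summable sequences *)

Section EllTwo.
Variables (R : realType) (I : finType).
Local Notation C := R[i].
Local Notation V0 := (nat -> I -> C^o).

Definition row_sqr (x : V0) n : R := \sum_i modc (x n i) ^+ 2.
Definition row_dot (x y : V0) n : C := \sum_i x n i * conjc (y n i).

Definition square_summable : {pred V0} := fun x =>
  `[< exists B, forall N, \sum_(n < N) row_sqr x n <= B >].

Lemma row_sqr_ge0 x n : 0 <= row_sqr x n.
Proof. by apply: sumr_ge0 => i _; rewrite sqr_ge0. Qed.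

Lemma row_sqrD x y n : row_sqr (x + y) n <= 2 * row_sqr x n + 2 * row_sqr y n.
Proof.
rewrite /row_sqr !mulr_sumr -big_split /=; apply: ler_sum => i _.
set z := modc (x n i); set t := modc (y n i).
have h : modc ((x + y) n i) <= z + t := modcD _ _.
apply: (@le_trans _ _ ((z + t) ^+ 2)).
  by rewrite lerXn2r ?nnegrE ?modc_ge0 // addr_ge0 ?modc_ge0.
by have := sqr_ge0 (z - t); rewrite sqrrB sqrrD; lra.
Qed.

Lemma row_sqrZ (a : C) x n : row_sqr (a *: x) n = modc a ^+ 2 * row_sqr x n.
Proof.
rewrite /row_sqr mulr_sumr; apply: eq_bigr => i _.
by rewrite -exprMn -modcM.
Qed.

Lemma square_summable_submod : submod_closed square_summable.
Proof.
split.
  apply/asboolP; exists 0 => N; rewrite big1 // => n _.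
  by rewrite /row_sqr big1 // => i _; rewrite modc0 expr0n.
move=> a x y /asboolP[B HB] /asboolP[B' HB']; apply/asboolP.
exists (2 * (modc a ^+ 2 * B) + 2 * B') => N.
apply: (@le_trans _ _ (\sum_(n < N) (2 * (modc a ^+ 2 * row_sqr x n) + 2 * row_sqr y n))).
  by apply: ler_sum => n _; rewrite -row_sqrZ row_sqrD.
rewrite big_split /= -!mulr_sumr; apply: lerD; rewrite ler_wpM2l ?HB' //.
by rewrite ler_wpM2l ?sqr_ge0 ?HB.
Qed.

HB.instance Definition _ := GRing.isSubmodClosed.Build C V0 square_summable
  square_summable_submod.

(** [subnormal] takes the larger Hilbert space to be a whole type, so summability belongs to the
    type rather than to a set of vectors. *)
Record ell2 := Ell2 { ell2_val :> V0; ell2_valP : ell2_val \in square_summable }.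

HB.instance Definition _ := [isSub for ell2_val].
HB.instance Definition _ := [Choice of ell2 by <:].
HB.instance Definition _ := [SubChoice_isSubLmodule of ell2 by <:].

Implicit Types x y z : ell2.

Lemma ell2_bounded x : exists B, forall N, \sum_(n < N) row_sqr x n <= B.
Proof. by have /asboolP := ell2_valP x. Qed.

Lemma modc_row_dot (x y : V0) n : modc (row_dot x y n) <= row_sqr x n + row_sqr y n.
Proof.
rewrite /row_dot /row_sqr -big_split /= (le_trans (modc_sum _ _ _)) //.
apply: ler_sum => i _; rewrite modcM modcJ.
set a := modc _; set b := modc _.
have := sqr_ge0 (a - b); rewrite sqrrB.
have : 0 <= a ^+ 2 := sqr_ge0 _; have : 0 <= b ^+ 2 := sqr_ge0 _; lra.
Qed.

Lemma row_dot_linear (a : C) (x y z : V0) n :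
  row_dot (a *: x + y) z n = a * row_dot x z n + row_dot y z n.
Proof.
rewrite /row_dot mulr_sumr -big_split; apply: eq_bigr => i _.
change ((a *: x + y) n i) with (a * x n i + y n i).
by rewrite mulrDl mulrA.
Qed.

Lemma row_dot_conj (x y : V0) n : row_dot y x n = conjc (row_dot x y n).
Proof.
rewrite /row_dot rmorph_sum; apply: eq_bigr => i _.
case: (x n i) => a b; case: (y n i) => c d; simpc.
by congr (_ +i* _); ring.
Qed.

Lemma ell2_linE (a : C) x y :
  ell2_val (a *: x + y) = a *: (ell2_val x : V0) + (ell2_val y : V0).
Proof. by []. Qed.

Definition ell2_ip x y : C :=
  limn (fun N => complex.Re (\sum_(n < N) row_dot x y n)) +i*
  limn (fun N => complex.Im (\sum_(n < N) row_dot x y n)).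

Lemma ell2_ip_cvg x y :
  ((fun N => \sum_(n < N) row_dot x y n) : nat -> C^o) @ \oo --> (ell2_ip x y : C^o).
Proof.
have [B HB] := ell2_bounded x; have [B' HB'] := ell2_bounded y.
have bnd N : \sum_(n < N) (row_sqr x n + row_sqr y n) <= B + B'.
  by rewrite big_split lerD ?HB ?HB'.
apply: cvg_complex.
  have -> : (fun N => complex.Re (\sum_(n < N) row_dot x y n)) =
      series (fun n => complex.Re (row_dot x y n)).
    by apply/funext => N; rewrite seriesEord raddf_sum.
  apply: (bounded_sums_cvg _ bnd) => n.
  exact: le_trans (Re_le_modc _) (modc_row_dot _ _ _).
have -> : (fun N => complex.Im (\sum_(n < N) row_dot x y n)) =
    series (fun n => complex.Im (row_dot x y n)).
  by apply/funext => N; rewrite seriesEord raddf_sum.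
apply: (bounded_sums_cvg _ bnd) => n.
exact: le_trans (Im_le_modc _) (modc_row_dot _ _ _).
Qed.

Lemma ell2_ip_unique x y (l : C) :
  ((fun N => \sum_(n < N) row_dot x y n) : nat -> C^o) @ \oo --> (l : C^o) ->
  ell2_ip x y = l.
Proof.
move=> Hl; have := @cvg_unique C^o (@norm_hausdorff _ C^o) _ _ _ _ (@ell2_ip_cvg x y) Hl.
exact.
Qed.

Lemma ell2_ip_linear (a : C) x y z :
  ell2_ip (a *: x + y) z = a * ell2_ip x z + ell2_ip y z.
Proof.
apply: ell2_ip_unique.
have -> : (fun N => \sum_(n < N) row_dot (a *: x + y : ell2) z n) =
   (fun N => a * (\sum_(n < N) row_dot x z n) + \sum_(n < N) row_dot y z n).
  apply/funext => N; rewrite mulr_sumr -big_split; apply: eq_bigr => n _.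
  by rewrite ell2_linE (row_dot_linear a x y z n).
apply: (@cvgD _ C^o); last exact: ell2_ip_cvg.
by apply: (@cvgMr C nat _ _ (fun N => \sum_(n < N) row_dot x z n)); exact: ell2_ip_cvg.
Qed.

Lemma ell2_ip_conj x y : ell2_ip y x = conjc (ell2_ip x y).
Proof.
apply: ell2_ip_unique.
have -> : (fun N => \sum_(n < N) row_dot y x n) =
   (fun N => conjc (\sum_(n < N) row_dot x y n)).
  by apply/funext => N; rewrite rmorph_sum; apply: eq_bigr => n _; exact: row_dot_conj.
by apply: cvg_conjc; exact: ell2_ip_cvg.
Qed.

Lemma row_dot_self (x : V0) n : row_dot x x n = (row_sqr x n)%:C.
Proof.
rewrite /row_dot /row_sqr rmorph_sum; apply: eq_bigr => i _ /=.
rewrite modc_sqr; case: (x n i) => a b; simpc.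
by congr (_ +i* _); ring.
Qed.

Lemma ell2_self_cvg x :
  (fun N => \sum_(n < N) row_sqr x n) @ \oo --> complex.Re (ell2_ip x x).
Proof.
have /cvg_complexP H := ell2_ip_cvg (x:=x) (y:=x); apply/cvgrPdist_lt => e /H[N HN].
exists N => // n /= /HN; apply: le_lt_trans.
rewrite distrC; apply: le_trans (Re_le_modc _).
rewrite raddfB /= raddf_sum; under [X in _ <= `|X - _|]eq_bigr do rewrite row_dot_self.
by [].
Qed.

Lemma ell2_self_Im x : complex.Im (ell2_ip x x) = 0.
Proof.
have := ell2_ip_conj x x; case: (ell2_ip x x) => a b /= [] h; lra.
Qed.

Lemma ell2_sum_le x N : \sum_(n < N) row_sqr x n <= complex.Re (ell2_ip x x).
Proof.
have nd : nondecreasing_seq (fun N => \sum_(n < N) row_sqr x n).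
  by apply/nondecreasing_seqP => n; rewrite big_ord_recr lerDl row_sqr_ge0.
have c := @ell2_self_cvg x; rewrite -(cvg_lim _ c) //.
by apply: (nondecreasing_cvgn_le nd); apply/cvg_ex; exists (complex.Re (ell2_ip x x)).
Qed.

Lemma ell2_self_le x (B : R) : (forall N, \sum_(n < N) row_sqr x n <= B) ->
  complex.Re (ell2_ip x x) <= B.
Proof.
move=> HB; have c := @ell2_self_cvg x; rewrite -(cvg_lim _ c) //.
apply: limr_le; first by apply/cvg_ex; exists (complex.Re (ell2_ip x x)).
by near=> N; exact: HB.
Unshelve. all: by end_near. Qed.

Local Notation nrm2 := (ipnorm ell2_ip).

Lemma ell2_self_ge0 x : 0 <= complex.Re (ell2_ip x x).
Proof. by have := ell2_sum_le x 0; rewrite big_ord0. Qed.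

Lemma ell2_norm_sqr x : nrm2 x ^+ 2 = complex.Re (ell2_ip x x).
Proof. by rewrite sqr_sqrtr ?ell2_self_ge0. Qed.

Lemma ell2_norm_le x (B : R) : 0 <= B ->
  (forall N, \sum_(n < N) row_sqr x n <= B ^+ 2) -> nrm2 x <= B.
Proof.
move=> B0 HB; rewrite -(@ler_pXn2r _ 2) ?nnegrE ?sqrtr_ge0 // ell2_norm_sqr.
exact: ell2_self_le.
Qed.

Lemma modc_entry_le x n i : modc (x n i) <= nrm2 x.
Proof.
rewrite -(@ler_pXn2r _ 2) ?nnegrE ?modc_ge0 ?sqrtr_ge0 // ell2_norm_sqr.
apply: le_trans (ell2_sum_le x n.+1); rewrite big_ord_recr /=.
rewrite (@le_trans _ _ (row_sqr x n)) ?lerDr ?sumr_ge0 // => [|k _]; last exact: row_sqr_ge0.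
by rewrite /row_sqr (bigD1 i) //= lerDl sumr_ge0 // => k _; rewrite sqr_ge0.
Qed.

Lemma ell2_ext x y : (forall n i, x n i = y n i) -> x = y.
Proof.
move=> xy; apply: val_inj; apply/funext => n; apply/funext => i; exact: xy.
Qed.

Lemma ell2_definite x : x <> 0 -> 0 < ell2_ip x x.
Proof.
move=> x0; have -> : ell2_ip x x = (complex.Re (ell2_ip x x))%:C.
  by have := ell2_self_Im x; case: (ell2_ip x x) => a b /= ->.
rewrite -[0]/(0%:C) ltcR lt_def ell2_self_ge0 andbT; apply/eqP => h; apply: x0.
apply: ell2_ext => n i; apply/modc_eq0/eqP; rewrite eq_le modc_ge0 andbT.
by rewrite (le_trans (modc_entry_le x n i)) // /ipnorm h sqrtr0.
Qed.

Lemma modc_sqr_cvg (a : C) (u : nat -> C) (l : C) :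
  (forall e : R, 0 < e -> exists N : nat, forall n, (N <= n)%N -> modc (u n - l) < e) ->
  (fun n => modc (a - u n) ^+ 2) @ \oo --> modc (a - l) ^+ 2.
Proof.
move=> H; apply: (@cvgM _ _ _ _ (fun n => modc (a - u n)) (fun n => modc (a - u n)));
  apply/cvgrPdist_lt => e /H[N HN]; exists N => // n /= /HN; apply: le_lt_trans;
  rewrite ler_norml; have := modc_triangle (u n) a l; have := modc_triangle l a (u n);
  rewrite [modc (l - u n)]modc_distC; lra.
Qed.

Lemma ell2_complete (u : nat -> ell2) : cauchy_in_norm ell2_ip u ->
  exists l : ell2, cvg_in_norm ell2_ip u l.
Proof.
move=> Hu.
have entryB m p n i : modc (u m n i - u p n i) <= nrm2 (u m - u p).
  exact: (modc_entry_le (u m - u p) n i).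
have /choice[l Hl] : forall n, exists l : I -> C, forall i (e : R), 0 < e ->
    exists N : nat, forall m, (N <= m)%N -> modc (u m n i - l i) < e.
  move=> n; suff /choice[l Hl] : forall i, exists l : C, forall e : R, 0 < e ->
    exists N : nat, forall m, (N <= m)%N -> modc (u m n i - l) < e by exists l.
  move=> i; apply: (@cauchy_complex_lim _ (fun m => u m n i)) => e /Hu[N HN].
  by exists N => m p Nm Np; rewrite (le_lt_trans (entryB m p n i)) // HN.
(* The Cauchy bound holds on each finite block of rows and there survives the passage to the
   entrywise limit; it is uniform in the block. *)
have near_l (e : R) : 0 < e -> exists N : nat, forall m, (N <= m)%N ->
    forall K, \sum_(n < K) row_sqr ((u m : V0) - (l : V0)) n <= e ^+ 2.
  move=> e0; have [N HN] := Hu _ e0; exists N => m Nm K.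
  have cv : (fun p => \sum_(n < K) \sum_i modc (u m n i - u p n i) ^+ 2) @ \oo -->
      \sum_(n < K) \sum_i modc (u m n i - l n i) ^+ 2.
    by apply: cvg_finite_sum => n; apply: cvg_finite_sum => i; apply: modc_sqr_cvg; exact: Hl.
  have -> : \sum_(n < K) row_sqr ((u m : V0) - (l : V0)) n =
      \sum_(n < K) \sum_i modc (u m n i - l n i) ^+ 2 by [].
  rewrite -(cvg_lim _ cv) //; apply: limr_le; first by apply/cvg_ex; eexists; exact: cv.
  exists N => // p /= Np.
  apply: (le_trans (ell2_sum_le (u m - u p) K)); rewrite -ell2_norm_sqr.
  by rewrite lerXn2r ?nnegrE ?sqrtr_ge0 ?(ltW e0) // ltW // HN.
have lP : (l : V0) \in square_summable.
  have [N /(_ N (leqnn N)) HN] := near_l 1 ltr01.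
  have [B HB] := ell2_bounded (u N).
  apply/asboolP; exists (2 * B + 2 * 1 ^+ 2) => K.
  apply: (@le_trans _ _ (\sum_(n < K)
     (2 * row_sqr (u N) n + 2 * row_sqr ((u N : V0) - (l : V0)) n))).
    apply: ler_sum => n _.
    have := row_sqrD (u N) (- ((u N : V0) - (l : V0))) n; rewrite subKr => /le_trans; apply.
    rewrite lerD2l -scaleN1r row_sqrZ modcN modc1 expr1n mul1r //.
  by rewrite big_split /= -!mulr_sumr; apply: lerD; rewrite ler_wpM2l ?HB ?HN.
exists (Ell2 lP); apply/cvgrPdist_lt => e e0.
have [N HN] := near_l (e / 2) (divr_gt0 e0 (ltr0n R 2)).
exists N => // m /= Nm; rewrite sub0r normrN ger0_norm ?sqrtr_ge0 //.
apply: (@le_lt_trans _ _ (e / 2)); last by lra.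
apply: ell2_norm_le; first by rewrite divr_ge0 // ltW.
exact: HN.
Qed.

Lemma ell2_hilbert : hilbert ell2_ip [set: ell2].
Proof.
split.
- by split.
- by move=> a u v w _ _ _; exact: ell2_ip_linear.
- by move=> u v _ _; exact: ell2_ip_conj.
- by move=> u _; exact: ell2_definite.
- by move=> u _ /ell2_complete[l Hl]; exists l.
Qed.

End EllTwo.

(** * The normal operator *)

Section BilateralShift.
Variables (R : realType) (d : nat) (lam : 'I_d -> R).
Hypothesis lam01 : forall i, 0 <= lam i <= 1.
Local Notation C := R[i].
Local Notation I := ('I_d * bool)%type.
Local Notation V0 := (nat -> I -> C^o).
Local Notation ell2 := (ell2 R I).

(* The direct sum over [i] of [lam i] times the bilateral shift: the entries
   with [true] are the coordinates of nonnegative index, in increasing order,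
   those with [false] the coordinates of negative index, in decreasing order. *)
Definition bilateral (x : V0) : V0 := fun n ib =>
  (lam ib.1)%:C * (if ib.2 then (if n is n'.+1 then x n' (ib.1, true) else x 0%N (ib.1, false))
                   else x n.+1 (ib.1, false)).

Definition bilateral_adj (x : V0) : V0 := fun n ib =>
  (lam ib.1)%:C * (if ib.2 then x n.+1 (ib.1, true)
    else (if n is n'.+1 then x n' (ib.1, false) else x 0%N (ib.1, true))).

Definition flip_rows (x : V0) : V0 := fun n ib => x n (ib.1, ~~ ib.2).

Lemma bilateral_adjE x : bilateral_adj x = flip_rows (bilateral (flip_rows x)).
Proof.
by apply/funext => -[|n]; apply/funext => -[i []].
Qed.

Lemma big_pair_bool (T : nmodType) (F : I -> T) :
  \sum_ib F ib = \sum_i F (i, true) + \sum_i F (i, false).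
Proof.
rewrite (eq_bigr (fun p => F (p.1, p.2))); last by case.
rewrite -(pair_bigA _ (fun i b => F (i, b))) /= -big_split /=.
by apply: eq_bigr => i _; rewrite big_bool.
Qed.

Lemma row_sqr_flip (x : V0) n : row_sqr (flip_rows x) n = row_sqr x n.
Proof. by rewrite /row_sqr !big_pair_bool addrC. Qed.

(** The negative half moves one row towards the origin, so [N] rows of the image involve [N.+1] rows
    of [x]. *)
Lemma bilateral_sum_le (x : V0) N :
  \sum_(n < N) row_sqr (bilateral x) n <= \sum_(n < N.+1) row_sqr x n.
Proof.
pose g b n : R := \sum_i modc (x n (i, b)) ^+ 2.
have g0 b n : 0 <= g b n by apply: sumr_ge0 => i _; rewrite sqr_ge0.
have E n : row_sqr x n = g true n + g false n by rewrite /row_sqr big_pair_bool.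
have le_lam (z : C) i : modc ((lam i)%:C * z) ^+ 2 <= modc z ^+ 2.
  have /andP[l0 l1] := lam01 i.
  rewrite lerXn2r ?nnegrE ?modc_ge0 // modcM modcR ger0_norm //.
  by rewrite ler_piMl ?modc_ge0.
have B n : row_sqr (bilateral x) n <=
    (if n is n'.+1 then g true n' else g false 0%N) + g false n.+1.
  rewrite /row_sqr big_pair_bool; apply: lerD.
    by case: n => [|n]; apply: ler_sum => i _; exact: le_lam.
  by apply: ler_sum => i _; exact: le_lam.
case: N => [|N]; first by rewrite big_ord0 sumr_ge0 // => n _; exact: row_sqr_ge0.
apply: (@le_trans _ _ (\sum_(n < N) g true n + \sum_(n < N.+2) g false n)).
  elim: N => [|N IH].
    by rewrite big_ord1 big_ord0 2!big_ord_recr big_ord0 /= !add0r; exact: (B 0%N).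
  rewrite big_ord_recr /= [X in _ <= X + _]big_ord_recr /= [X in _ <= _ + X]big_ord_recr /=.
  by have := B N.+1; lra.
under [leRHS]eq_bigr do rewrite E.
rewrite big_split lerD2r !big_ord_recr /= -addrA lerDl addr_ge0 //.
Qed.

Lemma bilateral_in (x : ell2) : bilateral x \in @square_summable R I.
Proof.
have [B HB] := ell2_bounded x; apply/asboolP; exists B => N.
exact: le_trans (bilateral_sum_le x N) (HB _).
Qed.

Lemma bilateral_adj_in (x : ell2) : bilateral_adj x \in @square_summable R I.
Proof.
have [B HB] := ell2_bounded x; apply/asboolP; exists B => N.
rewrite bilateral_adjE; under eq_bigr do rewrite row_sqr_flip.
apply: le_trans (bilateral_sum_le _ N) _.
by under eq_bigr do rewrite row_sqr_flip.
Qed.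

Definition shiftN (x : ell2) : ell2 := Ell2 (bilateral_in x).
Definition shiftNadj (x : ell2) : ell2 := Ell2 (bilateral_adj_in x).

Lemma shiftN_bounded :
  bounded_operator (@ell2_ip R I) (@ell2_ip R I) [set: ell2] [set: ell2] shiftN.
Proof.
split => // [a u v _ _|].
  apply: ell2_ext => n [i b]; rewrite ell2_linE.
  change (bilateral (ell2_val (a *: u + v)) n (i, b) =
    a * bilateral u n (i, b) + bilateral v n (i, b)).
  rewrite ell2_linE /bilateral /=.
  case: b; [case: n => [|n]|];
  match goal with |- _ * ((_ + _) ?m ?ib) = _ =>
    change ((a *: (ell2_val u : V0) + (ell2_val v : V0)) m ib) with (a * u m ib + v m ib) end;
  ring.
exists 1 => u _; rewrite mul1r; apply: ell2_norm_le; first exact: sqrtr_ge0.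
move=> N; rewrite ell2_norm_sqr.
exact: le_trans (bilateral_sum_le u N) (ell2_sum_le u N.+1).
Qed.

Lemma shiftNadj_bounded :
  bounded_operator (@ell2_ip R I) (@ell2_ip R I) [set: ell2] [set: ell2] shiftNadj.
Proof.
split => // [a u v _ _|].
  apply: ell2_ext => n [i b]; rewrite ell2_linE.
  change (bilateral_adj (ell2_val (a *: u + v)) n (i, b) =
    a * bilateral_adj u n (i, b) + bilateral_adj v n (i, b)).
  rewrite ell2_linE /bilateral_adj /=.
  case: b; [|case: n => [|n]];
  match goal with |- _ * ((_ + _) ?m ?ib) = _ =>
    change ((a *: (ell2_val u : V0) + (ell2_val v : V0)) m ib) with (a * u m ib + v m ib) end;
  ring.
exists 1 => u _; rewrite mul1r; apply: ell2_norm_le; first exact: sqrtr_ge0.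
move=> N; rewrite ell2_norm_sqr /= bilateral_adjE.
under eq_bigr do rewrite row_sqr_flip.
apply: le_trans (bilateral_sum_le _ N) _.
under eq_bigr do rewrite row_sqr_flip.
exact: ell2_sum_le.
Qed.

Lemma ell2_rows_cvg0 (x : ell2) : row_sqr x n @[n --> \oo] --> (0 : R).
Proof.
have c := @ell2_self_cvg _ _ x; apply: (@cvg_series_cvg_0 _ R^o (row_sqr x)).
by apply/cvg_ex; eexists; rewrite seriesEord; exact: c.
Qed.

(** Partial sums of the two sides differ by a boundary term, [B K - A K], which tends to 0 because
    the rows of [x] and [y] do. *)
Lemma shift_adjoint (x y : ell2) : ell2_ip (shiftN x) y = ell2_ip x (shiftNadj y).
Proof.
pose A n : C := \sum_i (lam i)%:C * (x n (i, true) * conjc (y n.+1 (i, true))).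
pose B n : C := \sum_i (lam i)%:C * (x n.+1 (i, false) * conjc (y n (i, false))).
pose Z : C := \sum_i (lam i)%:C * (x 0%N (i, false) * conjc (y 0%N (i, true))).
have E1 n : row_dot (shiftN x) y n = (if n is n'.+1 then A n' else Z) + B n.
  rewrite /row_dot big_pair_bool; congr (_ + _).
    by case: n => [|n]; apply: eq_bigr => i _; rewrite mulrA.
  by apply: eq_bigr => i _; rewrite mulrA.
have E2 n : row_dot x (shiftNadj y) n = A n + (if n is n'.+1 then B n' else Z).
  rewrite /row_dot big_pair_bool; congr (_ + _).
    by apply: eq_bigr => i _; rewrite conjc_realM mulrCA.
  by case: n => [|n]; apply: eq_bigr => i _; rewrite conjc_realM mulrCA.
have D K : \sum_(n < K.+1) row_dot (shiftN x) y n -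
    \sum_(n < K.+1) row_dot x (shiftNadj y) n = B K - A K.
  elim: K => [|K IH]; first by rewrite !big_ord1 E1 E2 /=; ring.
  rewrite big_ord_recr [X in _ - X]big_ord_recr E1 E2 /=.
  have -> : B K.+1 - A K.+1 = (B K - A K) + (A K + B K.+1 - (A K.+1 + B K)) by ring.
  by rewrite -IH; ring.
apply/eqP; rewrite -subr_eq0; apply/eqP/modc_eq0/eqP; rewrite eq_le modc_ge0 andbT.
apply: (@le_of_le_addM _ _ _ 8) => e e0.
have /cvg_complexP/(_ e e0)[N1 H1] := @ell2_ip_cvg _ _ (shiftN x) y.
have /cvg_complexP/(_ e e0)[N2 H2] := @ell2_ip_cvg _ _ x (shiftNadj y).
have /cvgrPdist_lt/(_ e e0)[N3 _ H3] := ell2_rows_cvg0 x.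
have /cvgrPdist_lt/(_ e e0)[N4 _ H4] := ell2_rows_cvg0 y.
pose K := (N1 + N2 + N3 + N4)%N.
have {}H1 := H1 K.+1 (ltac:(rewrite /K; lia)).
have {}H2 := H2 K.+1 (ltac:(rewrite /K; lia)).
have small (z : ell2) n : `|0 - row_sqr z n| < e -> row_sqr z n < e.
  by rewrite sub0r normrN ger0_norm // row_sqr_ge0.
have X1 := small _ _ (H3 K (ltac:(rewrite /= /K; lia))).
have X2 := small _ _ (H3 K.+1 (ltac:(rewrite /= /K; lia))).
have Y1 := small _ _ (H4 K (ltac:(rewrite /= /K; lia))).
have Y2 := small _ _ (H4 K.+1 (ltac:(rewrite /= /K; lia))).
have bnd n m b : modc (\sum_i (lam i)%:C * (x n (i, b) * conjc (y m (i, b)))) <=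
    row_sqr x n + row_sqr y m.
  rewrite (le_trans (modc_sum _ _ _)) // /row_sqr !big_pair_bool.
  apply: (@le_trans _ _ (\sum_i (modc (x n (i, b)) ^+ 2 + modc (y m (i, b)) ^+ 2))).
    apply: ler_sum => i _; rewrite !modcM modcJ modcR.
    have /andP[l0 l1] := lam01 i; rewrite ger0_norm //.
    set u := modc _; set v := modc _.
    have u0 : 0 <= u := modc_ge0 _; have v0 : 0 <= v := modc_ge0 _.
    apply: (@le_trans _ _ (u * v)); first by rewrite ler_piMl // mulr_ge0.
    have := sqr_ge0 (u - v); rewrite sqrrB; have := mulr_ge0 u0 v0.
    rewrite mulr2n; lra.
  rewrite big_split /=.
  have P (z : V0) k b' : 0 <= \sum_i modc (z k (i, b')) ^+ 2.
    by apply: sumr_ge0 => i _; rewrite sqr_ge0.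
  have := P x n true; have := P x n false; have := P y m true; have := P y m false.
  by case: b; lra.
have BK := bnd K.+1 K false; have AK := bnd K K.+1 true.
have DK := congr1 (@modc R) (D K).
have := modcB (B K) (A K); rewrite -DK -/(B K) -/(A K) in BK AK *.
set s1 := \sum_(n < K.+1) row_dot (shiftN x) y n in H1 DK *.
set s2 := \sum_(n < K.+1) row_dot x (shiftNadj y) n in H2 DK *.
have -> : ell2_ip (shiftN x) y - ell2_ip x (shiftNadj y) =
  (s1 - s2) - ((s1 - ell2_ip (shiftN x) y) - (s2 - ell2_ip x (shiftNadj y))) by ring.
have T1 := modcB (s1 - s2) ((s1 - ell2_ip (shiftN x) y) - (s2 - ell2_ip x (shiftNadj y))).
have T2 := modcB (s1 - ell2_ip (shiftN x) y) (s2 - ell2_ip x (shiftNadj y)).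
move=> T3; lra.
Qed.

Lemma shiftN_normal : normal_operator (@ell2_ip R I) [set: ell2] shiftN.
Proof.
split; first exact: shiftN_bounded.
exists shiftNadj; first by split; [exact: shiftNadj_bounded|move=> u v _ _; exact: shift_adjoint].
move=> u _; apply: ell2_ext => n [i b] /=.
by rewrite /bilateral /bilateral_adj /=; case: b; case: n => [|n] /=; ring.
Qed.

End BilateralShift.

(** * The isometric embedding of a shift *)

Section SubnormalShift.
Variables (R : realType) (V : lmodType R[i]) (ip : V -> V -> R[i]).
Local Notation C := R[i].
Variables (M : set V) (T : V -> V) (u : nat -> V) (alpha : nat -> R).
Variables (d : nat) (c t : 'I_d -> R).
Hypothesis siM : semi_inner ip M.
Hypothesis onb : orthonormal_basis ip M u.
Hypothesis Tb : bounded_operator ip ip M M T.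
Hypothesis T0 : forall f, M f -> ip (T f) (u 0%N) = 0.
Hypothesis TS : forall f n, M f -> ip (T f) (u n.+1) = (alpha n)%:C * ip f (u n).
Hypothesis alpha_gt0 : forall n, 0 < alpha n.
Hypothesis t01 : forall i, 0 <= t i <= 1.
Hypothesis c_ge0 : forall i, 0 <= c i.
Hypothesis moments : forall n, moment alpha n = \sum_i c i * t i ^+ n.
Local Notation I := ('I_d * bool)%type.
Local Notation ell2 := (ell2 R I).

Let Mu n : M (u n). Proof. by case: onb. Qed.
(** Moments are products of squared weights, so an atom at [t i] comes from a shift scaled by the
    square root. *)
Let lam i := Num.sqrt (t i).
Let lam01 i : 0 <= lam i <= 1.
Proof.
have /andP[t0 t1] := t01 i.
by rewrite sqrtr_ge0 /= -[leRHS]sqrtr1 ler_wsqrtr.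
Qed.

Let gamma_gt0 n : 0 < moment alpha n.
Proof. by apply: prodr_gt0 => j _; rewrite exprn_gt0. Qed.

(* [u n] is sent to the vector with entries [rho n i] in position [n], so that
   multiplying by [lam i] and shifting amounts to applying [T]. *)
Let rho n i := Num.sqrt (c i / moment alpha n) * lam i ^+ n.

Let rho_ge0 n i : 0 <= rho n i.
Proof. by rewrite mulr_ge0 ?exprn_ge0 ?sqrtr_ge0. Qed.

(** Here the moment representation enters; it is what makes the embedding isometric. *)
Let rho_sqr n : \sum_i rho n i ^+ 2 = 1.
Proof.
transitivity ((\sum_i c i * t i ^+ n) / moment alpha n); last first.
  by rewrite -moments divff // gt_eqF.
rewrite mulr_suml; apply: eq_bigr => i _.
have /andP[t0 t1] := t01 i.
rewrite exprMn sqr_sqrtr; last by rewrite divr_ge0 // ltW.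
by rewrite exprAC /lam sqr_sqrtr // mulrAC.
Qed.

Let alpha_rho n i : alpha n * rho n.+1 i = lam i * rho n i.
Proof.
have a0 := alpha_gt0 n; have g0 := gamma_gt0 n.
have E : alpha n * Num.sqrt (c i / moment alpha n.+1) = Num.sqrt (c i / moment alpha n).
  rewrite -{1}[alpha n](gtr0_norm a0) -sqrtr_sqr -sqrtrM ?sqr_ge0 //; congr Num.sqrt.
  have -> : moment alpha n.+1 = moment alpha n * alpha n ^+ 2 by rewrite /moment big_ord_recr.
  by field; rewrite !gt_eqF.
transitivity (alpha n * Num.sqrt (c i / moment alpha n.+1) * (lam i * lam i ^+ n)).
  by rewrite /rho exprS !mulrA.
by rewrite E /rho; ring.
Qed.

Definition berger_embedding_raw (f : V) : nat -> I -> C^o :=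
  fun n ib => if ib.2 then ip f (u n) * (rho n ib.1)%:C else 0.

Lemma berger_row_sqr f n : row_sqr (berger_embedding_raw f) n = modc (ip f (u n)) ^+ 2.
Proof.
rewrite /row_sqr big_pair_bool /= [X in _ + X]big1 ?addr0; last first.
  by move=> i _; rewrite modc0 expr0n.
rewrite -[RHS]mulr1 -(rho_sqr n) mulr_sumr; apply: eq_bigr => i _.
by rewrite modcM modcR ger0_norm // exprMn.
Qed.

Lemma berger_embedding_in f : M f -> berger_embedding_raw f \in @square_summable R I.
Proof.
move=> Mf; apply/asboolP; exists (ipnorm ip f ^+ 2) => N.
under eq_bigr do rewrite berger_row_sqr.
exact: (bessel siM onb N Mf).
Qed.

(** The embedding has to be a total map; [insubd] returns 0 where the coefficients fail to be
    square-summable. *)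
Definition berger_embedding f : ell2 := insubd (0 : ell2) (berger_embedding_raw f).

Lemma berger_embeddingE f : M f ->
  ell2_val (berger_embedding f) = berger_embedding_raw f.
Proof. by move=> Mf; rewrite -[LHS]/(val _) insubdK // -topredE /= berger_embedding_in. Qed.

(** The sufficiency half of Berger's theorem for a finitely atomic measure. *)
Lemma subnormal_of_moments : subnormal ip M T.
Proof.
split => //; exists ell2, (@ell2_ip R I), (shiftN lam01), berger_embedding; split.
- exact: ell2_hilbert.
- exact: shiftN_normal.
- move=> a f g Mf Mg; apply: ell2_ext => n [i b].
  rewrite ell2_linE (berger_embeddingE (si_lin siM a Mf Mg)).
  rewrite (berger_embeddingE Mf) (berger_embeddingE Mg).
  change (berger_embedding_raw (a *: f + g) n (i, b) =
    a * berger_embedding_raw f n (i, b) + berger_embedding_raw g n (i, b)).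
  rewrite /berger_embedding_raw /=; case: b; last by rewrite mulr0 addr0.
  by rewrite (si_linear siM) // mulrDl mulrA.
- move=> f g Mf Mg; apply: ell2_ip_unique; apply/cvg_complexP => e e0.
  have [N HN] := parseval siM onb Mf Mg (divr_gt0 e0 (ltr0n R 2)).
  exists N => K /HN; rewrite modc_distC; set s := (X in modc (_ - X)) => h.
  have -> : \sum_(n < K) row_dot (berger_embedding f) (berger_embedding g) n = s.
    apply: eq_bigr => n _; rewrite (berger_embeddingE Mf) (berger_embeddingE Mg).
    rewrite /row_dot big_pair_bool /= [X in _ + X]big1 ?addr0; last first.
      by move=> i _; rewrite mul0r.
    rewrite -[RHS]mulr1 -[1]/((1 : R)%:C) -(rho_sqr n) rmorph_sum mulr_sumr.
    apply: eq_bigr => i _; rewrite /berger_embedding_raw /=.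
    rewrite [ip g _ * _]mulrC conjc_realM.
    have -> : (rho n i ^+ 2)%:C = (rho n i)%:C * (rho n i)%:C by exact: rmorphXn.
    by move: (rho n i)%:C => r; ring.
  by apply: le_lt_trans h _; lra.
- move=> f Mf; have MTf : M (T f) by case: Tb => + _ _; apply.
  apply: ell2_ext => n [i b] /=.
  rewrite (berger_embeddingE MTf) /bilateral (berger_embeddingE Mf).
  rewrite /berger_embedding_raw /=; case: b; last by rewrite mulr0.
  case: n => [|n]; first by rewrite mulr0 T0 // mul0r.
  have E : (lam i)%:C * (rho n i)%:C = (alpha n)%:C * (rho n.+1 i)%:C.
    by rewrite -[LHS](rmorphM (real_complex R)) -alpha_rho; exact: (rmorphM (real_complex R)).
  by rewrite TS // mulrCA E; ring.
Qed.

End SubnormalShift.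

(** * H-Toeplitz operators *)

Section HToeplitz.
Variables (R : realType) (s : nat).
Local Notation C := R[i].
Local Notation V := (C -> C^o).
Variables P K Bstar : V -> V.
Hypothesis projP : bergman_projection P.
Hypothesis opK : K_operator K.
Local Notation B := (H_Toeplitz P K (@symbol R s)).
Hypothesis adjB : is_adjoint (@dot R) (@bergman R) B Bstar.
Implicit Types f g h : V.

Let siL := L2disk_semi_inner R.
Let siB := bergman_semi_inner R.
Let mon_B := @monomial_bergman R.

Lemma L2disk_symbol_mul h : L2disk h -> L2disk (fun z => symbol s z * h z).
Proof.
apply: (@L2disk_mul _ _ _ 1); first exact: cmeasurable_monomial.
by move=> z /disk_modc z1; exact: modc_monomial_le1.
Qed.

Lemma K_L2disk f : bergman f -> L2disk (K f).
Proof. by case: opK => -[HK _ _] _ _ /HK[]. Qed.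

Lemma H_Toeplitz_bergman f : bergman f -> bergman (B f).
Proof. by move=> /K_L2disk/L2disk_symbol_mul/projP[]. Qed.

(** Against a Bergman function the projection disappears, which reduces matrix entries to integrals
    of monomials. *)
Lemma H_Toeplitz_dot f g : bergman f -> bergman g ->
  dot (B f) g = dot (fun z => symbol s z * K f z) g.
Proof.
move=> Bf Bg; have LK := L2disk_symbol_mul (K_L2disk Bf).
have [[LP _] /(_ g Bg)] := projP LK; have [Lg _] := Bg.
by rewrite (ipBl siL) // => /eqP; rewrite subr_eq0 => /eqP ->.
Qed.

Lemma symbol_monomial n : (fun z => symbol s z * monomial n z) =
  (Num.sqrt n.+1%:R)%:C *: (zmonomial (s + n) s 1 : V).
Proof.
apply/funext => z; rewrite /monomial norm_modc ltcR /symbol.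
transitivity ((Num.sqrt n.+1%:R)%:C * zmonomial (s + n) s 1 z) => //.
by rewrite /zmonomial; case: ifP => _; rewrite ?mulr0 // exprD; move: (conjc z) => z'; ring.
Qed.

Lemma symbol_conj_monomial n : (fun z => symbol s z * conjf (@monomial R n) z) =
  (Num.sqrt n.+1%:R)%:C *: (zmonomial s (s + n) 1 : V).
Proof.
apply/funext => z; rewrite /conjf /monomial norm_modc ltcR /symbol.
transitivity ((Num.sqrt n.+1%:R)%:C * zmonomial s (s + n) 1 z) => //.
rewrite /zmonomial; case: ifP => _; last by rewrite rmorph0 !mulr0.
by rewrite conjc_realM rmorphXn /= exprD; move: (conjc z) => z'; ring.
Qed.

Lemma H_Toeplitz_even n m :
  dot (B (monomial n.*2)) (monomial m) = (bergman_weight R s n)%:C *+ (n == m).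
Proof.
rewrite H_Toeplitz_dot //; case: opK => _ -> _.
have Lz k a b : L2disk (k *: (zmonomial a b 1 : V)).
  by apply: si_scale siL _ _ _; exact: L2disk_zmonomial.
have Lz' a b : L2disk (zmonomial a b 1 : V) by exact: L2disk_zmonomial.
rewrite symbol_monomial monomialE (ipZl siL) // (ipZr siL) //.
have [<-|nm] := eqVneq n m; last first.
  by rewrite dot_zmonomial_neq ?mulr0 // addn0 eqn_add2l.
rewrite dot_zmonomial_eq ?addn0 // !expr1n mulr1n; simpc; congr (_ +i* _).
by rewrite mulrA -expr2 sqr_sqrtr // /bergman_weight addSn addnC ?mul1r.
Qed.

Lemma H_Toeplitz_odd n m : dot (B (monomial n.*2.+1)) (monomial m) = 0.
Proof.
rewrite H_Toeplitz_dot //; case: opK => _ _ ->.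
have Lz k a b : L2disk (k *: (zmonomial a b 1 : V)).
  by apply: si_scale siL _ _ _; exact: L2disk_zmonomial.
have Lz' a b : L2disk (zmonomial a b 1 : V) by exact: L2disk_zmonomial.
rewrite symbol_conj_monomial monomialE (ipZl siL) // (ipZr siL) //.
by rewrite dot_zmonomial_neq ?mulr0 // addn0; lia.
Qed.

(** The coefficients of [Bstar (monomial n)] are conjugates of entries of the matrix of [B];
    definiteness and the basis turn them into an equality of vectors. *)
Lemma adjoint_monomial n :
  Bstar (monomial n) = (bergman_weight R s n)%:C *: @monomial R n.*2.
Proof.
have [[HB _ _] adj] := adjB.
have BT := HB _ (mon_B n); have Bw := si_scale siB (bergman_weight R s n)%:C (mon_B n.*2).
apply: (coef_ext siB (@bergman_definite R) (monomial_basis R)) => // m.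
rewrite (ipC siB BT (mon_B m)) -(adj _ _ (mon_B m) (mon_B n)).
rewrite (ipZl siB _ (mon_B _) (mon_B _)) monomial_orthonormal.
rewrite -(odd_double_half m); case: (odd m); rewrite ?add1n ?add0n.
  by rewrite H_Toeplitz_odd rmorph0; case: eqP => [E|_]; rewrite ?mulr0 //; lia.
rewrite H_Toeplitz_even; have [->|nm] := eqVneq m./2 n.
  by rewrite eqxx mulr1; simpc.
by rewrite rmorph0; case: eqP => [/double_inj E|_]; rewrite ?mulr0 //; case/eqP: nm.
Qed.

Lemma adjoint_summand_subnormal k i : s = (2 ^ k - 1)%N ->
  subnormal (@dot R) (dyadic_space (@dot R) (@bergman R) (@monomial R) (Some i)) Bstar.
Proof.
move=> sk; have def := @bergman_definite R; have onb := monomial_basis R.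
have HB := H_Toeplitz_bergman; have Te := adjoint_monomial.
have [d [c [c0 mom]]] := bergman_moments_atomic R k (ltn0Sn i.*2).
apply: (subnormal_of_moments (t := fun i => 2^-1 ^+ i)
  (dyadic_semi_inner siB onb (Some i)) (dyadic_basis siB onb i) _ _ _ _ _ c0 mom).
- apply: (bounded_of_invariant siB def onb (bergman_weight_gt0 R s)
    (bergman_weight_le1 R s) HB adjB Te); first by move=> f [].
  by move=> f; exact: (dyadic_T siB def onb HB adjB Te).
- by move=> f [Bf _]; rewrite expn0 muln1 (T_coef_odd siB def onb HB adjB Te).
- move=> f n [Bf _]; rewrite expnSr mulnA muln2 -sk.
  by rewrite (T_coef_even siB def onb HB adjB Te).
- by move=> n; exact: bergman_weight_gt0.
- by move=> j; rewrite exprn_ge0 ?invr_ge0 //= exprn_ile1 ?invr_ge0 // invf_le1 // ler1n.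
Qed.

End HToeplitz.

Theorem theorem1p8 (R : realType) (s : nat)
    (P K Bstar : (R[i] -> (R[i])^o) -> (R[i] -> (R[i])^o)) :
  (0 < s)%N ->
  bergman_projection P ->
  K_operator K ->
  let B := H_Toeplitz P K (@symbol R s) in
  is_adjoint (@dot R) (@bergman R) B Bstar ->
  [/\ forall k : nat, (0 < k)%N -> s = (2 ^ k - 1)%N ->
        normal_plus_shifts (@dot R) (@bergman R) Bstar
          (fun M _ => subnormal (@dot R) M Bstar),
      forall k : nat, (0 < k)%N -> (2 ^ k - 1 < s < 2 ^ k.+1 - 1)%N ->
        normal_plus_shifts (@dot R) (@bergman R) Bstar
          (fun _ alpha => k_hyponormal alpha k),
      ~ hyponormal (@dot R) (@bergman R) B,
      contractive (@dot R) (@bergman R) Bstar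
    & contractive (@dot R) (@bergman R) B].
Proof.
move=> _ projP opK B adjB.
have siB := bergman_semi_inner R; have def := @bergman_definite R.
have onb := monomial_basis R; have w0 := bergman_weight_gt0 R s.
have w1 := bergman_weight_le1 R s.
have HB := H_Toeplitz_bergman s projP opK.
have Te := adjoint_monomial projP opK adjB.
split.
- move=> k _ sk; apply: (doubling_normal_plus_shifts siB def onb w0 w1 HB adjB Te) => i.
  exact: adjoint_summand_subnormal projP opK adjB _ i sk.
- move=> k _ /andP[ks _].
  apply: (doubling_normal_plus_shifts siB def onb w0 w1 HB adjB Te) => i.
  by apply: bergman_k_hyponormal => //; lia.
- exact: (halving_not_hyponormal siB def onb w0 HB adjB Te).
- exact: (doubling_contractive siB def onb w0 w1 HB adjB Te).
- exact: (halving_contractive siB def onb w0 w1 HB adjB Te).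
Qed.
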